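(* Let $f\in\mathcal G^+[1]$, i.e. $f\in\mathcal G$ satisfies $f(1)=0$ and $f'(1)=\beta>0$. Then for each $\mu\in\mathbb C$ such that $|\mu-\beta|\le\beta$, $\mu\ne0$, and for all $\tau\in\Delta$, there exist generators $f_\tau\in\mathcal G[\tau]$ such that $f_\tau'(\tau)=\mu$ for all $\tau\in\Delta$ and $f_\tau$ converges to $f$ uniformly on compact subsets of $\Delta$ as $\tau$ tends to $1$ unrestrictedly. In particular, setting $\mu=\beta$ we have $f_\tau'(\tau)=\beta\in(0,\infty)$ for all $\tau\in\Delta$.
   Context: $\Delta=\{z\in\mathbb C:|z|<1\}$; $\angle\lim$ denotes the angular (non-tangential) limit. A one-parameter continuous semigroup is a family $\{F_t\}_{t\ge0}$ of holomorphic self-mappings of $\Delta$ with $F_{t+s}=F_t\circ F_s$ for $t,s\ge0$, $F_0=\mathrm{id}$, and $\lim_{t\to s}F_t(z)=F_s(z)$ for all $z\in\Delta$, $s\ge0$. Its generator is $f(z)=\lim_{t\to0^+}\frac{z-F_t(z)}{t}$ (which exists and is holomorphic on $\Delta$); $F_t$ is recovered as the solution of $\frac{\partial F_t(z)}{\partial t}+f(F_t(z))=0$, $F_0(z)=z$. $\mathcal G$ is the set of all such generators. For $\tau\in\overline\Delta$, $\mathcal G[\tau]$ is the set of $f\in\mathcal G$ whose generated semigroup has Denjoy–Wolff point $\tau$, i.e. $\lim_{t\to\infty}F_t(z)=\tau$ for all $z\in\Delta$. $\mathcal G^+[1]$ is the set of $f\in\mathcal G$ with $f(1):=\angle\lim_{z\to1}f(z)=0$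 and $f'(1):=\angle\lim_{z\to1}\frac{f(z)}{z-1}=\beta>0$. ''$\tau\to1$ unrestrictedly'' means $\tau\in\Delta$, $|\tau-1|\to0$, with no restriction on the manner of approach. *)

(* Defs.v *)
From Stdlib Require Import Reals List.
From Coquelicot Require Import Coquelicot.

Open Scope R_scope.
Open Scope C_scope.

(* Functions on the disc are total functions [C -> C]; only their values on
   [unit_disc] matter. *)
Definition unit_disc (z : C) : Prop := Cmod z < 1.

Definition holomorphic_on_disc (f : C -> C) : Prop :=
  forall z : C, unit_disc z -> @ex_derive C_AbsRing C_NormedModule f z.

Definition stolz_region (zeta : C) (k : R) (z : C) : Prop :=
  unit_disc z /\ (Cmod (z - zeta) < k * (1 - Cmod z))%R.

Definition angular_lim (f : C -> C) (zeta l : C) : Prop :=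
  forall k : R, 1 < k ->
    filterlim f (within (stolz_region zeta k) (locally zeta)) (locally l).

Record continuous_semigroup (F : R -> C -> C) : Prop := {
  semigroup_holomorphic :
    forall t : R, 0 <= t -> holomorphic_on_disc (F t);
  semigroup_self_map :
    forall (t : R) (z : C), 0 <= t -> unit_disc z -> unit_disc (F t z);
  semigroup_add :
    forall (t s : R) (z : C), 0 <= t -> 0 <= s -> unit_disc z ->
      F (t + s)%R z = F t (F s z);
  semigroup_id :
    forall z : C, unit_disc z -> F 0%R z = z;
  semigroup_continuous :
    forall (s : R) (z : C), 0 <= s -> unit_disc z ->
      filterlim (fun t : R => F t z)
        (within (fun t : R => 0 <= t) (locally s)) (locally (F s z))
}.

Definition is_generator_of (f : C -> C) (F : R -> C -> C) : Prop :=
  forall z : C, unit_disc z ->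
    filterlim (fun t : R => (z - F t z) / RtoC t) (at_right 0%R) (locally (f z)).

Definition generator (f : C -> C) : Prop :=
  exists F : R -> C -> C, continuous_semigroup F /\ is_generator_of f F.

(* A generator determines its semigroup on the disc, so the existential
   quantifier speaks of the semigroup generated by [f]. *)
Definition generator_DW (tau : C) (f : C -> C) : Prop :=
  exists F : R -> C -> C,
    continuous_semigroup F /\ is_generator_of f F /\
    forall z : C, unit_disc z ->
      filterlim (fun t : R => F t z) (Rbar_locally p_infty) (locally tau).

(* [f] is in G^+[1] with f'(1) = beta. *)
Definition generator_plus_one (beta : R) (f : C -> C) : Prop :=
  generator f /\
  angular_lim f 1 0 /\
  angular_lim (fun z : C => f z / (z - 1)) 1 (RtoC beta) /\
  0 < beta.

(* Coquelicot has no compactness predicate for subsets of C. *)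
Definition compact_set (K : C -> Prop) : Prop :=
  forall (I : Type) (U : I -> C -> Prop),
    (forall i : I, open (U i)) ->
    (forall z : C, K z -> exists i : I, U i z) ->
    exists s : list I, forall z : C, K z -> exists i : I, In i s /\ U i z.

(* The family [g], indexed by the disc, tends to [f] uniformly on compact
   subsets of the disc as the index tends to [zeta] unrestrictedly. *)
Definition locally_uniform_lim (g : C -> C -> C) (f : C -> C) (zeta : C) : Prop :=
  forall K : C -> Prop, compact_set K -> (forall z : C, K z -> unit_disc z) ->
    forall eps : R, 0 < eps ->
      within unit_disc (locally zeta)
        (fun tau : C => forall z : C, K z -> Cmod (g tau z - f z) < eps).

(* Main.v *)
(* Write [f z = - (1 - z)^2 p z].  Differentiating Schwarz-Pick along the
   semigroup at the pair [z, w] and letting [w -> 1] radially turns the angular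
   derivative [beta] into [p z = (beta / 2) (1 + z) / (1 - z) + q z] with
   [Re q >= 0].  Conversely, whenever [Re p >= eta > 0], the field
   [(z - tau) (1 - conj tau z) p z] generates a semigroup with Denjoy-Wolff
   point [tau] and derivative [(1 - |tau|^2) p tau] there.  Hence one may take
   [p_tau z = c (beta / 2) (1 + a z) / (1 - a z) + q (rho z) + eta]
   with [c > 1], [rho < 1], [eta > 0] close to [1], [1], [0], and with [a] near
   [1] in the closed disc solving [(1 - |tau|^2) p_tau tau = mu].  As [q (rho z)]
   is bounded, [s = 1 - |tau|^2] tends to [0], and [s / (1 - a tau)] must be close
   to [mu / (c beta)], which lies strictly inside [|w - 1| < 1] because
   [|mu - beta| <= beta], [mu <> 0] and [c > 1], this equation has such a
   solution as soon as [tau] is close to [1].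

   Cauchy's theorem is only needed on circles: Goursat's bisection for
   [H (exp w)] on a rectangle of height [2 pi] makes circle means independent
   of the radius. *)

Require Import Defs.
From Stdlib Require Import ssreflect Reals Lra Lia ClassicalEpsilon Classical List.
From Coquelicot Require Import Coquelicot.

Local Open Scope general_if_scope.
Local Open Scope C_scope.

(** * Limits and complex derivatives *)

(** The hypotheses are pointwise: [is_generator_of] is a limit at each point, holomorphy is bare
    complex differentiability, and that of [f] itself has to be proved. Regularity is therefore
    carried by a two-variable divided difference with explicit bounds, obtained from Cauchy's
    formula. It yields removable singularities, holomorphy of pointwise limits, Lipschitz fields for
    the differential equation, and an exact formula for the difference of two trajectories, from
    which holomorphy of the flow in its initial value is read off.

    The dilation [q (rho z)] is there because [q] may be unbounded near [1], where [p_tau] must be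
    evaluated; for fixed [rho] the term [s * q (rho tau)] tends to [0]. The parameter [a] absorbs
    what is left, so that the derivative is exactly [mu].

    Accuracy and distance to [1] are related by a [delta] without formula, and far from [1] no
    approximation is available. Hence each [tau] gets the best approximation attainable at its
    distance, and a generator with constant [p] if there is none. *)

Lemma locally_Cmod (z : C) (P : C -> Prop) :
  locally z P <-> exists d : R, 0 < d /\ forall w, Cmod (w - z) < d -> P w.
Proof.
split.
- intros [d Hd]. exists d. split; [apply cond_pos|].
  intros w Hw. apply Hd.
  apply (C_NormedModule_mixin_compat1 z w d). exact Hw.
- intros [d [Hd H]].
  (* The balls of the product uniform structure are squares; the one of half-side [d / sqrt 2] lies
     in the round disc of radius [d]. *)
  assert (Hs : 0 < d / sqrt 2) by (apply Rdiv_lt_0_compat; [exact Hd | apply Rlt_sqrt2_0]).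
  exists (mkposreal _ Hs). intros w Hw. apply H.
  pose proof (C_NormedModule_mixin_compat2 z w _ Hw) as H1.
  simpl in H1. replace (sqrt 2 * (d / sqrt 2))%R with d in H1; [exact H1|].
  field. apply Rgt_not_eq, Rlt_sqrt2_0.
Qed.

Lemma filterlim_C {T : Type} {F : (T -> Prop) -> Prop} {FF : Filter F}
    (f : T -> C) (l : C) :
  filterlim f F (locally l) <->
  forall eps : R, 0 < eps -> F (fun x => Cmod (f x - l) < eps).
Proof.
split.
- intros H eps He. apply (H (fun y => Cmod (y - l) < eps)).
  apply locally_Cmod. exists eps. auto.
- intros H P HP. apply locally_Cmod in HP. destruct HP as [d [Hd HP]].
  change (F (fun x => P (f x))). apply (filter_imp (fun x => Cmod (f x - l) < d)); [|auto].
  intros x Hx. apply HP, Hx.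
Qed.

Section Limits.

Context {T : Type} {F : (T -> Prop) -> Prop} {FF : Filter F}.
Implicit Types f g : T -> C.

Lemma filterlim_Cplus f g (a b : C) :
  filterlim f F (locally a) -> filterlim g F (locally b) ->
  filterlim (fun x => f x + g x) F (locally (a + b)).
Proof.
intros Hf Hg. apply filterlim_C. intros eps He.
apply filterlim_C with (eps := (eps / 2)%R) in Hf; [|lra].
apply filterlim_C with (eps := (eps / 2)%R) in Hg; [|lra].
apply: filter_imp (filter_and _ _ Hf Hg) => x [H1 H2].
replace (f x + g x - (a + b)) with ((f x - a) + (g x - b)) by ring.
pose proof (Cmod_triangle (f x - a) (g x - b)). lra.
Qed.

Lemma filterlim_Cmult f g (a b : C) :
  filterlim f F (locally a) -> filterlim g F (locally b) ->
  filterlim (fun x => f x * g x) F (locally (a * b)).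
Proof.
intros Hf Hg. apply filterlim_C. intros eps He.
set (M := (1 + Cmod a + Cmod b)%R).
assert (HM : 1 <= M) by (unfold M; pose proof (Cmod_ge_0 a); pose proof (Cmod_ge_0 b); lra).
set (d := Rmin 1 (eps / (2 * M))).
assert (Hq : 0 < eps / (2 * M)) by (apply Rdiv_lt_0_compat; lra).
assert (Hd : 0 < d) by (apply Rmin_pos; lra).
apply filterlim_C with (eps := d) in Hf; [|exact Hd].
apply filterlim_C with (eps := d) in Hg; [|exact Hd].
apply: filter_imp (filter_and _ _ Hf Hg) => x [H1 H2].
replace (f x * g x - a * b) with ((f x - a) * (g x - b) + ((f x - a) * b + a * (g x - b))) by ring.
pose proof (Cmod_triangle ((f x - a) * (g x - b)) ((f x - a) * b + a * (g x - b))) as T1.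
pose proof (Cmod_triangle ((f x - a) * b) (a * (g x - b))) as T2.
rewrite !Cmod_mult in T1 T2.
assert (Hd1 : d <= 1) by apply Rmin_l.
assert (Hd2 : d * (2 * M) <= eps).
{ replace eps with (eps / (2 * M) * (2 * M))%R by (field; lra).
  apply Rmult_le_compat_r; [lra|apply Rmin_r]. }
pose proof (Cmod_ge_0 a). pose proof (Cmod_ge_0 b).
pose proof (Cmod_ge_0 (f x - a)). pose proof (Cmod_ge_0 (g x - b)).
unfold M in Hd2. nra.
Qed.

Lemma filterlim_Copp f (a : C) :
  filterlim f F (locally a) -> filterlim (fun x => - f x) F (locally (- a)).
Proof.
intros Hf. apply filterlim_C. intros eps He.
apply filterlim_C with (eps := eps) in Hf; [|exact He].
apply: filter_imp Hf => x H1.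
replace (- f x - - a) with (- (f x - a)) by ring. rewrite Cmod_opp. exact H1.
Qed.

Lemma filterlim_Cminus f g (a b : C) :
  filterlim f F (locally a) -> filterlim g F (locally b) ->
  filterlim (fun x => f x - g x) F (locally (a - b)).
Proof.
intros Hf Hg. apply filterlim_Cplus; [|apply filterlim_Copp]; assumption.
Qed.

Lemma filterlim_Cinv f (a : C) :
  a <> 0 -> filterlim f F (locally a) ->
  filterlim (fun x => / f x) F (locally (/ a)).
Proof.
intros Ha Hf. apply filterlim_C. intros eps He.
assert (Ha' : 0 < Cmod a) by (apply Cmod_gt_0; exact Ha).
set (d := Rmin (Cmod a / 2) (eps * (Cmod a * Cmod a) / 2)).
assert (Hd : 0 < d).
{ apply Rmin_pos; [lra|]. assert (0 < Cmod a * Cmod a) by nra. nra. }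
apply filterlim_C with (eps := d) in Hf; [|exact Hd].
apply: filter_imp Hf => x H1.
assert (Hd1 : d <= Cmod a / 2) by apply Rmin_l.
assert (Hd2 : d <= eps * (Cmod a * Cmod a) / 2) by apply Rmin_r.
assert (H2 : Cmod a / 2 < Cmod (f x)).
{ pose proof (Cmod_triangle (f x) (a - f x)) as T1.
  replace (f x + (a - f x)) with a in T1 by ring.
  replace (a - f x) with (- (f x - a)) in T1 by ring. rewrite Cmod_opp in T1. lra. }
assert (Hfx : f x <> 0) by (apply Cmod_gt_0; lra).
replace (/ f x - / a) with (- (f x - a) / (f x * a)) by (field; auto).
rewrite Cmod_div; [|apply Cmult_neq_0; auto].
rewrite Cmod_opp Cmod_mult.
apply Rlt_div_l; [nra|]. nra.
Qed.

Lemma filterlim_Cdiv f g (a b : C) :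
  b <> 0 -> filterlim f F (locally a) -> filterlim g F (locally b) ->
  filterlim (fun x => f x / g x) F (locally (a / b)).
Proof.
intros Hb Hf Hg. apply filterlim_Cmult; [|apply filterlim_Cinv]; assumption.
Qed.

Lemma filterlim_Re f (a : C) :
  filterlim f F (locally a) -> filterlim (fun x => Re (f x)) F (locally (Re a)).
Proof.
intros Hf P [d Hd].
apply filterlim_C with (eps := d) in Hf; [|apply cond_pos].
change (F (fun x => P (Re (f x)))).
apply: filter_imp Hf => x H1. apply Hd.
change (Rabs (Re (f x) - Re a) < d).
apply: Rle_lt_trans H1.
replace (Re (f x) - Re a)%R with (Re (f x - a)) by (destruct (f x), a; reflexivity).
apply re_le_Cmod.
Qed.

Lemma filterlim_Im f (a : C) :
  filterlim f F (locally a) -> filterlim (fun x => Im (f x)) F (locally (Im a)).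
Proof.
intros Hf.
assert (H := filterlim_Re _ _ (filterlim_Cmult _ _ _ _ Hf (filterlim_const (- Ci)))).
apply: filterlim_ext_loc; [|replace (Im a) with (Re (a * - Ci)); [exact H|]].
- apply filter_forall => x. destruct (f x); simpl; ring.
- destruct a; simpl; ring.
Qed.

Lemma filterlim_pair_C (u v : T -> R) (a b : R) :
  filterlim u F (locally a) -> filterlim v F (locally b) ->
  filterlim (fun x => (u x, v x) : C) F (locally ((a, b) : C)).
Proof.
intros Hu Hv P [d Hd].
assert (H1 : F (fun x => ball a d (u x))) by (apply Hu; exists d; auto).
assert (H2 : F (fun x => ball b d (v x))) by (apply Hv; exists d; auto).
change (F (fun x => P (u x, v x))).
apply: filter_imp (filter_and _ _ H1 H2) => x [K1 K2].
apply Hd. split; assumption.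
Qed.

Lemma filterlim_RtoC (u : T -> R) (a : R) :
  filterlim u F (locally a) -> filterlim (fun x => RtoC (u x)) F (locally (RtoC a)).
Proof.
intros Hu. apply filterlim_pair_C; [exact Hu|apply filterlim_const].
Qed.

Lemma filterlim_Cconj f (a : C) :
  filterlim f F (locally a) -> filterlim (fun x => Cconj (f x)) F (locally (Cconj a)).
Proof.
intros Hf. apply filterlim_C. intros eps He.
apply filterlim_C with (eps := eps) in Hf; [|exact He].
apply: filter_imp Hf => x H1.
rewrite <- Cminus_conj, Cmod_conj. exact H1.
Qed.

Lemma filterlim_Cmod f (a : C) :
  filterlim f F (locally a) -> filterlim (fun x => Cmod (f x)) F (locally (Cmod a)).
Proof.
intros Hf P [d Hd].
apply filterlim_C with (eps := d) in Hf; [|apply cond_pos].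
change (F (fun x => P (Cmod (f x)))).
apply: filter_imp Hf => x H1. apply Hd.
change (Rabs (Cmod (f x) - Cmod a) < d).
apply: Rle_lt_trans H1.
pose proof (Cmod_triangle (f x - a) a) as T1.
pose proof (Cmod_triangle (f x) (- (f x - a))) as T2.
replace (f x - a + a) with (f x) in T1 by ring.
replace (f x + - (f x - a)) with a in T2 by ring. rewrite Cmod_opp in T2.
apply Rabs_le. lra.
Qed.

End Limits.

(* The Caratheodory form of complex differentiability: sum, product and chain
   rules reduce to continuity of the slope. *)
Definition cderiv (f : C -> C) (z l : C) : Prop :=
  exists phi : C -> C,
    (forall w, f w = f z + phi w * (w - z)) /\ phi z = l /\ continuous phi z.

Definition cdiff (f : C -> C) (z : C) : Prop := exists l, cderiv f z l.

Lemma cderiv_is_derive (f : C -> C) (z l : C) :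
  cderiv f z l <-> @is_derive C_AbsRing C_NormedModule f z l.
Proof.
split.
- intros [phi [Hphi [Hl Hc]]]. split.
  + apply is_linear_scal_l.
  + intros x Hx.
    assert (Ex : z = x) by (apply (@is_filter_lim_locally_unique C_AbsRing (AbsRing_NormedModule C_AbsRing) z x Hx)).
    subst x. intros eps.
    apply locally_C.
    apply filterlim_C with (eps := (eps : R)) in Hc; [|apply cond_pos].
    revert Hc. apply filter_imp. intros y Hy.
    change (Cmod (f y - f z - (y - z) * l) <= eps * Cmod (y - z)).
    rewrite (Hphi y).
    replace (f z + phi y * (y - z) - f z - (y - z) * l) with ((phi y - phi z) * (y - z))
      by (rewrite Hl; ring).
    rewrite Cmod_mult. apply Rmult_le_compat_r; [apply Cmod_ge_0|lra].
- intros [_ H].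
  exists (fun w => if Ceq_dec w z then l else (f w - f z) / (w - z)).
  split; [|split].
  + intros w. destruct (Ceq_dec w z) as [->|n]; [ring|].
    field. apply Cminus_eq_contra, n.
  + destruct (Ceq_dec z z); [reflexivity|congruence].
  + apply filterlim_C. intros eps He.
    assert (He2 : 0 < eps / 2) by lra.
    specialize (H z (fun P H => H) (mkposreal _ He2)).
    apply locally_C in H.
    revert H. apply filter_imp. intros y Hy.
    change (Cmod (f y - f z - (y - z) * l) <= (eps / 2) * Cmod (y - z)) in Hy.
    destruct (Ceq_dec z z) as [_|n]; [|congruence].
    destruct (Ceq_dec y z) as [E|n].
    * replace (l - l) with (RtoC 0) by ring. rewrite Cmod_0. exact He.
    * assert (n' := Cminus_eq_contra _ _ n).
      assert (P1 : 0 < Cmod (y - z)) by (apply Cmod_gt_0; exact n').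
      replace ((f y - f z) / (y - z) - l) with ((f y - f z - (y - z) * l) / (y - z))
        by (field; exact n').
      rewrite Cmod_div; [|exact n'].
      apply Rlt_div_l; [exact P1|]. nra.
Qed.

Lemma cderiv_continuous (f : C -> C) (z l : C) : cderiv f z l -> continuous f z.
Proof.
intros [phi [Hphi [Hl Hc]]].
apply (continuous_ext (fun w => f z + phi w * (w - z))); [intros w; symmetry; apply Hphi|].
unfold continuous.
apply filterlim_Cplus; [apply filterlim_const|].
apply filterlim_Cmult; [exact Hc|].
apply filterlim_Cminus; [apply filterlim_id|apply filterlim_const].
Qed.

Lemma cdiff_continuous (f : C -> C) (z : C) : cdiff f z -> continuous f z.
Proof. intros [l H]. exact (cderiv_continuous _ _ _ H). Qed.

Lemma cderiv_ext_loc (f g : C -> C) (z l : C) :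
  locally z (fun w => f w = g w) -> cderiv f z l -> cderiv g z l.
Proof.
intros H Hf. apply cderiv_is_derive. apply cderiv_is_derive in Hf.
apply: is_derive_ext_loc Hf. apply locally_C. exact H.
Qed.

Lemma cdiff_ext_loc (f g : C -> C) (z : C) :
  locally z (fun w => f w = g w) -> cdiff f z -> cdiff g z.
Proof. intros H [l Hl]. exists l. exact (cderiv_ext_loc _ _ _ _ H Hl). Qed.

Lemma cderiv_const (c z : C) : cderiv (fun _ => c) z 0.
Proof.
exists (fun _ => 0). split; [intros; ring|split; [reflexivity|apply continuous_const]].
Qed.

Lemma cderiv_id (z : C) : cderiv (fun w => w) z 1.
Proof.
exists (fun _ => 1). split; [intros; ring|split; [reflexivity|apply continuous_const]].
Qed.

Lemma cderiv_plus (f g : C -> C) (z a b : C) :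
  cderiv f z a -> cderiv g z b -> cderiv (fun w => f w + g w) z (a + b).
Proof.
intros [p [Hp [Ea Ca]]] [q [Hq [Eb Cb]]].
exists (fun w => p w + q w). split; [|split].
- intros w. rewrite (Hp w) (Hq w). ring.
- rewrite Ea Eb. reflexivity.
- apply filterlim_Cplus; assumption.
Qed.

Lemma cderiv_mult (f g : C -> C) (z a b : C) :
  cderiv f z a -> cderiv g z b ->
  cderiv (fun w => f w * g w) z (a * g z + f z * b).
Proof.
intros Hf Hg. pose proof (cderiv_continuous _ _ _ Hg) as Cg.
destruct Hf as [p [Hp [Ea Ca]]]. destruct Hg as [q [Hq [Eb Cb]]].
exists (fun w => p w * g w + f z * q w). split; [|split].
- intros w. rewrite (Hp w) (Hq w). ring.
- rewrite Ea Eb. reflexivity.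
- apply filterlim_Cplus; apply filterlim_Cmult; try assumption. apply filterlim_const.
Qed.

Lemma cderiv_comp (f g : C -> C) (z a b : C) :
  cderiv f z a -> cderiv g (f z) b -> cderiv (fun w => g (f w)) z (b * a).
Proof.
intros Hf Hg. pose proof (cderiv_continuous _ _ _ Hf) as Cf.
destruct Hf as [p [Hp [Ea Ca]]]. destruct Hg as [q [Hq [Eb Cb]]].
exists (fun w => q (f w) * p w). split; [|split].
- intros w. rewrite (Hq (f w)). rewrite {2}(Hp w). ring.
- rewrite Ea Eb. reflexivity.
- apply filterlim_Cmult; [|exact Ca].
  exact (continuous_comp f q z Cf Cb).
Qed.

Lemma cderiv_inv (z : C) : z <> 0 -> cderiv (fun w => / w) z (- / (z * z)).
Proof.
intros Hz.
(* The Caratheodory identity must hold at every [w], also at [w = 0]. An explicit value there, with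
   slope [/ (z * z)], settles that point without changing the function near [z]. *)
apply (cderiv_ext_loc (fun w => if Ceq_dec w 0 then 0 else / w)).
{ apply locally_Cmod. exists (Cmod z). split; [apply Cmod_gt_0; exact Hz|].
  intros w Hw. destruct (Ceq_dec w 0) as [E|n]; [|reflexivity].
  exfalso. subst w. replace (0 - z) with (- z) in Hw by ring.
  rewrite Cmod_opp in Hw. lra. }
exists (fun w => if Ceq_dec w 0 then / (z * z) else - / (w * z)). split; [|split].
- intros w. destruct (Ceq_dec z 0) as [E|_]; [contradiction|].
  destruct (Ceq_dec w 0) as [->|n]; field; auto.
- destruct (Ceq_dec z 0) as [E|_]; [contradiction|reflexivity].
- unfold continuous. destruct (Ceq_dec z 0) as [E|_]; [contradiction|].
  apply: (filterlim_ext_loc (fun w => - / (w * z))).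
  + apply locally_Cmod. exists (Cmod z). split; [apply Cmod_gt_0; exact Hz|].
    intros w Hw. destruct (Ceq_dec w 0) as [E|n]; [|reflexivity].
    exfalso. subst w. replace (0 - z) with (- z) in Hw by ring.
    rewrite Cmod_opp in Hw. lra.
  + apply filterlim_Copp, filterlim_Cinv; [apply Cmult_neq_0; exact Hz|].
    apply filterlim_Cmult; [apply filterlim_id|apply filterlim_const].
Qed.

Lemma cdiff_const (c z : C) : cdiff (fun _ => c) z.
Proof. eexists; apply cderiv_const. Qed.

Lemma cdiff_id (z : C) : cdiff (fun w => w) z.
Proof. eexists; apply cderiv_id. Qed.

Lemma cdiff_plus (f g : C -> C) (z : C) :
  cdiff f z -> cdiff g z -> cdiff (fun w => f w + g w) z.
Proof. intros [a Ha] [b Hb]. eexists; apply cderiv_plus; eassumption. Qed.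

Lemma cdiff_mult (f g : C -> C) (z : C) :
  cdiff f z -> cdiff g z -> cdiff (fun w => f w * g w) z.
Proof. intros [a Ha] [b Hb]. eexists; apply cderiv_mult; eassumption. Qed.

Lemma cdiff_opp (f : C -> C) (z : C) : cdiff f z -> cdiff (fun w => - f w) z.
Proof.
intros H. apply (cdiff_ext_loc (fun w => (- (1)) * f w)).
- apply filter_forall => w. ring.
- apply cdiff_mult; [apply cdiff_const|exact H].
Qed.

Lemma cdiff_minus (f g : C -> C) (z : C) :
  cdiff f z -> cdiff g z -> cdiff (fun w => f w - g w) z.
Proof. intros Hf Hg. apply cdiff_plus; [|apply cdiff_opp]; assumption. Qed.

Lemma cdiff_comp (f g : C -> C) (z : C) :
  cdiff f z -> cdiff g (f z) -> cdiff (fun w => g (f w)) z.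
Proof. intros [a Ha] [b Hb]. eexists; apply (cderiv_comp f g); eassumption. Qed.

Lemma cdiff_inv (f : C -> C) (z : C) :
  f z <> 0 -> cdiff f z -> cdiff (fun w => / f w) z.
Proof.
intros Hz Hf. apply (cdiff_comp f (fun w => / w)); [exact Hf|].
eexists. apply cderiv_inv, Hz.
Qed.

Lemma cdiff_div (f g : C -> C) (z : C) :
  g z <> 0 -> cdiff f z -> cdiff g z -> cdiff (fun w => f w / g w) z.
Proof. intros Hz Hf Hg. apply cdiff_mult; [|apply cdiff_inv]; assumption. Qed.

Lemma cdiff_pow (f : C -> C) (n : nat) (z : C) :
  cdiff f z -> cdiff (fun w => Cpow (f w) n) z.
Proof.
intros H. induction n as [|n IH]; simpl; [apply cdiff_const|].
apply cdiff_mult; assumption.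
Qed.

(** * The complex exponential and integrals of complex-valued functions *)

Definition Cexp (w : C) : C := (exp (Re w) * cos (Im w), exp (Re w) * sin (Im w))%R.

Lemma Cexp_plus (z w : C) : Cexp (z + w) = Cexp z * Cexp w.
Proof.
unfold Cexp. rewrite re_plus im_plus exp_plus cos_plus sin_plus.
apply injective_projections; simpl; ring.
Qed.

Lemma Cexp_0 : Cexp 0 = 1.
Proof.
unfold Cexp; simpl. rewrite exp_0 cos_0 sin_0.
apply injective_projections; simpl; ring.
Qed.

Lemma Cmod_Cexp (w : C) : Cmod (Cexp w) = exp (Re w).
Proof.
unfold Cmod, Cexp; simpl fst; simpl snd.
replace ((exp (Re w) * cos (Im w)) ^ 2 + (exp (Re w) * sin (Im w)) ^ 2)%R
  with (exp (Re w) ^ 2)%R.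
- apply sqrt_pow2, Rlt_le, exp_pos.
- pose proof (sin2_cos2 (Im w)) as H. unfold Rsqr in H. nra.
Qed.

Lemma Cexp_neq_0 (w : C) : Cexp w <> 0.
Proof. apply Cmod_gt_0. rewrite Cmod_Cexp. apply exp_pos. Qed.

Lemma Cmod_le_Rabs (z : C) : Cmod z <= Rabs (Re z) + Rabs (Im z).
Proof.
replace z with (RtoC (Re z) + Ci * RtoC (Im z)) at 1.
- apply: Rle_trans; [apply Cmod_triangle|].
  rewrite Cmod_mult Cmod_Ci !Cmod_R. lra.
- destruct z; apply injective_projections; simpl; ring.
Qed.

Lemma im_le_Cmod (z : C) : Rabs (Im z) <= Cmod z.
Proof. apply: Rle_trans; [|apply Rmax_Cmod]. apply Rmax_r. Qed.

Lemma Rabs_sin_le (y : R) : Rabs (sin y) <= Rabs y.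
Proof.
destruct (MVT_gen sin 0 y cos) as [c [_ Hc]].
- intros x _. apply is_derive_sin.
- intros x _. apply continuity_sin.
- rewrite sin_0 !Rminus_0_r in Hc. rewrite Hc Rabs_mult.
  assert (Rabs (cos c) <= 1) by (apply Rabs_le; pose proof (COS_bound c); lra).
  pose proof (Rabs_pos y). nra.
Qed.

Lemma one_minus_cos_le (y : R) : 0 <= 1 - cos y <= y ^ 2.
Proof.
split; [pose proof (COS_bound y); lra|].
replace (cos y) with (1 - 2 * (sin (y / 2) * sin (y / 2)))%R.
- pose proof (Rabs_sin_le (y / 2)) as H.
  apply Rsqr_le_abs_1 in H. unfold Rsqr in H. nra.
- replace y with (2 * (y / 2))%R at 3 by field. rewrite cos_2a_sin. ring.
Qed.

Lemma Rabs_sin_minus_le (y : R) : Rabs (sin y - y) <= Rabs y * y ^ 2.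
Proof.
destruct (MVT_gen (fun t => sin t - t)%R 0 y (fun t => cos t - 1)%R) as [c [Hb Hc]].
- intros x _. auto_derive; [exact I|ring].
- intros x _. apply continuity_pt_minus; [apply continuity_sin|apply continuity_pt_id].
- rewrite sin_0 !Rminus_0_r in Hc. rewrite Hc Rabs_mult Rmult_comm.
  apply Rmult_le_compat_l; [apply Rabs_pos|].
  pose proof (one_minus_cos_le c) as Hcos. apply Rabs_le.
  assert (c ^ 2 <= y ^ 2).
  { unfold Rmin, Rmax in Hb. destruct (Rle_dec 0 y); nra. }
  lra.
Qed.

Lemma exp_second_order (x : R) : Rabs x <= / 2 -> 0 <= exp x - 1 - x <= 2 * x ^ 2.
Proof.
intros Hx. apply Rabs_le_between in Hx.
split; [pose proof (exp_ineq1_le x); lra|].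
pose proof (exp_ineq1_le (- x)) as H. pose proof (exp_pos x) as H0.
assert (E : (exp x * exp (- x) = 1)%R) by (rewrite <- exp_plus, Rplus_opp_r; apply exp_0).
assert (H1 : exp x * (1 - x) <= 1) by nra.
assert (H2 : 1 <= (1 + x + 2 * x ^ 2) * (1 - x)) by nra.
nra.
Qed.

Lemma Cexp_second_order (h : C) :
  Cmod h <= / 2 -> Cmod (Cexp h - 1 - h) <= 10 * Cmod h ^ 2.
Proof.
intros Hh. destruct h as [x y].
pose proof (re_le_Cmod (x, y)) as Hx. pose proof (im_le_Cmod (x, y)) as Hy.
simpl Re in Hx. simpl Im in Hy. unfold Re, Im in Hx, Hy; simpl in Hx, Hy.
set (m := Cmod (x, y)) in *.
apply: Rle_trans; [apply Cmod_le_Rabs|].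
unfold Cexp, Re, Im; simpl.
pose proof (exp_second_order x ltac:(lra)) as H1.
pose proof (one_minus_cos_le y) as H2.
pose proof (Rabs_sin_minus_le y) as H3.
assert (Hm : 0 <= m) by apply Cmod_ge_0.
assert (X2 : x ^ 2 <= m ^ 2) by (apply pow_maj_Rabs; exact Hx).
assert (Y2 : y ^ 2 <= m ^ 2) by (apply pow_maj_Rabs; exact Hy).
assert (E2 : 0 < exp x <= 2).
{ split; [apply exp_pos|]. apply Rabs_le_between in Hx. nra. }
assert (A1 : Rabs (exp x * cos y + - (1) + - x) <= 4 * m ^ 2).
{ replace (exp x * cos y + - (1) + - x)%R with ((exp x - 1 - x) - exp x * (1 - cos y))%R by ring.
  apply Rabs_le. nra. }
assert (A2 : Rabs (exp x * sin y + - 0 + - y) <= 6 * m ^ 2).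
{ replace (exp x * sin y + - 0 + - y)%R with (exp x * (sin y - y) + (exp x - 1) * y)%R by ring.
  apply: Rle_trans; [apply Rabs_triang|]. rewrite !Rabs_mult.
  rewrite (Rabs_pos_eq (exp x)); [|lra].
  assert (Rabs (exp x - 1) <= 2 * m).
  { apply Rabs_le. apply Rabs_le_between in Hx. nra. }
  assert (Rabs (sin y - y) <= m ^ 2).
  { apply: (Rle_trans _ _ _ H3). pose proof (Rabs_pos y). nra. }
  pose proof (Rabs_pos y). pose proof (Rabs_pos (exp x - 1)). nra. }
lra.
Qed.

Lemma cderiv_eps (f : C -> C) (z l : C) :
  (forall eps, 0 < eps -> exists d, 0 < d /\ forall w, Cmod (w - z) < d ->
     Cmod (f w - f z - l * (w - z)) <= eps * Cmod (w - z)) <-> cderiv f z l.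
Proof.
split.
- intros H. apply cderiv_is_derive. split; [apply is_linear_scal_l|].
  intros x Hx.
  assert (Ex : z = x) by (apply (@is_filter_lim_locally_unique C_AbsRing (AbsRing_NormedModule C_AbsRing) z x Hx)).
  subst x. intros eps. apply locally_C, locally_Cmod.
  destruct (H eps (cond_pos eps)) as [d [Hd Hw]].
  exists d. split; [exact Hd|]. intros w Hwd.
  change (Cmod (f w - f z - (w - z) * l) <= eps * Cmod (w - z)).
  rewrite (Cmult_comm (w - z) l). auto.
- intros [phi [Hphi [Hl Hc]]] eps He.
  apply filterlim_C with (eps := eps) in Hc; [|exact He].
  apply locally_Cmod in Hc. destruct Hc as [d [Hd Hw]].
  exists d. split; [exact Hd|]. intros w Hwd. specialize (Hw w Hwd).
  rewrite (Hphi w).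
  replace (f z + phi w * (w - z) - f z - l * (w - z)) with ((phi w - phi z) * (w - z))
    by (rewrite Hl; ring).
  rewrite Cmod_mult. apply Rmult_le_compat_r; [apply Cmod_ge_0|lra].
Qed.

Lemma cderiv_Cexp (z : C) : cderiv Cexp z (Cexp z).
Proof.
apply cderiv_eps. intros eps He.
set (K := (10 * Cmod (Cexp z))%R).
assert (HK : 0 < K).
{ unfold K. rewrite Cmod_Cexp. pose proof (exp_pos (Re z)). lra. }
exists (Rmin (/ 2) (eps / K)). split.
{ apply Rmin_pos; [lra|]. apply Rdiv_lt_0_compat; lra. }
intros w Hw.
assert (H1 : Cmod (w - z) < / 2) by (apply: Rlt_le_trans Hw _; apply Rmin_l).
assert (H2 : Cmod (w - z) < eps / K) by (apply: Rlt_le_trans Hw _; apply Rmin_r).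
assert (H3 : K * Cmod (w - z) <= eps).
{ apply Rlt_le. apply (Rmult_lt_compat_r K) in H2; [|exact HK].
  replace (eps / K * K)%R with eps in H2 by (field; lra). lra. }
set (h := w - z) in *.
replace w with (z + h) by (unfold h; ring). rewrite Cexp_plus.
replace (Cexp z * Cexp h - Cexp z - Cexp z * h) with (Cexp z * (Cexp h - 1 - h)) by ring.
rewrite Cmod_mult.
pose proof (Cexp_second_order h ltac:(lra)) as H4.
pose proof (Cmod_ge_0 h). pose proof (Cmod_ge_0 (Cexp z)).
apply Rle_trans with (Cmod (Cexp z) * (10 * Cmod h ^ 2))%R.
- apply Rmult_le_compat_l; assumption.
- unfold K in H3. nra.
Qed.

Definition CInt (f : R -> C) (a b : R) : C :=
  (RInt (fun t => Re (f t)) a b, RInt (fun t => Im (f t)) a b).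

Definition cont_on (f : R -> C) (a b : R) : Prop :=
  forall t, a <= t <= b -> continuous f t.

Section Integral.

Implicit Types (f g : R -> C) (a b c M : R).

Lemma ex_RInt_Re f a b : a <= b -> cont_on f a b -> ex_RInt (fun t => Re (f t)) a b.
Proof.
intros Hab H. apply (ex_RInt_continuous (V := R_CompleteNormedModule)). intros t Ht.
rewrite Rmin_left in Ht; [|exact Hab]. rewrite Rmax_right in Ht; [|exact Hab].
apply filterlim_Re, H, Ht.
Qed.

Lemma ex_RInt_Im f a b : a <= b -> cont_on f a b -> ex_RInt (fun t => Im (f t)) a b.
Proof.
intros Hab H. apply (ex_RInt_continuous (V := R_CompleteNormedModule)). intros t Ht.
rewrite Rmin_left in Ht; [|exact Hab]. rewrite Rmax_right in Ht; [|exact Hab].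
apply filterlim_Im, H, Ht.
Qed.

Lemma CInt_ext f g a b :
  a <= b -> (forall t, a <= t <= b -> f t = g t) -> CInt f a b = CInt g a b.
Proof.
intros Hab H. unfold CInt.
rewrite (RInt_ext (fun t => Re (f t)) (fun t => Re (g t))).
- rewrite (RInt_ext (fun t => Im (f t)) (fun t => Im (g t))); [reflexivity|].
  intros t Ht. rewrite Rmin_left in Ht; [|exact Hab]. rewrite Rmax_right in Ht; [|exact Hab].
  rewrite H; [reflexivity|lra].
- intros t Ht. rewrite Rmin_left in Ht; [|exact Hab]. rewrite Rmax_right in Ht; [|exact Hab].
  rewrite H; [reflexivity|lra].
Qed.

Lemma CInt_plus f g a b :
  a <= b -> cont_on f a b -> cont_on g a b ->
  CInt (fun t => f t + g t) a b = CInt f a b + CInt g a b.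
Proof.
intros Hab Hf Hg. unfold CInt. apply injective_projections; simpl.
- rewrite <- (RInt_plus (fun t => Re (f t)) (fun t => Re (g t)));
    [|apply ex_RInt_Re; assumption|apply ex_RInt_Re; assumption].
  apply RInt_ext. intros t _. apply re_plus.
- rewrite <- (RInt_plus (fun t => Im (f t)) (fun t => Im (g t)));
    [|apply ex_RInt_Im; assumption|apply ex_RInt_Im; assumption].
  apply RInt_ext. intros t _. apply im_plus.
Qed.

Lemma CInt_scal (k : C) f a b :
  a <= b -> cont_on f a b -> CInt (fun t => k * f t) a b = k * CInt f a b.
Proof.
intros Hab Hf.
pose proof (ex_RInt_Re f a b Hab Hf) as H1. pose proof (ex_RInt_Im f a b Hab Hf) as H2.
unfold CInt. apply injective_projections; simpl.
- apply is_RInt_unique.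
  exact (is_RInt_minus (V := R_NormedModule) _ _ _ _ _ _
    (is_RInt_scal _ _ _ (fst k) _ (RInt_correct _ _ _ H1))
    (is_RInt_scal _ _ _ (snd k) _ (RInt_correct _ _ _ H2))).
- apply is_RInt_unique.
  exact (is_RInt_plus (V := R_NormedModule) _ _ _ _ _ _
    (is_RInt_scal _ _ _ (fst k) _ (RInt_correct _ _ _ H2))
    (is_RInt_scal _ _ _ (snd k) _ (RInt_correct _ _ _ H1))).
Qed.

Lemma cont_on_scal (k : C) f a b : cont_on f a b -> cont_on (fun t => k * f t) a b.
Proof. intros H t Ht. apply filterlim_Cmult; [apply filterlim_const|exact (H t Ht)]. Qed.

Lemma CInt_minus f g a b :
  a <= b -> cont_on f a b -> cont_on g a b ->
  CInt (fun t => f t - g t) a b = CInt f a b - CInt g a b.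
Proof.
intros Hab Hf Hg.
transitivity (CInt (fun t => f t + (- (1)) * g t) a b).
- apply CInt_ext; [exact Hab|]. intros; ring.
- rewrite CInt_plus; [|exact Hab|exact Hf|apply cont_on_scal, Hg].
  rewrite CInt_scal; [ring|exact Hab|exact Hg].
Qed.

Lemma CInt_const (k : C) a b : CInt (fun _ => k) a b = RtoC (b - a) * k.
Proof.
unfold CInt. rewrite !RInt_const. destruct k. apply injective_projections; simpl; unfold scal; simpl; unfold mult; simpl; ring.
Qed.

Lemma CInt_point f a : CInt f a a = 0.
Proof. unfold CInt. rewrite !RInt_point. reflexivity. Qed.

Lemma CInt_Chasles f a b c :
  a <= b -> b <= c -> cont_on f a c -> CInt f a b + CInt f b c = CInt f a c.
Proof.
intros Hab Hbc Hf.
assert (H1 : cont_on f a b) by (intros t Ht; apply Hf; lra).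
assert (H2 : cont_on f b c) by (intros t Ht; apply Hf; lra).
unfold CInt. apply injective_projections; simpl.
- apply (RInt_Chasles (fun t => Re (f t))); apply ex_RInt_Re; assumption.
- apply (RInt_Chasles (fun t => Im (f t))); apply ex_RInt_Im; assumption.
Qed.

Lemma CInt_conj f a b :
  a <= b -> cont_on f a b -> CInt (fun t => Cconj (f t)) a b = Cconj (CInt f a b).
Proof.
intros Hab Hf. unfold CInt, Cconj; simpl. f_equal.
rewrite <- (RInt_opp (fun t => Im (f t))); [reflexivity|].
apply ex_RInt_Im; assumption.
Qed.

(* Multiplying by the conjugate of the integral reduces the bound to the real
   part, where monotonicity of the real integral applies. *)
Lemma Cmod_CInt_le_RInt f (g : R -> R) a b :
  a <= b -> cont_on f a b -> ex_RInt g a b ->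
  (forall t, a <= t <= b -> Cmod (f t) <= g t) ->
  Cmod (CInt f a b) <= RInt g a b.
Proof.
intros Hab Hf Hg HM.
set (J := CInt f a b).
destruct (Rle_lt_or_eq_dec 0 (Cmod J) (Cmod_ge_0 _)) as [HJ|HJ].
2:{ rewrite <- HJ. apply RInt_ge_0; [exact Hab|exact Hg|].
    intros t Ht. apply Rle_trans with (Cmod (f t)); [apply Cmod_ge_0|apply HM; lra]. }
assert (E : (Cmod J ^ 2)%R = Re (CInt (fun t => Cconj J * f t) a b)).
{ rewrite CInt_scal; [|exact Hab|exact Hf]. fold J.
  rewrite Cmult_comm -Cmod2_conj. reflexivity. }
assert (B : Re (CInt (fun t => Cconj J * f t) a b) <= Cmod J * RInt g a b).
{ change (RInt (fun t => Re (Cconj J * f t)) a b <= Cmod J * RInt g a b).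
  replace (Cmod J * RInt g a b)%R with (RInt (fun t => (Cmod J * g t)%R) a b)
    by exact (RInt_scal (V := R_CompleteNormedModule) g a b (Cmod J) Hg).
  apply RInt_le.
  - exact Hab.
  - apply (ex_RInt_Re (fun t => Cconj J * f t)); [exact Hab|apply cont_on_scal, Hf].
  - apply (ex_RInt_scal (V := R_NormedModule)), Hg.
  - intros t Ht. apply: Rle_trans; [apply Rle_abs|].
    apply: Rle_trans; [apply re_le_Cmod|].
    rewrite Cmod_mult Cmod_conj. apply Rmult_le_compat_l; [lra|]. apply HM. lra. }
rewrite <- E in B.
apply (Rmult_le_reg_l (Cmod J)); [exact HJ|]. lra.
Qed.

Lemma Cmod_CInt_le f a b M :
  a <= b -> cont_on f a b -> (forall t, a <= t <= b -> Cmod (f t) <= M) ->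
  Cmod (CInt f a b) <= M * (b - a).
Proof.
intros Hab Hf HM. rewrite Rmult_comm.
replace ((b - a) * M)%R with (RInt (fun _ => M) a b) by (rewrite RInt_const; reflexivity).
apply Cmod_CInt_le_RInt; [exact Hab|exact Hf|apply ex_RInt_const|exact HM].
Qed.

End Integral.

(** * Goursat's theorem on rectangles *)

(** The contour integral of [k] along the boundary of the rectangle with sides [[a, b]] and
    [[c, d]], taken counterclockwise. *)
Definition rect_int (k : C -> C) (a b c d : R) : C :=
  CInt (fun x => k (x, c)) a b - CInt (fun x => k (x, d)) a b
  + Ci * (CInt (fun y => k (b, y)) c d - CInt (fun y => k (a, y)) c d).

Definition on_rect (P : C -> Prop) (a b c d : R) : Prop :=
  forall x y, a <= x <= b -> c <= y <= d -> P (x, y).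

Lemma continuous_horizontal (k : C -> C) (x y : R) :
  continuous k (x, y) -> continuous (fun t => k (t, y)) x.
Proof.
intros H. apply (continuous_comp (fun t => (t, y) : C) k); [|exact H].
apply filterlim_pair_C; [apply filterlim_id|apply filterlim_const].
Qed.

Lemma continuous_vertical (k : C -> C) (x y : R) :
  continuous k (x, y) -> continuous (fun t => k (x, t)) y.
Proof.
intros H. apply (continuous_comp (fun t => (x, t) : C) k); [|exact H].
apply filterlim_pair_C; [apply filterlim_const|apply filterlim_id].
Qed.

Lemma rect_int_split (k : C -> C) (a m b c n d : R) :
  a <= m <= b -> c <= n <= d -> on_rect (continuous k) a b c d ->
  rect_int k a b c d = (rect_int k a m c n + rect_int k m b c n)
    + (rect_int k a m n d + rect_int k m b n d).
Proof.
intros Hm Hn H. unfold rect_int.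
assert (E1 : forall y, c <= y <= d ->
  CInt (fun x => k (x, y)) a b = CInt (fun x => k (x, y)) a m + CInt (fun x => k (x, y)) m b).
{ intros y Hy. symmetry. apply CInt_Chasles; try lra.
  intros x Hx. apply continuous_horizontal, H; lra. }
assert (E2 : forall x, a <= x <= b ->
  CInt (fun y => k (x, y)) c d = CInt (fun y => k (x, y)) c n + CInt (fun y => k (x, y)) n d).
{ intros x Hx. symmetry. apply CInt_Chasles; try lra.
  intros y Hy. apply continuous_vertical, H; lra. }
rewrite (E1 c); [|lra]. rewrite (E1 d); [|lra].
rewrite (E2 a); [|lra]. rewrite (E2 b); [|lra].
ring.
Qed.

Lemma CInt_RtoC (a b : R) : CInt RtoC a b = RtoC ((b ^ 2 - a ^ 2) / 2).
Proof.
unfold CInt, RtoC; simpl. f_equal.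
- apply is_RInt_unique.
  replace ((b * (b * 1) - a * (a * 1)) / 2)%R with (minus (b ^ 2 / 2) (a ^ 2 / 2))%R
    by (unfold minus, plus, opp; simpl; field).
  apply (is_RInt_derive (fun t => (t ^ 2 / 2)%R) (fun t => t)).
  + intros x _. auto_derive; [exact I|field].
  + intros x _. apply continuous_id.
- rewrite RInt_const. unfold scal; simpl; unfold mult; simpl. ring.
Qed.

Lemma continuous_RtoC (t : R) : continuous RtoC t.
Proof. apply filterlim_RtoC, filterlim_id. Qed.

Lemma CInt_affine (u v : C) (a b : R) :
  a <= b -> CInt (fun t => u + v * RtoC t) a b
    = RtoC (b - a) * u + v * RtoC ((b ^ 2 - a ^ 2) / 2).
Proof.
intros Hab. rewrite CInt_plus; [|exact Hab|intros t _; apply continuous_const|].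
- rewrite CInt_const CInt_scal; [|exact Hab|intros t _; apply continuous_RtoC].
  rewrite CInt_RtoC. reflexivity.
- apply cont_on_scal. intros t _. apply continuous_RtoC.
Qed.

Lemma rect_int_affine (u v : C) (a b c d : R) :
  a <= b -> c <= d -> rect_int (fun w => u + v * w) a b c d = 0.
Proof.
intros Hab Hcd. unfold rect_int.
assert (E1 : forall y, CInt (fun x => u + v * (x, y)) a b
  = RtoC (b - a) * (u + v * (Ci * RtoC y)) + v * RtoC ((b ^ 2 - a ^ 2) / 2)).
{ intros y. rewrite -CInt_affine; [|exact Hab]. apply CInt_ext; [exact Hab|].
  intros t _. rewrite -Cplus_assoc -Cmult_plus_distr_l. do 2 f_equal.
  apply injective_projections; simpl; ring. }
assert (E2 : forall x, CInt (fun y => u + v * (x, y)) c d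
  = RtoC (d - c) * (u + v * RtoC x) + (v * Ci) * RtoC ((d ^ 2 - c ^ 2) / 2)).
{ intros x. rewrite -CInt_affine; [|exact Hcd]. apply CInt_ext; [exact Hcd|].
  intros t _. rewrite -Cplus_assoc -Cmult_assoc -Cmult_plus_distr_l. do 2 f_equal.
  apply injective_projections; simpl; ring. }
rewrite !E1 !E2 !RtoC_minus. ring.
Qed.

Lemma rect_int_bound (k : C -> C) (a b c d M : R) :
  a <= b -> c <= d -> on_rect (continuous k) a b c d ->
  on_rect (fun w => Cmod (k w) <= M) a b c d ->
  Cmod (rect_int k a b c d) <= 2 * M * ((b - a) + (d - c)).
Proof.
intros Hab Hcd Hc HM. unfold rect_int.
assert (E1 : forall y, c <= y <= d -> Cmod (CInt (fun x => k (x, y)) a b) <= M * (b - a)).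
{ intros y Hy. apply Cmod_CInt_le; [exact Hab| |].
  - intros x Hx. apply continuous_horizontal, Hc; lra.
  - intros x Hx. apply HM; lra. }
assert (E2 : forall x, a <= x <= b -> Cmod (CInt (fun y => k (x, y)) c d) <= M * (d - c)).
{ intros x Hx. apply Cmod_CInt_le; [exact Hcd| |].
  - intros y Hy. apply continuous_vertical, Hc; lra.
  - intros y Hy. apply HM; lra. }
pose proof (E1 c ltac:(lra)). pose proof (E1 d ltac:(lra)).
pose proof (E2 a ltac:(lra)). pose proof (E2 b ltac:(lra)).
apply: Rle_trans; [apply Cmod_triangle|].
rewrite Cmod_mult Cmod_Ci. unfold Cminus.
pose proof (Cmod_triangle (CInt (fun x => k (x, c)) a b) (- CInt (fun x => k (x, d)) a b)) as T1.
pose proof (Cmod_triangle (CInt (fun y => k (b, y)) c d) (- CInt (fun y => k (a, y)) c d)) as T2.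
rewrite Cmod_opp in T1. rewrite Cmod_opp in T2. lra.
Qed.

Lemma rect_int_minus (f g : C -> C) (a b c d : R) :
  a <= b -> c <= d -> on_rect (continuous f) a b c d -> on_rect (continuous g) a b c d ->
  rect_int (fun w => f w - g w) a b c d = rect_int f a b c d - rect_int g a b c d.
Proof.
intros Hab Hcd Hf Hg. unfold rect_int.
rewrite !CInt_minus; try assumption;
  try (intros t Ht; apply continuous_horizontal; (apply Hf || apply Hg); lra);
  try (intros t Ht; apply continuous_vertical; (apply Hf || apply Hg); lra).
ring.
Qed.

Lemma pow2_half (p : R) (n : nat) : (p / 2 ^ n = p / 2 ^ (S n) + p / 2 ^ (S n))%R.
Proof. simpl. field. apply pow_nonzero. lra. Qed.

Lemma is_lim_seq_div_pow2 (p : R) : is_lim_seq (fun n => (p / 2 ^ n)%R) 0.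
Proof.
apply (is_lim_seq_ext (fun n => (p * (/ 2) ^ n)%R)).
- intros n. rewrite pow_inv. reflexivity.
- replace (Finite 0) with (Rbar_mult p 0) by (simpl; f_equal; ring).
  apply is_lim_seq_scal_l. apply is_lim_seq_geom. rewrite Rabs_pos_eq; lra.
Qed.

Lemma nested_limit (x : nat -> R) (p : R) :
  (forall n, x n <= x (S n)) -> (forall n, x (S n) + p / 2 ^ (S n) <= x n + p / 2 ^ n) ->
  0 <= p -> exists X, forall n, x n <= X <= x n + p / 2 ^ n.
Proof.
intros Hi Hd Hp.
assert (Hpos : forall n, 0 <= p / 2 ^ n).
{ intros n. apply Rdiv_le_0_compat; [exact Hp|apply pow_lt; lra]. }
assert (Hb : forall n, x n + p / 2 ^ n <= x O + p).
{ induction n as [|n IH]; [simpl; lra|]. pose proof (Hd n). lra. }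
destruct (ex_finite_lim_seq_incr x (x O + p) Hi) as [X HX].
{ intros n. pose proof (Hb n). pose proof (Hpos n). lra. }
exists X. intros n. split.
- apply (is_lim_seq_incr_compare x X HX Hi).
- apply (is_lim_seq_decr_compare (fun n => (x n + p / 2 ^ n)%R) X).
  + replace X with (X + 0)%R by ring.
    apply (is_lim_seq_plus' x (fun n => (p / 2 ^ n)%R)); [exact HX|apply is_lim_seq_div_pow2].
  + exact Hd.
Qed.

Section Goursat.

Variables (k : C -> C) (a b c d : R).
Hypotheses (Hab : a <= b) (Hcd : c <= d) (Hk : on_rect (cdiff k) a b c d).

Let p := (b - a)%R.
Let q := (d - c)%R.

Let in_rect (n : nat) (z : R * R) : Prop :=
  a <= fst z /\ fst z + p / 2 ^ n <= b /\ c <= snd z /\ snd z + q / 2 ^ n <= d.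

Let piece (n : nat) (z : R * R) : C :=
  rect_int k (fst z) (fst z + p / 2 ^ n) (snd z) (snd z + q / 2 ^ n).

(** Invariant of the bisection: area shrinks by [4] at each stage, and the integral over a bad piece
    does not decay faster than area. *)
Let bad (e : R) (n : nat) (z : R * R) : Prop :=
  in_rect n z /\ e / 4 ^ n < Cmod (piece n z).

Let size_pos (r : R) (n : nat) : 0 <= r -> 0 <= r / 2 ^ n.
Proof. intros H. apply Rdiv_le_0_compat; [exact H|apply pow_lt; lra]. Qed.

Let continuous_sub x1 x2 y1 y2 :
  a <= x1 -> x2 <= b -> c <= y1 -> y2 <= d -> on_rect (continuous k) x1 x2 y1 y2.
Proof. intros. intros x y Hx Hy. apply cdiff_continuous, Hk; lra. Qed.

(** If all four quarters were good, the triangle inequality would make the whole piece good. The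
    inclusions on the right are what nested intervals need. *)
Let bad_step (e : R) (n : nat) (z : R * R) :
  bad e n z -> exists z', bad e (S n) z' /\
    fst z <= fst z' /\ fst z' + p / 2 ^ (S n) <= fst z + p / 2 ^ n /\
    snd z <= snd z' /\ snd z' + q / 2 ^ (S n) <= snd z + q / 2 ^ n.
Proof.
destruct z as [x y]. unfold bad, in_rect, piece. simpl fst; simpl snd.
intros [[H1 [H2 [H3 H4]]] H5].
assert (Hp : 0 <= p / 2 ^ (S n)) by (apply size_pos; unfold p; lra).
assert (Hq : 0 <= q / 2 ^ (S n)) by (apply size_pos; unfold q; lra).
pose proof (pow2_half p n) as Ep. pose proof (pow2_half q n) as Eq.
assert (Ee : (e / 4 ^ n = 4 * (e / 4 ^ (S n)))%R).
{ simpl. field. apply pow_nonzero. lra. }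
set (u := (p / 2 ^ (S n))%R) in *. set (v := (q / 2 ^ (S n))%R) in *.
rewrite Ep Eq in H2 H4 H5 |- *. rewrite Ee in H5.
set (e' := (e / 4 ^ (S n))%R) in *.
rewrite (rect_int_split k x (x + u) (x + (u + u)) y (y + v) (y + (v + v))) in H5;
  [|lra|lra|apply continuous_sub; lra].
pose proof (Cmod_triangle
  (rect_int k x (x + u) y (y + v) + rect_int k (x + u) (x + (u + u)) y (y + v))
  (rect_int k x (x + u) (y + v) (y + (v + v)) + rect_int k (x + u) (x + (u + u)) (y + v) (y + (v + v)))) as T1.
pose proof (Cmod_triangle (rect_int k x (x + u) y (y + v)) (rect_int k (x + u) (x + (u + u)) y (y + v))) as T2.
pose proof (Cmod_triangle (rect_int k x (x + u) (y + v) (y + (v + v))) (rect_int k (x + u) (x + (u + u)) (y + v) (y + (v + v)))) as T3.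
rewrite -!Rplus_assoc in T1 T2 T3 H5 |- *.
destruct (Rlt_le_dec e' (Cmod (rect_int k x (x + u) y (y + v)))) as [B|B1].
{ exists (x, y). simpl. repeat split; try lra. }
destruct (Rlt_le_dec e' (Cmod (rect_int k (x + u) (x + u + u) y (y + v)))) as [B|B2].
{ exists (x + u, y)%R. simpl. repeat split; try lra. }
destruct (Rlt_le_dec e' (Cmod (rect_int k x (x + u) (y + v) (y + v + v)))) as [B|B3].
{ exists (x, y + v)%R. simpl. repeat split; try lra. }
destruct (Rlt_le_dec e' (Cmod (rect_int k (x + u) (x + u + u) (y + v) (y + v + v)))) as [B|B4].
{ exists (x + u, y + v)%R. simpl. repeat split; try lra. }
exfalso. lra.
Qed.

(** The tangent map of [k] at [(X, Y)] integrates to [0], and the error left is small compared with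
    the diameter. Diameter and perimeter are both of order [2 ^ -N], so the integral is small
    compared with [4 ^ -N]. *)
Let small_rect (e : R) (X Y : R) : 0 < e -> a <= X <= b -> c <= Y <= d ->
  exists N : nat, forall z, in_rect N z ->
    fst z <= X <= fst z + p / 2 ^ N -> snd z <= Y <= snd z + q / 2 ^ N ->
    Cmod (piece N z) <= e / 4 ^ N.
Proof.
intros He HX HY.
destruct (Hk X Y HX HY) as [A HA].
(* [2 (p + q)^2] is the product of the factors in [rect_int_bound] before scaling; the [1] keeps [K]
   positive for a degenerate rectangle. *)
set (K := (2 * (p + q) ^ 2 + 1)%R).
assert (HK : 0 < K) by (unfold K; pose proof (pow2_ge_0 (p + q)); lra).
assert (He' : 0 < e / K) by (apply Rdiv_lt_0_compat; assumption).
destruct (proj2 (cderiv_eps _ _ _) HA (e / K)%R He') as [dl [Hdl Hw]].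
assert (HN := is_lim_seq_div_pow2 (p + q)).
apply is_lim_seq_spec in HN. destruct (HN (mkposreal _ Hdl)) as [N HN'].
specialize (HN' N (le_n _)). simpl in HN'. exists N.
intros [x y] [R1 [R2 [R3 R4]]] HXx HYy.
unfold piece. simpl fst in *; simpl snd in *.
assert (Hp : 0 <= p / 2 ^ N) by (apply size_pos; unfold p; lra).
assert (Hq : 0 <= q / 2 ^ N) by (apply size_pos; unfold q; lra).
assert (Es : ((p + q) / 2 ^ N = p / 2 ^ N + q / 2 ^ N)%R) by (field; apply pow_nonzero; lra).
rewrite Rminus_0_r Rabs_pos_eq in HN'; [|lra]. rewrite Es in HN'.
set (u := (p / 2 ^ N)%R) in *. set (v := (q / 2 ^ N)%R) in *.
set (g := fun w => (k (X, Y) - A * (X, Y)) + A * w).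
assert (Cg : forall w, continuous g w).
{ intros w. apply filterlim_Cplus; [apply filterlim_const|].
  apply filterlim_Cmult; [apply filterlim_const|apply filterlim_id]. }
assert (Ck : on_rect (continuous k) x (x + u) y (y + v)) by (apply continuous_sub; lra).
assert (E : rect_int k x (x + u) y (y + v) = rect_int (fun w => k w - g w) x (x + u) y (y + v)).
{ rewrite rect_int_minus; [|lra|lra|exact Ck|intros ? ? _ _; apply Cg].
  unfold g at 1. rewrite rect_int_affine; [ring|lra|lra]. }
rewrite E.
apply: Rle_trans.
{ apply (rect_int_bound _ _ _ _ _ (e / K * (u + v))); [lra|lra| |].
  - intros s t Hs Ht. apply filterlim_Cminus; [apply Ck; lra|apply Cg].
  - intros s t Hs Ht.
    assert (Hd : Cmod ((s, t) - (X, Y)) <= u + v).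
    { apply: Rle_trans; [apply Cmod_le_Rabs|]. simpl.
      apply Rplus_le_compat; apply Rabs_le; lra. }
    unfold g.
    replace (k (s, t) - (k (X, Y) - A * (X, Y) + A * (s, t)))
      with (k (s, t) - k (X, Y) - A * ((s, t) - (X, Y))) by ring.
    apply: Rle_trans; [apply Hw; lra|].
    apply Rmult_le_compat_l; lra. }
replace (x + u - x + (y + v - y))%R with (u + v)%R by ring.
rewrite -Es.
replace (2 * (e / K * ((p + q) / 2 ^ N)) * ((p + q) / 2 ^ N))%R
  with ((2 * (p + q) ^ 2 / K) * (e / 4 ^ N))%R.
- rewrite -{2}(Rmult_1_l (e / 4 ^ N)). apply Rmult_le_compat_r.
  + apply Rdiv_le_0_compat; [lra|apply pow_lt; lra].
  + apply Rle_div_l; [exact HK|]. unfold K. lra.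
- replace 4%R with (2 * 2)%R by ring. rewrite Rpow_mult_distr. field.
  split; [|lra]. apply pow_nonzero. lra.
Qed.

Lemma goursat : rect_int k a b c d = 0.
Proof.
apply Cmod_eq_0, Rle_antisym; [|apply Cmod_ge_0].
apply Rnot_lt_le. intros Hlt.
(* Half of the modulus, so that the initial rectangle is bad with a strict inequality. *)
set (e := (Cmod (rect_int k a b c d) / 2)%R).
assert (He : 0 < e) by (unfold e; lra).
assert (B0 : bad e 0 (a, c)).
{ split; [unfold in_rect; simpl; unfold p, q; lra|].
  unfold piece. simpl. unfold p, q.
  replace (a + (b - a) / 1)%R with b by field. replace (c + (d - c) / 1)%R with d by field.
  unfold e. lra. }
(* Dependent choice: each stage carries the proof that its piece is bad, which is what [bad_step]
   consumes. *)
set (next := fun n (z : {z | bad e n z}) =>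
  let w := constructive_indefinite_description _ (bad_step e n _ (proj2_sig z)) in
  exist (bad e (S n)) (proj1_sig w) (proj1 (proj2_sig w))).
set (zs := fix zs n : {z | bad e n z} :=
  match n with O => exist _ (a, c) B0 | S m => next m (zs m) end).
set (z := fun n => proj1_sig (zs n)).
assert (Hz : forall n, bad e n (z n)) by (intros n; apply (proj2_sig (zs n))).
assert (Hs : forall n, fst (z n) <= fst (z (S n)) /\
    fst (z (S n)) + p / 2 ^ (S n) <= fst (z n) + p / 2 ^ n /\
    snd (z n) <= snd (z (S n)) /\ snd (z (S n)) + q / 2 ^ (S n) <= snd (z n) + q / 2 ^ n).
{ intros n. unfold z. simpl zs. unfold next. simpl proj1_sig.
  exact (proj2 (proj2_sig (constructive_indefinite_description _
    (bad_step e n _ (proj2_sig (zs n)))))). }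
clearbody z. clear zs next.
destruct (nested_limit (fun n => fst (z n)) p) as [X HX].
{ intros n; apply (Hs n). } { intros n; apply (Hs n). } { unfold p; lra. }
destruct (nested_limit (fun n => snd (z n)) q) as [Y HY].
{ intros n; apply (Hs n). } { intros n; apply (Hs n). } { unfold q; lra. }
destruct (Hz O) as [[R1 [R2 [R3 R4]]] _].
pose proof (HX O) as HX0. pose proof (HY O) as HY0.
destruct (small_rect e X Y He) as [N HN]; [lra|lra|].
destruct (Hz N) as [HR HB]. specialize (HN (z N) HR (HX N) (HY N)). lra.
Qed.

End Goursat.

(** * Circle means and Cauchy's formula *)

Lemma Ceq_eps (x y : C) : (forall eps, 0 < eps -> Cmod (x - y) <= eps) -> x = y.
Proof.
intros H. apply Ceq_minus, Cmod_eq_0, Rle_antisym; [|apply Cmod_ge_0].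
apply le_epsilon. intros eps He. rewrite Rplus_0_l. apply H, He.
Qed.

Definition circle (r t : R) : C := (r * cos t, r * sin t)%R.

Lemma Cmod_circle (r t : R) : 0 <= r -> Cmod (circle r t) = r.
Proof.
intros Hr. unfold Cmod, circle; simpl fst; simpl snd.
replace ((r * cos t) ^ 2 + (r * sin t) ^ 2)%R with (r ^ 2)%R.
- apply sqrt_pow2, Hr.
- pose proof (sin2_cos2 t) as H. unfold Rsqr in H. nra.
Qed.

Lemma Cexp_circle (x y : R) : Cexp (x, y) = circle (exp x) y.
Proof. reflexivity. Qed.

Lemma continuous_circle (p : R * R) :
  continuous (fun p : R * R => circle (fst p) (snd p)) p.
Proof.
apply filterlim_pair_C.
- apply (continuous_mult (fun p : R * R => fst p) (fun p : R * R => cos (snd p))).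
  + apply continuous_fst.
  + apply (continuous_comp snd cos); [apply continuous_snd|].
    apply continuity_pt_filterlim, continuity_cos.
- apply (continuous_mult (fun p : R * R => fst p) (fun p : R * R => sin (snd p))).
  + apply continuous_fst.
  + apply (continuous_comp snd sin); [apply continuous_snd|].
    apply continuity_pt_filterlim, continuity_sin.
Qed.

Lemma continuous_circle_r (r t : R) : continuous (circle r) t.
Proof.
apply (continuous_comp (fun t : R => (r, t)) (fun p : R * R => circle (fst p) (snd p)));
  [|apply continuous_circle].
intros P [d Hd]. exists d. intros y Hy. apply Hd. split; [apply ball_center|exact Hy].
Qed.

(** Heine's theorem transversally to a compact slice: continuity is assumed only at the points of
    the slice, and a finite cover by the gauge [delta] gives one width for all [t]. *)
Lemma uniform_continuity_slice (Phi : R * R -> C) (s A B : R) :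
  (forall t, A <= t <= B -> continuous Phi (s, t)) ->
  forall eps, 0 < eps -> exists d, 0 < d /\
    forall r t, Rabs (r - s) < d -> A <= t <= B -> Cmod (Phi (r, t) - Phi (s, t)) < eps.
Proof.
intros H eps He.
assert (Hd : forall t, exists d : posreal, A <= t <= B ->
  forall r t', Rabs (r - s) < d -> Rabs (t' - t) < d ->
    Cmod (Phi (r, t') - Phi (s, t)) < eps / 2).
{ intros t. destruct (classic (A <= t <= B)) as [Ht|Ht]; [|exists (mkposreal 1 Rlt_0_1); tauto].
  pose proof (H t Ht) as Hc. apply filterlim_C with (eps := (eps / 2)%R) in Hc; [|lra].
  destruct Hc as [d Hd]. exists d. intros _ r t' Hr Ht'.
  apply (Hd (r, t')). split; assumption. }
set (delta := fun t => proj1_sig (constructive_indefinite_description _ (Hd t))).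
assert (Hdelta : forall t, A <= t <= B -> forall r t', Rabs (r - s) < delta t ->
    Rabs (t' - t) < delta t -> Cmod (Phi (r, t') - Phi (s, t)) < eps / 2).
{ intros t. exact (proj2_sig (constructive_indefinite_description _ (Hd t))). }
clearbody delta.
destruct (compactness_value_1d A B delta) as [d Hcomp].
exists d. split; [apply cond_pos|]. intros r t Hr Ht.
(* The compactness lemma provides the covering point under a double negation. *)
destruct (NNPP _ (Hcomp t Ht)) as [t0 [Ht0 [K1 K2]]].
pose proof (Hdelta t0 Ht0 r t ltac:(lra) K1) as E1.
assert (E0 : Rabs (s - s) < delta t0).
{ replace (s - s)%R with 0%R by ring. rewrite Rabs_R0. apply cond_pos. }
pose proof (Hdelta t0 Ht0 s t E0 K1) as E2.
replace (Phi (r, t) - Phi (s, t)) with ((Phi (r, t) - Phi (s, t0)) + - (Phi (s, t) - Phi (s, t0))) by ring.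
apply: Rle_lt_trans; [apply Cmod_triangle|]. rewrite Cmod_opp. lra.
Qed.

(** Integration against the angle, that is against [dw / (i w)]. Cauchy's kernel therefore appears
    below as [w / (w - a)], and the normalising factor is [2 pi]. *)
Definition circle_int (f : C -> C) (r : R) : C := CInt (fun t => f (circle r t)) 0 (2 * PI).

Section MeanValue.

Variables (H : C -> C) (a : C) (R0 : R).
Hypothesis Hc : forall z, Cmod z < R0 -> continuous H z.
Hypothesis Hd : forall z, Cmod z < R0 -> z <> 0 -> z <> a -> cdiff H z.

Let twopi_pos : 0 < 2 * PI.
Proof. pose proof PI_RGT_0. lra. Qed.

Let cont_circle r t : 0 <= r < R0 -> continuous (fun t => H (circle r t)) t.
Proof.
intros Hr. apply (continuous_comp (circle r) H); [apply continuous_circle_r|].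
apply Hc. rewrite Cmod_circle; lra.
Qed.

(** The horizontal sides of the logarithmic rectangle cancel by periodicity of [Cexp], and its
    vertical sides are the two circles. Two exceptional points are tolerated: [0] serves removable
    singularities, [a] serves the difference quotient in Cauchy's formula. *)
Lemma circle_int_annulus (r1 r2 : R) :
  0 < r1 -> r1 <= r2 -> r2 < R0 -> (Cmod a < r1 \/ r2 < Cmod a) ->
  circle_int H r1 = circle_int H r2.
Proof.
intros H1 H12 H2 Ha.
assert (Hln : ln r1 <= ln r2).
{ destruct H12 as [H12| ->]; [|apply Rle_refl]. apply Rlt_le, ln_increasing; assumption. }
pose proof (goursat (fun w => H (Cexp w)) (ln r1) (ln r2) 0 (2 * PI) Hln ltac:(lra)) as G.
assert (Hk : on_rect (cdiff (fun w => H (Cexp w))) (ln r1) (ln r2) 0 (2 * PI)).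
{ intros x y Hx _. apply cdiff_comp; [eexists; apply cderiv_Cexp|].
  assert (B1 : r1 <= exp x).
  { rewrite -(exp_ln r1); [|exact H1]. destruct Hx as [[Hx| ->] _]; [|lra].
    apply Rlt_le, exp_increasing, Hx. }
  assert (B2 : exp x <= r2).
  { rewrite -(exp_ln r2); [|lra]. destruct Hx as [_ [Hx| ->]]; [|lra].
    apply Rlt_le, exp_increasing, Hx. }
  apply Hd.
  - rewrite Cmod_Cexp. simpl. lra.
  - apply Cexp_neq_0.
  - intros E. apply (f_equal Cmod) in E. rewrite Cmod_Cexp in E. simpl in E. lra. }
specialize (G Hk). unfold rect_int in G.
rewrite (CInt_ext (fun x => H (Cexp (x, 0%R))) (fun x => H (Cexp (x, (2 * PI)%R)))) in G;
  [|exact Hln|].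
2:{ intros t _. unfold Cexp; simpl. rewrite cos_2PI sin_2PI cos_0 sin_0. reflexivity. }
assert (G2 : CInt (fun y => H (Cexp (ln r2, y))) 0 (2 * PI)
  - CInt (fun y => H (Cexp (ln r1, y))) 0 (2 * PI) = 0).
{ destruct (Ceq_dec (CInt (fun y => H (Cexp (ln r2, y))) 0 (2 * PI)
  - CInt (fun y => H (Cexp (ln r1, y))) 0 (2 * PI)) 0) as [E|n]; [exact E|].
  exfalso. apply (Cmult_neq_0 _ _ Ci_nz n). rewrite -G. ring. }
apply Ceq_minus in G2. unfold circle_int.
rewrite (CInt_ext _ (fun y => H (Cexp (ln r1, y)))); [|lra|].
2:{ intros t _. rewrite Cexp_circle exp_ln; [reflexivity|lra]. }
rewrite -G2. apply CInt_ext; [lra|].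
intros t _. rewrite Cexp_circle exp_ln; [reflexivity|lra].
Qed.

Lemma circle_int_continuous (s : R) : 0 <= s < R0 -> forall eps, 0 < eps ->
  exists d, 0 < d /\ forall r, 0 <= r < R0 -> Rabs (r - s) < d ->
    Cmod (circle_int H r - circle_int H s) <= eps.
Proof.
intros Hs eps He.
destruct (uniform_continuity_slice (fun p => H (circle (fst p) (snd p))) s 0 (2 * PI))
  with (eps := (eps / (2 * PI))%R) as [d [Hd0 Hd1]].
- intros t _.
  apply (continuous_comp (fun p : R * R => circle (fst p) (snd p)) H); [apply continuous_circle|].
  apply Hc. simpl. rewrite Cmod_circle; lra.
- apply Rdiv_lt_0_compat; assumption.
- exists d. split; [exact Hd0|]. intros r Hr Hrs.
  unfold circle_int. rewrite -CInt_minus; [|lra|intros t _; apply cont_circle; lra|intros t _; apply cont_circle; lra].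
  apply Rle_trans with (eps / (2 * PI) * (2 * PI - 0))%R.
  + apply Cmod_CInt_le; [lra| |].
    * intros t _. apply filterlim_Cminus; apply cont_circle; lra.
    * intros t Ht. apply Rlt_le, (Hd1 r t Hrs Ht).
  + right. field. pose proof PI_RGT_0. lra.
Qed.

(** At radius [0] the circle is a point and the integral is [2 pi H 0]. The radius is irrelevant on
    either side of [|a|], and continuity in the radius joins the pieces at [0] and at [|a|]. *)
Lemma circle_mean_value (r : R) :
  0 <= r < R0 -> circle_int H r = RtoC (2 * PI) * H 0.
Proof.
assert (H0 : circle_int H 0 = RtoC (2 * PI) * H 0).
{ unfold circle_int. rewrite -[X in RtoC X](Rminus_0_r (2 * PI)) -CInt_const.
  apply CInt_ext; [lra|]. intros t _. f_equal. unfold circle. apply injective_projections; simpl; ring. }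
assert (Hlt : forall r, 0 < r < R0 -> r < Cmod a -> circle_int H r = circle_int H 0).
{ intros s Hs Hsa. apply Ceq_eps. intros eps He.
  destruct (circle_int_continuous 0 ltac:(lra) eps He) as [d [Hd0 Hd1]].
  set (s' := Rmin s (d / 2)).
  assert (B1 : 0 < s') by (apply Rmin_pos; lra).
  assert (B2 : s' <= s) by apply Rmin_l.
  assert (B3 : s' <= d / 2) by apply Rmin_r.
  rewrite -(circle_int_annulus s' s); [|lra|lra|lra|right; exact Hsa].
  apply Hd1; [lra|]. rewrite Rabs_pos_eq; lra. }
assert (Heq : 0 < Cmod a < R0 -> circle_int H (Cmod a) = circle_int H 0).
{ intros Ha. symmetry. apply Ceq_eps. intros eps He.
  destruct (circle_int_continuous (Cmod a) ltac:(lra) eps He) as [d [Hd0 Hd1]].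
  set (s' := Rmax (Cmod a / 2) (Cmod a - d / 2)).
  assert (B1 : Cmod a / 2 <= s') by apply Rmax_l.
  assert (B2 : Cmod a - d / 2 <= s') by apply Rmax_r.
  assert (B3 : s' < Cmod a) by (apply Rmax_lub_lt; lra).
  rewrite -(Hlt s'); [|lra|lra].
  apply Hd1; [lra|]. apply Rabs_lt_between. lra. }
intros Hr. rewrite -H0.
destruct (Rlt_le_dec 0 r) as [Hr0|Hr0]; [|replace r with 0%R by lra; reflexivity].
destruct (Rtotal_order r (Cmod a)) as [Hra|[Hra|Hra]].
- apply Hlt; [lra|exact Hra].
- rewrite Hra. apply Heq. lra.
- assert (Ha0 : circle_int H (Cmod a) = circle_int H 0).
  { destruct (Cmod_ge_0 a) as [Ha|Ha]; [apply Heq; lra|rewrite -Ha; reflexivity]. }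
  rewrite -Ha0. apply Ceq_eps. intros eps He.
  pose proof (Cmod_ge_0 a) as Ha.
  destruct (circle_int_continuous (Cmod a) ltac:(lra) eps He) as [d [Hd0 Hd1]].
  set (s' := Rmin r (Cmod a + d / 2)).
  assert (B1 : s' <= r) by apply Rmin_l.
  assert (B2 : s' <= Cmod a + d / 2) by apply Rmin_r.
  assert (B3 : Cmod a < s') by (apply Rmin_glb_lt; lra).
  rewrite -(circle_int_annulus s' r); [|lra|lra|lra|left; exact B3].
  apply Hd1; [lra|]. apply Rabs_lt_between. lra.
Qed.

End MeanValue.

Lemma circle_neq (r t : R) (z : C) : Cmod z < r -> circle r t - z <> 0.
Proof.
intros Hz E. apply Ceq_minus in E. apply (f_equal Cmod) in E.
rewrite Cmod_circle in E; pose proof (Cmod_ge_0 z); lra.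
Qed.

Lemma cont_on_circle (P : C -> C) (r A B : R) :
  (forall z, Cmod z = r -> continuous P z) -> 0 <= r ->
  cont_on (fun t => P (circle r t)) A B.
Proof.
intros Hc Hr t _. apply (continuous_comp (circle r) P); [apply continuous_circle_r|].
apply Hc, Cmod_circle, Hr.
Qed.

(* On the circle the conjugate of [zeta / (zeta - a)] is the boundary value of
   the holomorphic function [r^2 / (r^2 - conj a * zeta)]. *)
Lemma cauchy_kernel_int (a : C) (r : R) :
  Cmod a < r -> a <> 0 -> circle_int (fun w => w / (w - a)) r = RtoC (2 * PI).
Proof.
intros Ha Ha0.
assert (Ha' : 0 < Cmod a) by (apply Cmod_gt_0; exact Ha0).
set (h := fun w => RtoC (r ^ 2) / (RtoC (r ^ 2) - Cconj a * w)).
assert (Hne : forall z, Cmod z < r ^ 2 / Cmod a -> RtoC (r ^ 2) - Cconj a * z <> 0).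
{ intros z Hz E. apply Ceq_minus in E. apply (f_equal Cmod) in E.
  rewrite Cmod_R Cmod_mult Cmod_conj Rabs_pos_eq in E; [|apply pow2_ge_0].
  apply Rlt_div_r in Hz; [|exact Ha']. lra. }
assert (Hh : forall z, Cmod z < r ^ 2 / Cmod a -> cdiff h z).
{ intros z Hz. apply cdiff_div; [apply Hne, Hz|apply cdiff_const|].
  apply cdiff_minus; [apply cdiff_const|apply cdiff_mult; [apply cdiff_const|apply cdiff_id]]. }
assert (Hr : 0 <= r < r ^ 2 / Cmod a).
{ split; [lra|]. apply Rlt_div_r; [exact Ha'|]. simpl. nra. }
assert (E : circle_int (fun w => Cconj (w / (w - a))) r = circle_int h r).
{ apply CInt_ext; [pose proof PI_RGT_0; lra|]. intros t _. unfold h.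
  assert (N1 := circle_neq r t a Ha).
  rewrite Cdiv_conj; [|exact N1]. rewrite Cminus_conj.
  assert (N2 := Hne (circle r t) ltac:(rewrite Cmod_circle; lra)).
  assert (N3 : circle r t <> 0).
  { intros E. apply (f_equal Cmod) in E. rewrite Cmod_circle in E; [|lra]. rewrite Cmod_0 in E. lra. }
  assert (N4 : Cconj (circle r t) - Cconj a <> 0).
  { rewrite -Cminus_conj. intros E. apply N1.
    rewrite -(Cconj_conj (circle r t - a)) E. apply injective_projections; simpl; ring. }
  assert (Er : RtoC (r ^ 2) = circle r t * Cconj (circle r t)).
  { rewrite -Cmod2_conj Cmod_circle; [reflexivity|lra]. }
  rewrite Er. rewrite Er in N2.
  set (w := circle r t) in *. set (v := Cconj w) in *.
  replace (w * v - Cconj a * w) with (w * (v - Cconj a)) by ring.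
  field. split; [exact N4|exact N3]. }
assert (Hcc : cont_on (fun t => circle r t / (circle r t - a)) 0 (2 * PI)).
{ intros t _. apply filterlim_Cdiv; [apply circle_neq, Ha|apply continuous_circle_r|].
  apply filterlim_Cminus; [apply continuous_circle_r|apply filterlim_const]. }
unfold circle_int at 1 in E. rewrite CInt_conj in E; [|pose proof PI_RGT_0; lra|exact Hcc].
fold (circle_int (fun w => w / (w - a)) r) in E.
rewrite (circle_mean_value h 0 (r ^ 2 / Cmod a)) in E; [| |intros; auto|exact Hr].
2:{ intros z Hz. apply cdiff_continuous, Hh, Hz. }
rewrite -(Cconj_conj (circle_int (fun w => w / (w - a)) r)) E.
unfold h. replace (RtoC (r ^ 2) / (RtoC (r ^ 2) - Cconj a * 0)) with (RtoC 1).
- rewrite Cmult_1_r. apply injective_projections; simpl; ring.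
- field. apply RtoC_neq || (intros E0; apply RtoC_inj in E0; simpl in E0; nra).
Qed.

(** For [a <> 0] the mean value property is applied to [w * (P w - P a) / (w - a)], which vanishes
    at [0]; the term with [P a] is then evaluated by [cauchy_kernel_int]. For [a = 0] the kernel is
    [1]. At [0] only continuity of [P] enters, which is what makes singularities removable. *)
Lemma cauchy_formula (P : C -> C) (R0 r : R) (a : C) :
  (forall z, Cmod z < R0 -> continuous P z) ->
  (forall z, Cmod z < R0 -> z <> 0 -> cdiff P z) ->
  Cmod a < r < R0 ->
  circle_int (fun w => P w * (w / (w - a))) r = RtoC (2 * PI) * P a.
Proof.
intros Hc Hd Hr. pose proof (Cmod_ge_0 a) as Ha.
assert (Hpi : 0 <= 2 * PI) by (pose proof PI_RGT_0; lra).
destruct (Ceq_dec a 0) as [->|Ha0].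
- rewrite -(circle_mean_value P 0 R0 Hc (fun z H1 H2 _ => Hd z H1 H2) r); [|lra].
  apply CInt_ext; [exact Hpi|]. intros t _.
  assert (N := circle_neq r t 0 (proj1 Hr)). field. 
  replace (circle r t) with (circle r t - 0) by ring. exact N.
(* The Caratheodory slope [phi] is the difference quotient at [a], already extended continuously
   over [a]. *)
- destruct (Hd a ltac:(lra) Ha0) as [l [phi [Hphi [El Cphi]]]].
  assert (Hq : forall w, w <> a -> phi w = (P w - P a) / (w - a)).
  { intros w Hw. rewrite (Hphi w). field. apply Cminus_eq_contra, Hw. }
  assert (Hnear : forall z, z <> a -> locally z (fun w => w * ((P w - P a) / (w - a)) = w * phi w)).
  { intros z Hz. apply locally_Cmod. exists (Cmod (z - a)).
    split; [apply Cmod_gt_0, Cminus_eq_contra, Hz|].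
    intros w Hw. rewrite Hq; [reflexivity|]. intros ->.
    replace (a - z) with (- (z - a)) in Hw by ring. rewrite Cmod_opp in Hw. lra. }
  assert (HHd : forall z, Cmod z < R0 -> z <> 0 -> z <> a -> cdiff (fun w => w * phi w) z).
  { intros z Hz Hz0 Hza. apply (cdiff_ext_loc _ _ _ (Hnear z Hza)).
    apply cdiff_mult; [apply cdiff_id|].
    apply cdiff_div; [apply Cminus_eq_contra, Hza| |].
    - apply cdiff_minus; [apply Hd; assumption|apply cdiff_const].
    - apply cdiff_minus; [apply cdiff_id|apply cdiff_const]. }
  assert (HHc : forall z, Cmod z < R0 -> continuous (fun w => w * phi w) z).
  { intros z Hz. destruct (Ceq_dec z a) as [->|Hza].
    - apply filterlim_Cmult; [apply filterlim_id|exact Cphi].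
    - apply (continuous_ext_loc _ (fun w => w * ((P w - P a) / (w - a)))).
      + exact (Hnear z Hza).
      + apply filterlim_Cmult; [apply filterlim_id|].
        apply filterlim_Cdiv; [apply Cminus_eq_contra, Hza| |].
        * apply filterlim_Cminus; [apply Hc, Hz|apply filterlim_const].
        * apply filterlim_Cminus; [apply filterlim_id|apply filterlim_const]. }
  pose proof (circle_mean_value _ a R0 HHc HHd r ltac:(lra)) as M.
  simpl in M. rewrite Cmult_0_l Cmult_0_r in M.
  rewrite -(cauchy_kernel_int a r (proj1 Hr) Ha0).
  rewrite Cmult_comm. unfold circle_int.
  assert (Cker : cont_on (fun t => circle r t / (circle r t - a)) 0 (2 * PI)).
  { intros t _. apply filterlim_Cdiv; [apply circle_neq, Hr|apply continuous_circle_r|].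
    apply filterlim_Cminus; [apply continuous_circle_r|apply filterlim_const]. }
  rewrite -CInt_scal; [|exact Hpi|exact Cker].
  apply Ceq_minus. rewrite -M -CInt_minus; [|exact Hpi| |apply cont_on_scal, Cker].
  + apply CInt_ext; [exact Hpi|]. intros t _. rewrite Hq.
    * field. apply circle_neq, Hr.
    * intros E. apply (circle_neq r t a (proj1 Hr)). rewrite E. ring.
  + intros t Ht. apply filterlim_Cmult; [|apply Cker, Ht].
    apply (cont_on_circle P r 0 (2 * PI)); [|lra|exact Ht].
    intros z Hz. apply Hc. lra.
Qed.

(** * Divided differences, the maximum principle and Schwarz-Pick *)

(** [G] is the slope of [P] and, on the diagonal, its derivative. One constant bounds [G] and its
    oscillation, so that a common [L] for a sequence of functions survives pointwise limits. *)
Definition divided_difference (P : C -> C) (rho L : R) (G : C -> C -> C) : Prop :=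
  (forall z w, Cmod z <= rho -> Cmod w <= rho -> P z - P w = (z - w) * G z w) /\
  (forall z w, Cmod z <= rho -> Cmod w <= rho -> Cmod (G z w) <= L) /\
  (forall z w z' w', Cmod z <= rho -> Cmod w <= rho -> Cmod z' <= rho -> Cmod w' <= rho ->
     Cmod (G z w - G z' w') <= L * (Cmod (z - z') + Cmod (w - w'))).

Lemma Cmod_inv_le (x : C) (d : R) : 0 < d -> d <= Cmod x -> Cmod (/ x) <= / d.
Proof.
intros Hd Hx. rewrite Cmod_inv; [apply Rinv_le_contravar; assumption|].
apply Cmod_gt_0. lra.
Qed.

Lemma Cmod_sub_ge (x y : C) : Cmod x - Cmod y <= Cmod (x - y).
Proof.
pose proof (Cmod_triangle (x - y) y) as T1. replace (x - y + y) with x in T1 by ring. lra.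
Qed.

(** Subtracting two instances of Cauchy's formula leaves the kernel [u / ((u - z) * (u - w))], with
    [u] on the circle. Each denominator is at least [r - rho]: two of them give the bound on [G],
    three its Lipschitz constant. The constant depends on [P] through [B] only, which makes it
    uniform along a bounded sequence. *)
Lemma cauchy_divided_difference (P : C -> C) (r rho B : R) :
  0 <= rho < r ->
  cont_on (fun t => P (circle r t)) 0 (2 * PI) ->
  (forall t, 0 <= t <= 2 * PI -> Cmod (P (circle r t)) <= B) ->
  (forall a, Cmod a < r ->
     circle_int (fun w => P w * (w / (w - a))) r = RtoC (2 * PI) * P a) ->
  exists G, divided_difference P rho (B * r * (/ (r - rho) ^ 2 + / (r - rho) ^ 3)) G.
Proof.
intros Hr Hcont HB HC.
pose proof PI_RGT_0 as Hpi.
assert (Hpi2 : RtoC (2 * PI) <> 0) by (intros E; apply RtoC_inj in E; lra).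
assert (HB0 : 0 <= B) by (apply: Rle_trans; [|apply (HB 0%R); lra]; apply Cmod_ge_0).
set (d := (r - rho)%R). assert (Hd : 0 < d) by (unfold d; lra).
assert (Hge : forall t z, Cmod z <= rho -> d <= Cmod (circle r t - z)).
{ intros t z Hz. pose proof (Cmod_sub_ge (circle r t) z) as T1.
  rewrite Cmod_circle in T1; [|lra]. unfold d. lra. }
assert (Hne : forall t z, Cmod z <= rho -> circle r t - z <> 0) by (intros; apply circle_neq; lra).
set (K := fun z w t => P (circle r t) * (circle r t * (/ (circle r t - z) * / (circle r t - w)))).
assert (CI : forall t z, Cmod z <= rho -> continuous (fun t => / (circle r t - z)) t).
{ intros t z Hz. apply filterlim_Cinv; [apply Hne, Hz|].
  apply filterlim_Cminus; [apply continuous_circle_r|apply filterlim_const]. }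
assert (CK : forall z w, Cmod z <= rho -> Cmod w <= rho -> cont_on (K z w) 0 (2 * PI)).
{ intros z w Hz Hw t Ht. apply filterlim_Cmult; [apply Hcont, Ht|].
  apply filterlim_Cmult; [apply continuous_circle_r|].
  apply filterlim_Cmult; apply CI; assumption. }
assert (Hinv : forall t z, Cmod z <= rho -> Cmod (/ (circle r t - z)) <= / d).
{ intros t z Hz. apply Cmod_inv_le; [exact Hd|apply Hge, Hz]. }
assert (Hid : 0 < / d) by (apply Rinv_0_lt_compat, Hd).
assert (Hbd : forall (J : R -> C) M, cont_on J 0 (2 * PI) -> (forall t, 0 <= t <= 2 * PI -> Cmod (J t) <= M) ->
   Cmod (/ RtoC (2 * PI) * CInt J 0 (2 * PI)) <= M).
{ intros J M HJ HM. rewrite Cmod_mult Cmod_inv; [|exact Hpi2].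
  rewrite Cmod_R Rabs_pos_eq; [|lra].
  apply Rle_trans with (/ (2 * PI) * (M * (2 * PI - 0)))%R.
  - apply Rmult_le_compat_l; [apply Rlt_le, Rinv_0_lt_compat; lra|].
    apply Cmod_CInt_le; [lra|exact HJ|exact HM].
  - right. field. lra. }
assert (E2 : (/ d ^ 2 = / d * / d)%R) by (field; lra).
assert (E3 : (/ d ^ 3 = / d * / d * / d)%R) by (field; lra).
assert (HBr : 0 <= B * r) by nra.
assert (P2 : 0 < / d * / d) by nra. assert (P3 : 0 < / d * / d * / d) by nra.
exists (fun z w => / RtoC (2 * PI) * CInt (K z w) 0 (2 * PI)).
split; [|split].
- intros z w Hz Hw.
  assert (E : RtoC (2 * PI) * P z - RtoC (2 * PI) * P w = (z - w) * CInt (K z w) 0 (2 * PI)).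
  { rewrite -(HC z); [|lra]. rewrite -(HC w); [|lra]. unfold circle_int.
    rewrite -CInt_minus; [|lra| |].
    - rewrite -CInt_scal; [|lra|apply CK; assumption].
      apply CInt_ext; [lra|]. intros t _. unfold K. field. split; apply Hne; assumption.
    - intros t Ht. apply filterlim_Cmult; [apply Hcont, Ht|].
      apply filterlim_Cmult; [apply continuous_circle_r|apply CI, Hz].
    - intros t Ht. apply filterlim_Cmult; [apply Hcont, Ht|].
      apply filterlim_Cmult; [apply continuous_circle_r|apply CI, Hw]. }
  replace ((z - w) * (/ RtoC (2 * PI) * CInt (K z w) 0 (2 * PI)))
    with (/ RtoC (2 * PI) * ((z - w) * CInt (K z w) 0 (2 * PI))) by ring.
  rewrite -E. field. exact Hpi2.
- intros z w Hz Hw. apply Hbd; [apply CK; assumption|].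
  intros t Ht. unfold K. rewrite !Cmod_mult. rewrite (Cmod_circle r t); [|lra].
  pose proof (HB t Ht). pose proof (Hinv t z Hz). pose proof (Hinv t w Hw).
  pose proof (Cmod_ge_0 (P (circle r t))).
  pose proof (Cmod_ge_0 (/ (circle r t - z))). pose proof (Cmod_ge_0 (/ (circle r t - w))).
  apply Rle_trans with (B * (r * (/ d * / d)))%R.
  + apply Rmult_le_compat; [assumption| |assumption|].
    * apply Rmult_le_pos; [lra|nra].
    * apply Rmult_le_compat_l; [lra|]. apply Rmult_le_compat; assumption.
  + fold d. rewrite E2 E3. nra.
- intros z w z' w' Hz Hw Hz' Hw'.
  replace (/ RtoC (2 * PI) * CInt (K z w) 0 (2 * PI) - / RtoC (2 * PI) * CInt (K z' w') 0 (2 * PI))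
    with (/ RtoC (2 * PI) * (CInt (K z w) 0 (2 * PI) - CInt (K z' w') 0 (2 * PI))) by ring.
  rewrite -CInt_minus; [|lra|apply CK; assumption|apply CK; assumption].
  apply Hbd.
  { intros t Ht. apply filterlim_Cminus; apply CK; assumption. }
  intros t Ht. unfold K.
  set (i1 := / (circle r t - z)). set (i2 := / (circle r t - w)).
  set (i3 := / (circle r t - z')). set (i4 := / (circle r t - w')).
  assert (Ed : i1 * i2 - i3 * i4 = (z - z') * (i1 * i3 * i2) + (w - w') * (i3 * i2 * i4)).
  { unfold i1, i2, i3, i4. field. repeat split; apply Hne; assumption. }
  replace (P (circle r t) * (circle r t * (i1 * i2)) - P (circle r t) * (circle r t * (i3 * i4)))
    with (P (circle r t) * (circle r t * (i1 * i2 - i3 * i4))) by ring.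
  rewrite Ed !Cmod_mult (Cmod_circle r t); [|lra].
  pose proof (HB t Ht) as HBt. pose proof (Cmod_ge_0 (P (circle r t))).
  assert (T1 : forall x y v, Cmod x <= / d -> Cmod y <= / d -> Cmod v <= / d ->
    Cmod (x * y * v) <= / d * / d * / d).
  { intros x y v Hx Hy Hv. rewrite !Cmod_mult.
    pose proof (Cmod_ge_0 x). pose proof (Cmod_ge_0 y). pose proof (Cmod_ge_0 v).
    apply Rmult_le_compat; [nra|assumption|apply Rmult_le_compat; assumption|assumption]. }
  assert (T2 : Cmod ((z - z') * (i1 * i3 * i2) + (w - w') * (i3 * i2 * i4))
    <= (Cmod (z - z') + Cmod (w - w')) * (/ d * / d * / d)).
  { apply: Rle_trans; [apply Cmod_triangle|].
    rewrite (Cmod_mult (z - z')) (Cmod_mult (w - w')) Rmult_plus_distr_r.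
    apply Rplus_le_compat; (apply Rmult_le_compat_l; [apply Cmod_ge_0|]); apply T1; apply Hinv; assumption. }
  pose proof (Cmod_ge_0 (z - z')). pose proof (Cmod_ge_0 (w - w')).
  set (D := (Cmod (z - z') + Cmod (w - w'))%R) in *.
  apply Rle_trans with (B * (r * (D * (/ d * / d * / d))))%R.
  + apply Rmult_le_compat; [assumption| |assumption|].
    * apply Rmult_le_pos; [lra|apply Cmod_ge_0].
    * apply Rmult_le_compat_l; [lra|exact T2].
  + fold d. rewrite E2 E3.
    replace (B * (r * (D * (/ d * / d * / d))))%R with (B * r * D * (/ d * / d * / d))%R by ring.
    replace (B * r * (/ d * / d + / d * / d * / d) * D)%R
      with (B * r * D * (/ d * / d) + B * r * D * (/ d * / d * / d))%R by ring.
    assert (0 <= B * r * D) by (apply Rmult_le_pos; [exact HBr|unfold D; lra]). nra.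
Qed.

Lemma divided_difference_cdiff (P : C -> C) (rho L : R) (G : C -> C -> C) (z : C) :
  divided_difference P rho L G -> Cmod z < rho -> cdiff P z.
Proof.
intros [H1 [H2 H3]] Hz. exists (G z z). apply cderiv_eps. intros eps He.
assert (HL : 0 <= L) by (apply: Rle_trans; [|apply (H2 z z); lra]; apply Cmod_ge_0).
exists (Rmin (rho - Cmod z) (eps / (L + 1))). split.
{ apply Rmin_pos; [lra|]. apply Rdiv_lt_0_compat; lra. }
intros w Hw.
assert (W1 : Cmod (w - z) < rho - Cmod z) by (apply: Rlt_le_trans Hw _; apply Rmin_l).
assert (W2 : Cmod (w - z) < eps / (L + 1)) by (apply: Rlt_le_trans Hw _; apply Rmin_r).
assert (W3 : Cmod w <= rho) by (pose proof (Cmod_sub_ge w z); lra).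
rewrite H1; [|lra|lra].
replace ((w - z) * G w z - G z z * (w - z)) with ((G w z - G z z) * (w - z)) by ring.
rewrite Cmod_mult. apply Rmult_le_compat_r; [apply Cmod_ge_0|].
apply: Rle_trans; [apply H3; lra|].
replace (z - z) with (RtoC 0) by ring. rewrite Cmod_0 Rplus_0_r.
apply Rlt_div_r in W2; [|lra]. pose proof (Cmod_ge_0 (w - z)). nra.
Qed.

Lemma circle_bounded (P : C -> C) (r : R) :
  0 <= r -> (forall z, Cmod z = r -> continuous P z) ->
  exists B, forall t, 0 <= t <= 2 * PI -> Cmod (P (circle r t)) <= B.
Proof.
intros Hr Hc. pose proof PI_RGT_0.
destruct (continuity_ab_maj (fun t => Cmod (P (circle r t))) 0 (2 * PI)) as [M [HM _]].
- lra.
- intros t Ht. apply continuity_pt_filterlim.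
  apply (filterlim_Cmod (fun t => P (circle r t))).
  apply (cont_on_circle P r 0 (2 * PI)); assumption.
- exists (Cmod (P (circle r M))). exact HM.
Qed.

Lemma punctured_divided_difference (P : C -> C) (R0 rho : R) :
  (forall z, Cmod z < R0 -> continuous P z) ->
  (forall z, Cmod z < R0 -> z <> 0 -> cdiff P z) ->
  0 <= rho < R0 -> exists L G, 0 <= L /\ divided_difference P rho L G.
Proof.
intros Hc Hd Hrho.
set (r := ((rho + R0) / 2)%R). assert (Hr : rho < r < R0) by (unfold r; lra).
assert (Hcr : forall z, Cmod z = r -> continuous P z) by (intros z Hz; apply Hc; lra).
destruct (circle_bounded P r ltac:(lra) Hcr) as [B HB].
destruct (cauchy_divided_difference P r rho B) as [G HG].
- lra.
- apply cont_on_circle; [exact Hcr|lra].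
- exact HB.
- intros a Ha. apply (cauchy_formula P R0); [exact Hc|exact Hd|lra].
- eexists; exists G. split; [|exact HG].
  destruct HG as [_ [H2 _]]. apply: Rle_trans; [|apply (H2 0 0)]; rewrite ?Cmod_0; try lra.
  apply Cmod_ge_0.
Qed.

Lemma holomorphic_divided_difference (P : C -> C) (R0 rho : R) :
  (forall z, Cmod z < R0 -> cdiff P z) ->
  0 <= rho < R0 -> exists L G, 0 <= L /\ divided_difference P rho L G.
Proof.
intros H. apply punctured_divided_difference.
- intros z Hz. apply cdiff_continuous, H, Hz.
- intros z Hz _. apply H, Hz.
Qed.

(** Cauchy's formula tolerates the exceptional point [0], so the divided difference it produces is
    regular there, and its diagonal value is the missing derivative. *)
Lemma removable_singularity (P : C -> C) (R0 : R) :
  (forall z, Cmod z < R0 -> continuous P z) ->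
  (forall z, Cmod z < R0 -> z <> 0 -> cdiff P z) ->
  forall z, Cmod z < R0 -> cdiff P z.
Proof.
intros Hc Hd z Hz. pose proof (Cmod_ge_0 z).
destruct (punctured_divided_difference P R0 ((Cmod z + R0) / 2) Hc Hd ltac:(lra)) as [L [G [_ HG]]].
apply (divided_difference_cdiff _ _ _ _ _ HG). lra.
Qed.

Definition holo_disc (f : C -> C) : Prop := forall z, Cmod z < 1 -> cdiff f z.

(* Cauchy's formula for [H ^ n] bounds [|H a| ^ n] by [M ^ n] up to a factor
   independent of [n]. *)
Lemma maximum_on_circle (H : C -> C) (r M : R) (a : C) :
  holo_disc H -> Cmod a < r < 1 -> 0 < M ->
  (forall z, Cmod z = r -> Cmod (H z) <= M) -> Cmod (H a) <= M.
Proof.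
intros Hd Hr HM Hb. apply Rnot_lt_le. intros Hlt.
pose proof (Cmod_ge_0 a) as Ha. pose proof PI_RGT_0 as Hpi.
set (q := (Cmod (H a) / M)%R).
assert (Hq : 1 < q).
{ unfold q. apply Rlt_div_r; [exact HM|]. lra. }
set (K := (r / (r - Cmod a))%R).
assert (Hn : forall n, q ^ n <= K).
{ intros n.
  assert (Hdn : forall z, Cmod z < 1 -> cdiff (fun w => Cpow (H w) n) z).
  { intros z Hz. apply cdiff_pow, Hd, Hz. }
  assert (Hcn : forall z, Cmod z < 1 -> continuous (fun w => Cpow (H w) n) z).
  { intros z Hz. apply cdiff_continuous, Hdn, Hz. }
  pose proof (cauchy_formula (fun w => Cpow (H w) n) 1 r a Hcn (fun z Hz _ => Hdn z Hz) ltac:(lra)) as E.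
  apply (f_equal Cmod) in E. rewrite Cmod_mult Cmod_pow Cmod_R Rabs_pos_eq in E; [|lra].
  assert (U : Cmod (circle_int (fun w => Cpow (H w) n * (w / (w - a))) r) <= (M ^ n * K) * (2 * PI - 0)).
  { apply Cmod_CInt_le; [lra| |].
    - intros t Ht. apply filterlim_Cmult.
      + apply (cont_on_circle (fun w => Cpow (H w) n) r 0 (2 * PI)); [|lra|exact Ht].
        intros z Hz. apply Hcn. lra.
      + apply filterlim_Cdiv; [apply circle_neq, Hr|apply continuous_circle_r|].
        apply filterlim_Cminus; [apply continuous_circle_r|apply filterlim_const].
    - intros t _. rewrite Cmod_mult Cmod_pow. apply Rmult_le_compat.
      + apply pow_le, Cmod_ge_0.
      + apply Cmod_ge_0.
      + apply pow_incr. split; [apply Cmod_ge_0|]. apply Hb, Cmod_circle. lra.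
      + unfold Cdiv. rewrite Cmod_mult Cmod_circle; [|lra].
        apply Rmult_le_compat_l; [lra|]. apply Cmod_inv_le; [lra|].
        pose proof (Cmod_sub_ge (circle r t) a) as T. rewrite Cmod_circle in T; lra. }
  rewrite E in U.
  assert (U2 : Cmod (H a) ^ n <= M ^ n * K).
  { apply (Rmult_le_reg_l (2 * PI)); lra. }
  unfold q, Rdiv. rewrite Rpow_mult_distr pow_inv.
  assert (0 < M ^ n) by (apply pow_lt, HM).
  apply Rle_div_l; [assumption|]. lra. }
destruct (Pow_x_infinity q ltac:(rewrite Rabs_pos_eq; lra) (K + 1)%R) as [N HN].
specialize (HN N (le_n _)). specialize (Hn N).
rewrite Rabs_pos_eq in HN; [lra|]. apply pow_le. lra.
Qed.

(* [g z / z] with the singularity removed. *)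
Lemma schwarz_quotient (g : C -> C) :
  holo_disc g -> g 0 = 0 -> (forall z, Cmod z < 1 -> Cmod (g z) <= 1) ->
  exists h, holo_disc h /\ (forall z, g z = z * h z) /\
    (forall z, Cmod z < 1 -> Cmod (h z) <= 1).
Proof.
intros Hg Hg0 Hb.
(* Since [g 0 = 0], the Caratheodory slope of [g] at [0] is the quotient itself, continuous at
   [0]. *)
destruct (Hg 0 ltac:(rewrite Cmod_0; lra)) as [l [h [Hh [_ Ch]]]].
assert (Eh : forall z, g z = z * h z) by (intros z; rewrite (Hh z) Hg0; ring).
assert (Hq : forall z : C, z <> 0 -> h z = g z / z) by (intros z Hz; rewrite (Eh z); field; exact Hz).
assert (Hd0 : forall z : C, Cmod z < 1 -> z <> 0 -> cdiff h z).
{ intros z Hz Hz0. apply (cdiff_ext_loc (fun w => g w / w)).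
  - apply locally_Cmod. exists (Cmod z). split; [apply Cmod_gt_0, Hz0|].
    intros w Hw. rewrite Hq; [reflexivity|]. intros ->.
    replace (0 - z) with (- z) in Hw by ring. rewrite Cmod_opp in Hw. lra.
  - apply cdiff_div; [exact Hz0|apply Hg, Hz|apply cdiff_id]. }
assert (Hd : holo_disc h).
{ refine (removable_singularity h 1 _ Hd0). intros z Hz.
  destruct (Ceq_dec z 0) as [->|Hz0]; [exact Ch|apply cdiff_continuous, Hd0; assumption]. }
exists h. split; [exact Hd|split; [exact Eh|]].
intros a Ha. apply le_epsilon. intros eps He. pose proof (Cmod_ge_0 a) as Ha0.
(* The circle must enclose [a], and on it [|h| <= 1 / r] must not exceed [1 + eps]. *)
set (r := Rmax ((Cmod a + 1) / 2) (/ (1 + eps))).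
assert (I1 : 0 < / (1 + eps)) by (apply Rinv_0_lt_compat; lra).
assert (I2 : / (1 + eps) < 1) by (rewrite -Rinv_1; apply Rinv_lt_contravar; lra).
assert (R1 : (Cmod a + 1) / 2 <= r) by apply Rmax_l.
assert (R2 : / (1 + eps) <= r) by apply Rmax_r.
assert (R3 : r < 1) by (apply Rmax_lub_lt; lra).
apply (maximum_on_circle h r (1 + eps) a Hd); [lra|lra|].
intros z Hz.
assert (Hz0 : z <> 0) by (apply Cmod_gt_0; lra).
rewrite Hq; [|exact Hz0]. rewrite Cmod_div; [|exact Hz0].
apply Rle_div_l; [lra|]. apply Rle_trans with 1%R; [apply Hb; lra|].
rewrite Hz. apply (Rmult_le_reg_l (/ (1 + eps))); [exact I1|].
rewrite -Rmult_assoc Rinv_l; lra.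
Qed.

(** * Disc automorphisms and the Schwarz-Pick inequality *)

Definition moebius (b z : C) : C := (z - b) / (1 - Cconj b * z).

Lemma Cmod_sqr_identity (z w : C) :
  (Cmod (1 - Cconj w * z) ^ 2 - Cmod (z - w) ^ 2 = (1 - Cmod z ^ 2) * (1 - Cmod w ^ 2))%R.
Proof.
rewrite !Cmod2_alt. destruct z as [x y], w as [u v]. simpl. ring.
Qed.

Lemma moebius_den (b z : C) : Cmod b <= 1 -> Cmod z < 1 -> 1 - Cconj b * z <> 0.
Proof.
intros Hb Hz E. apply Ceq_minus in E. apply (f_equal Cmod) in E.
rewrite Cmod_mult Cmod_conj Cmod_1 in E.
pose proof (Cmod_ge_0 b). pose proof (Cmod_ge_0 z). nra.
Qed.

Lemma moebius_self_map (b z : C) : Cmod b < 1 -> Cmod z < 1 -> Cmod (moebius b z) < 1.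
Proof.
intros Hb Hz. pose proof (moebius_den b z ltac:(lra) Hz) as N.
unfold moebius. rewrite Cmod_div; [|exact N].
apply Rlt_div_l; [apply Cmod_gt_0, N|]. rewrite Rmult_1_l.
pose proof (Cmod_sqr_identity z b) as E.
pose proof (Cmod_ge_0 b). pose proof (Cmod_ge_0 z).
pose proof (Cmod_ge_0 (z - b)). pose proof (Cmod_ge_0 (1 - Cconj b * z)).
assert (0 < (1 - Cmod z ^ 2) * (1 - Cmod b ^ 2)) by (apply Rmult_lt_0_compat; nra).
nra.
Qed.

Lemma moebius_cdiff (b z : C) : Cmod b <= 1 -> Cmod z < 1 -> cdiff (moebius b) z.
Proof.
intros Hb Hz. apply cdiff_div; [apply moebius_den; assumption| |].
- apply cdiff_minus; [apply cdiff_id|apply cdiff_const].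
- apply cdiff_minus; [apply cdiff_const|apply cdiff_mult; [apply cdiff_const|apply cdiff_id]].
Qed.

Lemma moebius_inv (b z : C) : Cmod b < 1 -> Cmod z < 1 -> moebius (- b) (moebius b z) = z.
Proof.
intros Hb Hz. pose proof (moebius_den b z ltac:(lra) Hz) as N.
assert (N2 : 1 - Cconj b * b <> 0) by (apply moebius_den; lra).
unfold moebius. rewrite Copp_conj. field. split; [exact N|].
intros E. apply N2. rewrite -E. ring.
Qed.

(** Conjugation by automorphisms moves [w] and [F w] to [0], where the Schwarz lemma applies. The
    cross-multiplied form stays meaningful when a denominator vanishes, as it may for maps into the
    closed disc. *)
Lemma schwarz_pick_strict (F : C -> C) (z w : C) :
  holo_disc F -> (forall z, Cmod z < 1 -> Cmod (F z) < 1) ->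
  Cmod z < 1 -> Cmod w < 1 ->
  Cmod (F z - F w) * Cmod (1 - Cconj w * z) <= Cmod (z - w) * Cmod (1 - Cconj (F w) * F z).
Proof.
intros HF Hs Hz Hw.
set (g := fun x => moebius (F w) (F (moebius (- w) x))).
assert (Hw' : Cmod (- w) < 1) by (rewrite Cmod_opp; exact Hw).
destruct (schwarz_quotient g) as [h [_ [Eh Bh]]].
- intros x Hx. apply (cdiff_comp (fun x => F (moebius (- w) x)) (moebius (F w))).
  + apply (cdiff_comp (moebius (- w)) F); [apply moebius_cdiff; lra|].
    apply HF, moebius_self_map; assumption.
  + apply moebius_cdiff; [apply Rlt_le, Hs, Hw|]. apply Hs, moebius_self_map; assumption.
- unfold g. replace (moebius (- w) 0) with w; unfold moebius; [|field].
  + replace (F w - F w) with (RtoC 0) by ring. unfold Cdiv. ring.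
- intros x Hx. apply Rlt_le, moebius_self_map; [apply Hs, Hw|].
  apply Hs, moebius_self_map; assumption.
- pose proof (Bh (moebius w z) (moebius_self_map w z Hw Hz)) as B.
  pose proof (Eh (moebius w z)) as E. unfold g in E. rewrite moebius_inv in E; [|exact Hw|exact Hz].
  apply (f_equal Cmod) in E. rewrite Cmod_mult in E.
  pose proof (moebius_den w z ltac:(lra) Hz) as N1.
  pose proof (moebius_den (F w) (F z) (Rlt_le _ _ (Hs w Hw)) (Hs z Hz)) as N2.
  unfold moebius in E at 1 2. rewrite !Cmod_div in E; try assumption.
  apply Cmod_gt_0 in N1. apply Cmod_gt_0 in N2.
  set (n1 := Cmod (1 - Cconj w * z)) in *. set (n2 := Cmod (1 - Cconj (F w) * F z)) in *.
  assert (E2 : (Cmod (F z - F w) * n1 = Cmod (z - w) * n2 * Cmod (h (moebius w z)))%R).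
  { replace (Cmod (F z - F w)) with (Cmod (F z - F w) / n2 * n2)%R by (field; lra).
    rewrite E. field. lra. }
  rewrite E2. pose proof (Cmod_ge_0 (z - w)).
  rewrite -{2}(Rmult_1_r (Cmod (z - w) * n2)). apply Rmult_le_compat_l; [|exact B].
  apply Rmult_le_pos; lra.
Qed.

(** The maps [s n * F] with [s n < 1] send the disc strictly inside itself, and the cross-multiplied
    inequality passes to the limit. The closed version is what a Schwarz quotient [F z / z]
    requires. *)
Lemma schwarz_pick (F : C -> C) (z w : C) :
  holo_disc F -> (forall z, Cmod z < 1 -> Cmod (F z) <= 1) ->
  Cmod z < 1 -> Cmod w < 1 ->
  Cmod (F z - F w) * Cmod (1 - Cconj w * z) <= Cmod (z - w) * Cmod (1 - Cconj (F w) * F z).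
Proof.
intros HF Hs Hz Hw.
set (s := fun n : nat => (1 - (/ 2) ^ (S n))%R).
assert (Hlim : is_lim_seq s 1).
{ replace (Finite 1) with (Finite (1 - 0)) by (f_equal; ring).
  apply (is_lim_seq_minus' (fun _ => 1) (fun n => ((/ 2) ^ (S n))%R)); [apply is_lim_seq_const|].
  apply (is_lim_seq_incr_1 (fun n => ((/ 2) ^ n)%R)).
  apply is_lim_seq_geom. rewrite Rabs_pos_eq; lra. }
assert (Hs01 : forall n, 0 <= s n < 1).
{ intros n. unfold s. assert (0 < (/ 2) ^ (S n)) by (apply pow_lt; lra).
  assert ((/ 2) ^ S n <= 1 ^ S n) by (apply pow_incr; lra). rewrite pow1 in H0. lra. }
assert (HCl : filterlim (fun n => RtoC (s n)) eventually (locally (RtoC 1))).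
{ apply filterlim_RtoC. exact Hlim. }
assert (L1 : is_lim_seq (fun n => Cmod (RtoC (s n) * F z - RtoC (s n) * F w) * Cmod (1 - Cconj w * z))%R
   (Cmod (F z - F w) * Cmod (1 - Cconj w * z))%R).
{ apply (is_lim_seq_mult' _ (fun _ => Cmod (1 - Cconj w * z))); [|apply is_lim_seq_const].
  rewrite -{2}(Cmult_1_l (F z)) -{2}(Cmult_1_l (F w)).
  apply (filterlim_Cmod (fun n => RtoC (s n) * F z - RtoC (s n) * F w)).
  apply filterlim_Cminus; (apply filterlim_Cmult; [exact HCl|apply filterlim_const]). }
assert (L2 : is_lim_seq (fun n => Cmod (z - w) * Cmod (1 - Cconj (RtoC (s n) * F w) * (RtoC (s n) * F z)))%R
   (Cmod (z - w) * Cmod (1 - Cconj (F w) * F z))%R).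
{ apply (is_lim_seq_mult' (fun _ => Cmod (z - w))); [apply is_lim_seq_const|].
  rewrite -{2}(Cmult_1_l (F z)) -{2}(Cmult_1_l (F w)).
  apply (filterlim_Cmod (fun n => 1 - Cconj (RtoC (s n) * F w) * (RtoC (s n) * F z))).
  apply filterlim_Cminus; [apply filterlim_const|].
  apply filterlim_Cmult; [apply filterlim_Cconj|];
    (apply filterlim_Cmult; [exact HCl|apply filterlim_const]). }
apply (is_lim_seq_le _ _ _ _ (fun n => schwarz_pick_strict (fun x => RtoC (s n) * F x) z w
  (fun x Hx => cdiff_mult _ _ _ (cdiff_const _ _) (HF x Hx))
  (fun x Hx => ltac:(rewrite Cmod_mult Cmod_R Rabs_pos_eq; pose proof (Hs01 n); pose proof (Hs x Hx); pose proof (Cmod_ge_0 (F x)); nra)) Hz Hw) L1 L2).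
Qed.

(** * Generators of semigroups *)

(* If [F 0 = 0], then [h z = F z / z] maps the disc into the closed disc, and
   Schwarz-Pick applied to [h] at [z] and [1/2] propagates [h (1/2)] close to
   [1] to the whole disc. *)
Lemma near_identity (r : R) : 0 <= r < 1 ->
  exists K, 0 <= K /\ forall F : C -> C,
    holo_disc F -> (forall z, Cmod z < 1 -> Cmod (F z) < 1) -> Cmod (F 0) <= / 2 ->
    forall z, Cmod z <= r ->
      Cmod (F z - z) <= K * (Cmod (F 0) + Cmod (F (RtoC (/ 2)) - RtoC (/ 2))).
Proof.
intros Hr.
assert (Hr2 : 0 < 1 - r ^ 2) by nra.
assert (Hir : 0 < / (1 - r ^ 2)) by (apply Rinv_0_lt_compat, Hr2).
(* [4] is the cost of moving [F 0] to the origin; [96] is [12 * 2 * 4], the constants of [A13],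
   [A14] and [Hbg] below. *)
exists (4 + 96 * / (1 - r ^ 2))%R. split; [lra|].
intros F HF Hs Hb z Hz.
set (c := RtoC (/ 2)). set (b := F 0) in *.
assert (Hc : Cmod c = (/ 2)%R) by (unfold c; rewrite Cmod_R Rabs_pos_eq; lra).
assert (Hc0 : c <> 0) by (apply Cmod_gt_0; lra).
(* The automorphism taking [b] to [0] reduces to a fixed origin. As [|b| <= 1/2], its denominator is
   at least [1/2], and it moves values by at most [4 |b|]. *)
set (g := fun x => moebius b (F x)).
assert (Hbg : forall x, Cmod x < 1 -> Cmod (g x - F x) <= 4 * Cmod b).
{ intros x Hx. unfold g, moebius.
  pose proof (moebius_den b (F x) ltac:(lra) (Hs x Hx)) as N.
  replace ((F x - b) / (1 - Cconj b * F x) - F x)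
    with ((Cconj b * (F x * F x) - b) / (1 - Cconj b * F x)) by (field; exact N).
  rewrite Cmod_div; [|exact N]. apply Rle_div_l; [apply Cmod_gt_0, N|].
  pose proof (Hs x Hx) as Hx1. pose proof (Cmod_ge_0 (F x)). pose proof (Cmod_ge_0 b).
  pose proof (Cmod_sub_ge 1 (Cconj b * F x)) as T1.
  pose proof (Cmod_triangle (Cconj b * (F x * F x)) (- b)) as T2.
  rewrite Cmod_1 Cmod_mult Cmod_conj in T1.
  rewrite !Cmod_mult Cmod_conj Cmod_opp in T2. unfold Cminus at 1.
  assert (Cmod b * Cmod (F x) <= / 2) by nra.
  assert (Cmod (F x) * Cmod (F x) <= 1) by nra.
  assert (Cmod b * (Cmod (F x) * Cmod (F x)) <= Cmod b) by nra.
  apply Rle_trans with (2 * Cmod b)%R; [lra|].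
  replace (2 * Cmod b)%R with (4 * Cmod b * / 2)%R by field.
  apply Rmult_le_compat_l; lra. }
destruct (schwarz_quotient g) as [h [Hh [Eh Bh]]].
{ intros x Hx. apply (cdiff_comp F (moebius b)); [apply HF, Hx|].
  apply moebius_cdiff; [lra|apply Hs, Hx]. }
{ unfold g, moebius. fold b. replace (b - b) with (RtoC 0) by ring. unfold Cdiv. ring. }
{ intros x Hx. apply Rlt_le, moebius_self_map; [lra|apply Hs, Hx]. }
assert (Hz1 : Cmod z < 1) by lra. assert (Hc1 : Cmod c < 1) by lra.
pose proof (schwarz_pick h z c Hh Bh Hz1 Hc1) as SP.
pose proof (Cmod_sqr_identity z c) as Id.
set (N := Cmod (1 - Cconj c * z)) in *. set (M := Cmod (z - c)) in *.
set (X := Cmod (1 - h z)). set (eta := Cmod (1 - h c)).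
assert (A1 : X <= Cmod (h z - h c) + eta).
{ unfold X, eta. replace (1 - h z) with (- (h z - h c) + (1 - h c)) by ring.
  apply: Rle_trans; [apply Cmod_triangle|]. rewrite Cmod_opp. lra. }
assert (A2 : Cmod (1 - Cconj (h c) * h z) <= eta + X).
{ replace (1 - Cconj (h c) * h z) with ((1 - Cconj (h c)) + Cconj (h c) * (1 - h z)) by ring.
  apply: Rle_trans; [apply Cmod_triangle|]. rewrite Cmod_mult.
  replace (1 - Cconj (h c)) with (Cconj (1 - h c))
    by (rewrite Cminus_conj; f_equal; apply injective_projections; simpl; ring).
  rewrite !Cmod_conj. fold eta X. pose proof (Bh c Hc1).
  assert (0 <= X) by apply Cmod_ge_0.
  assert (Cmod (h c) * X <= 1 * X) by (apply Rmult_le_compat_r; assumption). lra. }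
assert (A3 : N <= 3 / 2).
{ unfold N. apply: Rle_trans; [apply Cmod_triangle|].
  rewrite Cmod_opp Cmod_mult Cmod_conj Cmod_1 Hc. pose proof (Cmod_ge_0 z). lra. }
assert (A4 : M <= 3 / 2).
{ unfold M. apply: Rle_trans; [apply Cmod_triangle|]. rewrite Cmod_opp Hc. lra. }
assert (A5 : 0 <= M) by apply Cmod_ge_0. assert (A6 : 0 <= N) by apply Cmod_ge_0.
assert (A7 : 0 <= X) by apply Cmod_ge_0. assert (A8 : 0 <= eta) by apply Cmod_ge_0.
assert (A9 : (1 - r ^ 2) * (3 / 4) <= N ^ 2 - M ^ 2).
{ rewrite Id Hc. assert (Cmod z ^ 2 <= r ^ 2) by (apply pow_incr; split; [apply Cmod_ge_0|exact Hz]).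
  replace (1 - (/ 2) ^ 2)%R with (3 / 4)%R by field. lra. }
(* This gap makes the Schwarz-Pick bound solvable for [X]: [(X - eta) * N <= M * (eta + X)] becomes
   [X * (N - M) <= eta * (N + M) <= 3 * eta]. *)
assert (A10 : (1 - r ^ 2) / 4 <= N - M).
{ assert (A : (N ^ 2 - M ^ 2 = (N - M) * (N + M))%R) by ring.
  destruct (Rle_lt_dec 0 (N - M)) as [P|P]; [|nra].
  assert ((N - M) * (N + M) <= (N - M) * 3) by (apply Rmult_le_compat_l; lra). lra. }
assert (A11 : (X - eta) * N <= M * (eta + X)).
{ apply Rle_trans with (Cmod (h z - h c) * N)%R; [nra|]. apply: Rle_trans; [exact SP|].
  apply Rmult_le_compat_l; assumption. }
assert (A12 : X * ((1 - r ^ 2) / 4) <= 3 * eta) by nra.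
assert (A13 : X <= 12 * / (1 - r ^ 2) * eta).
{ apply (Rmult_le_reg_r ((1 - r ^ 2) / 4)); [lra|].
  replace (12 * / (1 - r ^ 2) * eta * ((1 - r ^ 2) / 4))%R with (3 * eta)%R by (field; lra). exact A12. }
assert (A14 : eta <= 2 * (Cmod (F c - c) + 4 * Cmod b)).
{ unfold eta. replace (1 - h c) with (/ c * (c - g c)).
  - rewrite Cmod_mult Cmod_inv; [|exact Hc0]. rewrite Hc Rinv_inv.
    apply Rmult_le_compat_l; [lra|].
    replace (c - g c) with (- (g c - F c) + - (F c - c)) by ring.
    apply: Rle_trans; [apply Cmod_triangle|]. rewrite !Cmod_opp. pose proof (Hbg c Hc1). lra.
  - rewrite (Eh c). field. exact Hc0. }
replace (F z - z) with (- (g z - F z) + z * - (1 - h z)) by (rewrite (Eh z); ring).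
apply: Rle_trans; [apply Cmod_triangle|]. rewrite Cmod_mult !Cmod_opp. fold X.
pose proof (Hbg z Hz1). pose proof (Cmod_ge_0 b). pose proof (Cmod_ge_0 (F c - c)).
pose proof (Cmod_ge_0 z).
set (I := (/ (1 - r ^ 2))%R) in *. set (e := Cmod (F c - c)) in *.
assert (Cmod z * X <= X) by nra.
assert (X <= 24 * I * (e + 4 * Cmod b)) by nra.
nra.
Qed.

Lemma C_cauchy_limit (u : nat -> C) :
  (forall eps, 0 < eps -> exists N, forall n m, (N <= n)%nat -> (N <= m)%nat ->
     Cmod (u n - u m) < eps) ->
  exists l : C, filterlim u eventually (locally l).
Proof.
intros H.
assert (HR : exists l, is_lim_seq (fun n => Re (u n)) (Finite l)).
{ apply ex_lim_seq_cauchy_corr. intros eps. destruct (H eps (cond_pos eps)) as [N HN].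
  exists N. intros n m Hn Hm. apply: Rle_lt_trans (HN n m Hn Hm).
  exact (re_le_Cmod (u n - u m)). }
assert (HI : exists l, is_lim_seq (fun n => Im (u n)) (Finite l)).
{ apply ex_lim_seq_cauchy_corr. intros eps. destruct (H eps (cond_pos eps)) as [N HN].
  exists N. intros n m Hn Hm. apply: Rle_lt_trans (HN n m Hn Hm).
  exact (im_le_Cmod (u n - u m)). }
destruct HR as [l1 H1]. destruct HI as [l2 H2].
exists (l1, l2).
apply (filterlim_ext (fun n => (Re (u n), Im (u n)) : C)).
- intros n. destruct (u n); reflexivity.
- apply filterlim_pair_C; assumption.
Qed.

Lemma eventually_C (u : nat -> C) (l : C) (eps : R) :
  filterlim u eventually (locally l) -> 0 < eps ->
  exists N, forall n, (N <= n)%nat -> Cmod (u n - l) < eps.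
Proof. intros H He. exact (proj1 (filterlim_C u l) H eps He). Qed.

(** With a common [L], pointwise convergence is enough: [G n w w] is within [L * eta] of the slope
    between [w] and [w + eta], and that slope converges because [g n] converges at two points. So
    the derivatives are Cauchy, and the first-order estimate passes to the limit. *)
Lemma cdiff_limit (g : nat -> C -> C) (f : C -> C) (rho L : R) :
  0 < L ->
  (forall n, exists G, divided_difference (g n) rho L G) ->
  (forall z, Cmod z <= rho -> filterlim (fun n => g n z) eventually (locally (f z))) ->
  forall z, Cmod z < rho -> cdiff f z.
Proof.
intros HL HG Hlim w Hw.
set (G := fun n => proj1_sig (constructive_indefinite_description _ (HG n))).
assert (HG' : forall n, divided_difference (g n) rho L (G n)).
{ intros n. exact (proj2_sig (constructive_indefinite_description _ (HG n))). }
clearbody G.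
destruct (C_cauchy_limit (fun n => G n w w)) as [l Hl].
{ intros eps He.
  set (eta := Rmin (rho - Cmod w) (eps / (8 * L))).
  assert (Heta : 0 < eta) by (apply Rmin_pos; [lra|apply Rdiv_lt_0_compat; lra]).
  assert (Heta1 : eta <= rho - Cmod w) by apply Rmin_l.
  assert (Heta2 : L * eta <= eps / 8).
  { apply Rle_trans with (L * (eps / (8 * L)))%R; [apply Rmult_le_compat_l; [lra|apply Rmin_r]|].
    right. field. lra. }
  set (w' := w + RtoC eta).
  assert (Em : Cmod (w' - w) = eta).
  { unfold w'. replace (w + RtoC eta - w) with (RtoC eta) by ring. rewrite Cmod_R Rabs_pos_eq; lra. }
  assert (Hw' : Cmod w' <= rho) by (pose proof (Cmod_sub_ge w' w); lra).
  destruct (eventually_C _ _ (eps * eta / 8) (Hlim w' Hw')) as [N1 HN1]; [nra|].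
  destruct (eventually_C _ _ (eps * eta / 8) (Hlim w ltac:(lra))) as [N2 HN2]; [nra|].
  exists (Nat.max N1 N2). intros n m Hn Hm.
  assert (K1 : forall n, Cmod (G n w w - G n w' w) <= eps / 8).
  { intros k. destruct (HG' k) as [_ [_ H3]].
    apply: Rle_trans; [apply H3; lra|].
    replace (w - w) with (RtoC 0) by ring. replace (w - w') with (- (w' - w)) by ring.
    rewrite Cmod_opp Cmod_0 Em. lra. }
  assert (K2 : Cmod (G n w' w - G m w' w) <= eps / 2).
  { apply (Rmult_le_reg_l eta); [exact Heta|]. rewrite -{1}Em -Cmod_mult.
    replace ((w' - w) * (G n w' w - G m w' w))
      with ((w' - w) * G n w' w - (w' - w) * G m w' w) by ring.
    destruct (HG' n) as [H1 _]. destruct (HG' m) as [H2 _].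
    rewrite -H1; [|lra|lra]. rewrite -H2; [|lra|lra].
    replace (g n w' - g n w - (g m w' - g m w))
      with (((g n w' - f w') + - (g n w - f w)) + (- (g m w' - f w') + (g m w - f w))) by ring.
    pose proof (HN1 n ltac:(lia)). pose proof (HN1 m ltac:(lia)).
    pose proof (HN2 n ltac:(lia)). pose proof (HN2 m ltac:(lia)).
    apply: Rle_trans; [apply Cmod_triangle|].
    apply: Rle_trans; [apply Rplus_le_compat; apply Cmod_triangle|].
    rewrite !Cmod_opp. lra. }
  replace (G n w w - G m w w)
    with ((G n w w - G n w' w) + ((G n w' w - G m w' w) + - (G m w w - G m w' w))) by ring.
  apply: Rle_lt_trans; [apply Cmod_triangle|].
  pose proof (Cmod_triangle (G n w' w - G m w' w) (- (G m w w - G m w' w))) as T.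
  rewrite Cmod_opp in T. pose proof (K1 n). pose proof (K1 m). lra. }
exists l. apply cderiv_eps. intros eps He.
exists (Rmin (rho - Cmod w) (eps / L)). split.
{ apply Rmin_pos; [lra|]. apply Rdiv_lt_0_compat; lra. }
intros z Hz.
assert (W1 : Cmod (z - w) < rho - Cmod w) by (apply: Rlt_le_trans Hz _; apply Rmin_l).
assert (W2 : Cmod (z - w) < eps / L) by (apply: Rlt_le_trans Hz _; apply Rmin_r).
assert (W3 : Cmod z <= rho) by (pose proof (Cmod_sub_ge z w); lra).
assert (W4 : L * Cmod (z - w) <= eps).
{ apply Rlt_div_r in W2; [|exact HL]. lra. }
apply (is_lim_seq_le (fun n => Cmod (g n z - g n w - G n w w * (z - w)))
  (fun _ => (eps * Cmod (z - w))%R)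
  (Cmod (f z - f w - l * (z - w))) (eps * Cmod (z - w))%R).
- intros n. destruct (HG' n) as [H1 [_ H3]].
  rewrite H1; [|lra|lra].
  replace ((z - w) * G n z w - G n w w * (z - w)) with ((G n z w - G n w w) * (z - w)) by ring.
  rewrite Cmod_mult. apply Rmult_le_compat_r; [apply Cmod_ge_0|].
  apply: Rle_trans; [apply H3; lra|].
  replace (w - w) with (RtoC 0) by ring. rewrite Cmod_0 Rplus_0_r. exact W4.
- apply (filterlim_Cmod (fun n => g n z - g n w - G n w w * (z - w))).
  apply filterlim_Cminus; [apply filterlim_Cminus; apply Hlim; lra|].
  apply filterlim_Cmult; [exact Hl|apply filterlim_const].
- apply is_lim_seq_const.
Qed.

(** The exponent starts at [1], so every term is below [1] and [1 - dyadic n] is the radius of a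
    proper subdisc. The sequence serves as time step, as radial approach to [1] and as scale of
    accuracy. *)
Definition dyadic (n : nat) : R := (/ 2) ^ (S n).

Lemma dyadic_pos (n : nat) : 0 < dyadic n.
Proof. apply pow_lt. lra. Qed.

Lemma dyadic_lim : is_lim_seq dyadic 0.
Proof.
apply (is_lim_seq_incr_1 (fun n => ((/ 2) ^ n)%R)).
apply is_lim_seq_geom. rewrite Rabs_pos_eq; lra.
Qed.

Lemma dyadic_lt_1 (n : nat) : dyadic n < 1.
Proof.
unfold dyadic. rewrite -tech_pow_Rmult. assert (H : (/ 2) ^ n <= 1 ^ n) by (apply pow_incr; lra).
rewrite pow1 in H. lra.
Qed.

Lemma dyadic_at_right : filterlim dyadic eventually (at_right 0).
Proof.
intros P [d Hd]. pose proof dyadic_lim as H. apply is_lim_seq_spec in H. destruct (H d) as [N HN].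
exists N. intros n Hn. apply Hd; [exact (HN n Hn)|apply dyadic_pos].
Qed.

Section Generator.

Variables (f : C -> C) (F : R -> C -> C).
Hypotheses (HF : continuous_semigroup F) (Hf : is_generator_of f F).

Let quot (n : nat) (z : C) : C := (z - F (dyadic n) z) / RtoC (dyadic n).

Let quot_lim (z : C) : Cmod z < 1 -> filterlim (fun n => quot n z) eventually (locally (f z)).
Proof.
intros Hz. exact (filterlim_comp _ _ _ dyadic _ _ _ _ dyadic_at_right (Hf z Hz)).
Qed.

Lemma semigroup_holo (t : R) : 0 <= t -> holo_disc (F t).
Proof.
intros Ht z Hz. destruct (semigroup_holomorphic F HF t Ht z Hz) as [l Hl].
exists l. apply cderiv_is_derive, Hl.
Qed.

Let dyadic_C (n : nat) : RtoC (dyadic n) <> 0.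
Proof. intros E. apply RtoC_inj in E. pose proof (dyadic_pos n). lra. Qed.

(** The quotients [quot n] converge pointwise, hence are bounded at [0] and at [1/2];
    [near_identity] spreads these two bounds to the disc of radius [r]. Cauchy's formula then gives
    divided differences with a common constant, and [cdiff_limit] applies. *)
Lemma generator_holo : holo_disc f.
Proof.
intros z Hz. pose proof (Cmod_ge_0 z) as Hz0.
set (rho := ((Cmod z + 1) / 2)%R). set (r := ((rho + 1) / 2)%R).
assert (Hrho : Cmod z < rho < r) by (unfold r, rho; lra).
assert (Hr : r < 1) by (unfold r, rho; lra).
destruct (near_identity r ltac:(lra)) as [K [HK Hnear]].
set (c := RtoC (/ 2)).
assert (Hc : Cmod c < 1) by (unfold c; rewrite Cmod_R Rabs_pos_eq; lra).
assert (H0 : Cmod 0 < 1) by (rewrite Cmod_0; lra).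
destruct (eventually_C _ _ 1 (quot_lim 0 H0) Rlt_0_1) as [N1 HN1].
destruct (eventually_C _ _ 1 (quot_lim c Hc) Rlt_0_1) as [N2 HN2].
set (b0 := (Cmod (f 0) + 1)%R). set (b1 := (Cmod (f c) + 1)%R).
assert (Hb0 : 0 < b0) by (unfold b0; pose proof (Cmod_ge_0 (f 0)); lra).
assert (Hb1 : 0 < b1) by (unfold b1; pose proof (Cmod_ge_0 (f c)); lra).
pose proof dyadic_lim as HT. apply is_lim_seq_spec in HT.
(* Times below [1 / (2 b0)] keep [|F t 0| <= 1/2], as [near_identity] requires. *)
assert (Hhb : 0 < / (2 * b0)) by (apply Rinv_0_lt_compat; lra).
destruct (HT (mkposreal _ Hhb)) as [N3 HN3]. simpl in HN3.
set (N := (N1 + N2 + N3)%nat).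
assert (Hmul : forall n x, x - F (dyadic n) x = RtoC (dyadic n) * quot n x).
{ intros n x. unfold quot. field. apply dyadic_C. }
assert (Hmod : forall n x, Cmod (x - F (dyadic n) x) = (dyadic n * Cmod (quot n x))%R).
{ intros n x. rewrite Hmul Cmod_mult Cmod_R Rabs_pos_eq; [reflexivity|apply Rlt_le, dyadic_pos]. }
assert (Hq0 : forall n, (N <= n)%nat -> Cmod (quot n 0) <= b0).
{ intros n Hn. pose proof (HN1 n ltac:(lia)) as H. pose proof (Cmod_sub_ge (quot n 0) (f 0)).
  unfold b0. lra. }
assert (Hqc : forall n, (N <= n)%nat -> Cmod (quot n c) <= b1).
{ intros n Hn. pose proof (HN2 n ltac:(lia)) as H. pose proof (Cmod_sub_ge (quot n c) (f c)).
  unfold b1. lra. }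
set (B := (K * (b0 + b1))%R).
assert (HB : forall n x, (N <= n)%nat -> Cmod x <= r -> Cmod (quot n x) <= B).
{ intros n x Hn Hx. pose proof (dyadic_pos n) as Ht.
  assert (HF0 : Cmod (F (dyadic n) 0) = (dyadic n * Cmod (quot n 0))%R).
  { rewrite -Hmod. replace (0 - F (dyadic n) 0) with (- F (dyadic n) 0) by ring. rewrite Cmod_opp. reflexivity. }
  assert (HFc : Cmod (F (dyadic n) c - c) = (dyadic n * Cmod (quot n c))%R).
  { rewrite -Hmod. replace (F (dyadic n) c - c) with (- (c - F (dyadic n) c)) by ring. apply Cmod_opp. }
  pose proof (Hq0 n Hn) as Q0. pose proof (Hqc n Hn) as Q1.
  assert (Hsm : Cmod (F (dyadic n) 0) <= / 2).
  { rewrite HF0. specialize (HN3 n ltac:(lia)). rewrite Rminus_0_r Rabs_pos_eq in HN3; [|lra].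
    apply Rle_trans with (/ (2 * b0) * b0)%R; [|right; field; lra].
    apply Rmult_le_compat; [lra|apply Cmod_ge_0|lra|exact Q0]. }
  pose proof (Hnear (F (dyadic n)) (semigroup_holo _ (Rlt_le _ _ Ht))
    (fun y Hy => semigroup_self_map F HF _ y (Rlt_le _ _ Ht) Hy) Hsm x Hx) as Hn1.
  fold c in Hn1. rewrite HF0 HFc in Hn1.
  replace (F (dyadic n) x - x) with (- (x - F (dyadic n) x)) in Hn1 by ring.
  rewrite Cmod_opp Hmod in Hn1.
  apply (Rmult_le_reg_l (dyadic n)); [exact Ht|]. unfold B.
  apply: Rle_trans; [exact Hn1|].
  replace (dyadic n * (K * (b0 + b1)))%R with (K * (dyadic n * (b0 + b1)))%R by ring.
  apply Rmult_le_compat_l; [exact HK|]. nra. }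
assert (Hholo : forall n, holo_disc (quot n)).
{ intros n x Hx. apply cdiff_mult; [|apply cdiff_const].
  apply cdiff_minus; [apply cdiff_id|]. apply semigroup_holo; [apply Rlt_le, dyadic_pos|exact Hx]. }
assert (HBp : 0 <= B).
{ apply Rle_trans with (Cmod (quot N 0)); [apply Cmod_ge_0|].
  apply HB; [lia|rewrite Cmod_0; lra]. }
set (L := (B * r * (/ (r - rho) ^ 2 + / (r - rho) ^ 3) + 1)%R).
assert (I2 : 0 < / (r - rho) ^ 2) by (apply Rinv_0_lt_compat, pow_lt; lra).
assert (I3 : 0 < / (r - rho) ^ 3) by (apply Rinv_0_lt_compat, pow_lt; lra).
apply (cdiff_limit (fun n => quot (n + N)%nat) f rho L).
- unfold L. assert (0 <= B * r) by nra. nra.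
- intros n.
  assert (Hcn : forall x, Cmod x < 1 -> continuous (quot (n + N)%nat) x).
  { intros x Hx. apply cdiff_continuous, Hholo, Hx. }
  destruct (cauchy_divided_difference (quot (n + N)%nat) r rho B) as [G [G1 [G2 G3]]].
  + lra.
  + apply cont_on_circle; [|lra]. intros x Hx. apply Hcn. lra.
  + intros t _. apply HB; [lia|]. rewrite Cmod_circle; lra.
  + intros a Ha. apply (cauchy_formula _ 1); [exact Hcn| |lra].
    intros x Hx _. apply Hholo, Hx.
  + exists G. split; [exact G1|split].
    * intros x y Hx Hy. pose proof (G2 x y Hx Hy). unfold L. lra.
    * intros x y x' y' Hx Hy Hx' Hy'. pose proof (G3 x y x' y' Hx Hy Hx' Hy').
      pose proof (Cmod_ge_0 (x - x')). pose proof (Cmod_ge_0 (y - y')). unfold L. lra.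
- intros x Hx. pose proof (quot_lim x ltac:(lra)) as Hq.
  apply (filterlim_comp _ _ _ (fun n => n + N)%nat (fun n => quot n x) _ eventually); [|exact Hq].
  intros P [M HM]. exists M. intros n Hn. apply HM. lia.
- lra.
Qed.

Lemma is_lim_seq_Re_mult (k : C) (u : nat -> C) (l : C) :
  filterlim u eventually (locally l) -> is_lim_seq (fun n => Re (k * u n)) (Re (k * l)).
Proof.
intros H. apply (filterlim_Re (fun n => k * u n)).
apply filterlim_Cmult; [apply filterlim_const|exact H].
Qed.

(* Infinitesimal form of Schwarz-Pick: the hyperbolic distance between
   [F t z] and [F t w] is non-increasing at [t = 0]. *)
Lemma generator_two_points (z w : C) : Cmod z < 1 -> Cmod w < 1 ->
  (1 - Cmod z ^ 2) * (1 - Cmod w ^ 2)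
    * (2 * Re (Cconj (1 - Cconj w * z) * (Cconj (f w) * z + Cconj w * f z)))
  <= Cmod (1 - Cconj w * z) ^ 2
    * ((1 - Cmod w ^ 2) * (2 * Re (Cconj z * f z)) + (1 - Cmod z ^ 2) * (2 * Re (Cconj w * f w))).
Proof.
intros Hz Hw.
set (x := (1 - Cmod z ^ 2)%R). set (y := (1 - Cmod w ^ 2)%R).
set (u := 1 - Cconj w * z). set (m := (Cmod u ^ 2)%R).
set (A := fun n => quot n z). set (B := fun n => quot n w).
set (v := fun n => Cconj (B n) * z + Cconj w * A n - RtoC (dyadic n) * (Cconj (B n) * A n)).
(* [a], [b], [e] are exact difference quotients in time of [1 - |z|^2], [1 - |w|^2] and
   [|1 - conj w z|^2] along the semigroup, second-order terms included. *)
set (a := fun n => (2 * Re (Cconj z * A n) - dyadic n * Cmod (A n) ^ 2)%R).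
set (b := fun n => (2 * Re (Cconj w * B n) - dyadic n * Cmod (B n) ^ 2)%R).
set (e := fun n => (2 * Re (Cconj u * v n) + dyadic n * Cmod (v n) ^ 2)%R).
pose proof (quot_lim z Hz) as LA. fold A in LA.
pose proof (quot_lim w Hw) as LB. fold B in LB.
assert (LT : filterlim (fun n => RtoC (dyadic n)) eventually (locally (RtoC 0))).
{ apply filterlim_RtoC, dyadic_lim. }
assert (LV : filterlim v eventually (locally (Cconj (f w) * z + Cconj w * f z))).
{ replace (Cconj (f w) * z + Cconj w * f z)
    with (Cconj (f w) * z + Cconj w * f z - 0 * (Cconj (f w) * f z)) by ring.
  apply filterlim_Cminus; [apply filterlim_Cplus; apply filterlim_Cmult|apply filterlim_Cmult; [exact LT|apply filterlim_Cmult]];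
    try apply filterlim_const; try apply filterlim_Cconj; assumption. }
assert (Lsq : forall s l, filterlim s eventually (locally l) ->
  is_lim_seq (fun n => dyadic n * Cmod (s n) ^ 2)%R 0%R).
{ intros s l Hs. replace 0%R with (0 * (Cmod l * (Cmod l * 1)))%R by ring.
  apply is_lim_seq_mult'; [exact dyadic_lim|].
  apply is_lim_seq_mult'; [apply (filterlim_Cmod s); exact Hs|].
  apply is_lim_seq_mult'; [apply (filterlim_Cmod s); exact Hs|apply is_lim_seq_const]. }
assert (La : is_lim_seq a (2 * Re (Cconj z * f z))%R).
{ replace (2 * Re (Cconj z * f z))%R with (2 * Re (Cconj z * f z) - 0)%R by ring.
  apply is_lim_seq_minus'; [|apply (Lsq _ _ LA)].
  apply is_lim_seq_mult'; [apply is_lim_seq_const|apply is_lim_seq_Re_mult, LA]. }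
assert (Lb : is_lim_seq b (2 * Re (Cconj w * f w))%R).
{ replace (2 * Re (Cconj w * f w))%R with (2 * Re (Cconj w * f w) - 0)%R by ring.
  apply is_lim_seq_minus'; [|apply (Lsq _ _ LB)].
  apply is_lim_seq_mult'; [apply is_lim_seq_const|apply is_lim_seq_Re_mult, LB]. }
assert (Le : is_lim_seq e (2 * Re (Cconj u * (Cconj (f w) * z + Cconj w * f z)))%R).
{ replace (2 * Re (Cconj u * (Cconj (f w) * z + Cconj w * f z)))%R
    with (2 * Re (Cconj u * (Cconj (f w) * z + Cconj w * f z)) + 0)%R by ring.
  apply is_lim_seq_plus'; [|apply (Lsq _ _ LV)].
  apply is_lim_seq_mult'; [apply is_lim_seq_const|apply is_lim_seq_Re_mult, LV]. }
apply (is_lim_seq_le (fun n => x * y * e n)%R (fun n => m * (y * a n + x * b n + dyadic n * a n * b n))%R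
  (x * y * (2 * Re (Cconj u * (Cconj (f w) * z + Cconj w * f z))))%R
  (m * (y * (2 * Re (Cconj z * f z)) + x * (2 * Re (Cconj w * f w))))%R).
- intros n. pose proof (dyadic_pos n) as Ht.
  pose proof (schwarz_pick_strict (F (dyadic n)) z w (semigroup_holo _ (Rlt_le _ _ Ht))
    (fun y Hy => semigroup_self_map F HF _ y (Rlt_le _ _ Ht) Hy) Hz Hw) as SP.
  assert (EZ : F (dyadic n) z = z - RtoC (dyadic n) * A n) by (unfold A, quot; field; apply dyadic_C).
  assert (EW : F (dyadic n) w = w - RtoC (dyadic n) * B n) by (unfold B, quot; field; apply dyadic_C).
  pose proof (Cmod_sqr_identity (F (dyadic n) z) (F (dyadic n) w)) as I1.
  pose proof (Cmod_sqr_identity z w) as I2. fold x y u in I2.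
  assert (X1 : (1 - Cmod (F (dyadic n) z) ^ 2 = x + dyadic n * a n)%R).
  { rewrite EZ. unfold x, a. rewrite !Cmod2_alt. destruct z, (A n); simpl; ring. }
  assert (Y1 : (1 - Cmod (F (dyadic n) w) ^ 2 = y + dyadic n * b n)%R).
  { rewrite EW. unfold y, b. rewrite !Cmod2_alt. destruct w, (B n); simpl; ring. }
  assert (N1 : (Cmod (1 - Cconj (F (dyadic n) w) * F (dyadic n) z) ^ 2 = m + dyadic n * e n)%R).
  { replace (1 - Cconj (F (dyadic n) w) * F (dyadic n) z) with (u + RtoC (dyadic n) * v n).
    - unfold m, e. rewrite !Cmod2_alt. destruct u, (v n); simpl; ring.
    - rewrite EZ EW. unfold u, v. rewrite Cminus_conj Cmult_conj.
      replace (Cconj (RtoC (dyadic n))) with (RtoC (dyadic n)) by (apply injective_projections; simpl; ring).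
      ring. }
  rewrite X1 Y1 N1 in I1. fold u in SP.
  assert (SP2 : Cmod (F (dyadic n) z - F (dyadic n) w) ^ 2 * m
    <= Cmod (z - w) ^ 2 * (m + dyadic n * e n)).
  { rewrite -N1. unfold m. rewrite -!Rpow_mult_distr. apply pow_incr. split; [|exact SP].
    apply Rmult_le_pos; apply Cmod_ge_0. }
  fold m in I2.
  (* Once the distances are eliminated by [Cmod_sqr_identity], the squared inequality has equal
     terms of order zero on both sides; what remains is divisible by the time step. *)
  replace (Cmod (F (dyadic n) z - F (dyadic n) w) ^ 2)%R
    with (m + dyadic n * e n - (x + dyadic n * a n) * (y + dyadic n * b n))%R in SP2 by lra.
  replace (Cmod (z - w) ^ 2)%R with (m - x * y)%R in SP2 by lra.
  apply (Rmult_le_reg_l (dyadic n)); [exact Ht|]. nra.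
- apply is_lim_seq_mult'; [apply is_lim_seq_const|exact Le].
- apply is_lim_seq_mult'; [apply is_lim_seq_const|].
  replace (y * (2 * Re (Cconj z * f z)) + x * (2 * Re (Cconj w * f w)))%R
    with (y * (2 * Re (Cconj z * f z)) + x * (2 * Re (Cconj w * f w))
      + 0 * (2 * Re (Cconj z * f z)) * (2 * Re (Cconj w * f w)))%R by ring.
  apply is_lim_seq_plus'; [apply is_lim_seq_plus'; (apply is_lim_seq_mult'; [apply is_lim_seq_const|assumption])|].
  apply is_lim_seq_mult'; [apply is_lim_seq_mult'; [exact dyadic_lim|exact La]|exact Lb].
Qed.

End Generator.

(** * The angular derivative at 1 and the positive remainder *)

Lemma radial_limit (g : C -> C) (l : C) : angular_lim g 1 l ->
  filterlim (fun n => g (RtoC (1 - dyadic n))) eventually (locally l).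
Proof.
intros H.
apply (filterlim_comp _ _ _ (fun n => RtoC (1 - dyadic n)) g _
  (within (stolz_region 1 2) (locally (RtoC 1)))); [|apply H; lra].
intros P HP. unfold within in HP. apply locally_Cmod in HP. destruct HP as [d [Hd HP]].
pose proof dyadic_lim as HT. apply is_lim_seq_spec in HT.
destruct (HT (mkposreal _ Hd)) as [N HN]. exists N. intros n Hn.
specialize (HN n Hn). simpl in HN. rewrite Rminus_0_r Rabs_pos_eq in HN; [|apply Rlt_le, dyadic_pos].
pose proof (dyadic_pos n). pose proof (dyadic_lt_1 n).
assert (E : Cmod (RtoC (1 - dyadic n) - 1) = dyadic n).
{ rewrite -RtoC_minus Cmod_R Rabs_left; [ring|lra]. }
apply HP.
- rewrite E. exact HN.
- assert (E2 : Cmod (RtoC (1 - dyadic n)) = (1 - dyadic n)%R) by (rewrite Cmod_R Rabs_pos_eq; lra).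
  split; [unfold unit_disc; lra|]. rewrite E E2. lra.
Qed.

Lemma one_minus_neq_0 (z : C) : Cmod z < 1 -> 1 - z <> 0.
Proof.
intros Hz E. apply Ceq_minus in E. rewrite -E Cmod_1 in Hz. lra.
Qed.

(* The limit [w -> 1] of the two-point inequality. *)
Lemma generator_boundary_inequality (f : C -> C) (beta : R) (z : C) :
  generator_plus_one beta f -> Cmod z < 1 ->
  (1 - Cmod z ^ 2) * (2 * Re (Cconj (1 - z) * f z))
  <= Cmod (1 - z) ^ 2 * (2 * Re (Cconj z * f z) - (1 - Cmod z ^ 2) * beta).
Proof.
intros [[F [HF Hf]] [H0 [H1 Hb]]] Hz.
set (x := (1 - Cmod z ^ 2)%R).
set (r := fun n => (1 - dyadic n)%R).
pose proof (radial_limit _ _ H0) as L0. pose proof (radial_limit _ _ H1) as L1.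
set (bt := fun n => f (RtoC (1 - dyadic n)) / (RtoC (1 - dyadic n) - 1)) in L1.
change (fun n => f (RtoC (1 - dyadic n))) with (fun n => f (RtoC (r n))) in L0.
assert (Lr : is_lim_seq r 1).
{ replace (Finite 1) with (Finite (1 - 0)) by (f_equal; ring).
  apply is_lim_seq_minus'; [apply is_lim_seq_const|exact dyadic_lim]. }
assert (LC : filterlim (fun n => RtoC (r n)) eventually (locally (RtoC 1))) by (apply filterlim_RtoC, Lr).
assert (Lu : filterlim (fun n => 1 - RtoC (r n) * z) eventually (locally (1 - z))).
{ rewrite -{2}(Cmult_1_l z).
  apply filterlim_Cminus; [apply filterlim_const|apply filterlim_Cmult; [exact LC|apply filterlim_const]]. }
assert (Lb : is_lim_seq (fun n => Re (bt n)) beta) by exact (filterlim_Re bt _ L1).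
assert (Le : is_lim_seq (fun n => Re (Cconj (1 - RtoC (r n) * z) *
    (Cconj (f (RtoC (r n))) * z + RtoC (r n) * f z))) (Re (Cconj (1 - z) * f z))).
{ apply (filterlim_Re (fun n => Cconj (1 - RtoC (r n) * z) *
    (Cconj (f (RtoC (r n))) * z + RtoC (r n) * f z))).
  replace (Cconj (1 - z) * f z) with (Cconj (1 - z) * (Cconj 0 * z + 1 * f z))
    by (replace (Cconj 0) with (RtoC 0) by (apply injective_projections; simpl; ring); ring).
  apply filterlim_Cmult; [apply filterlim_Cconj, Lu|].
  apply filterlim_Cplus; apply filterlim_Cmult; try apply filterlim_const;
    [apply (filterlim_Cconj (fun n => f (RtoC (r n)))); exact L0|exact LC]. }
assert (Lm : is_lim_seq (fun n => (Cmod (1 - RtoC (r n) * z) ^ 2)%R) (Cmod (1 - z) ^ 2)%R).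
{ apply is_lim_seq_mult'; [apply (filterlim_Cmod _ _ Lu)|].
  apply is_lim_seq_mult'; [apply (filterlim_Cmod _ _ Lu)|apply is_lim_seq_const]. }
assert (Hle : forall n, x * (1 + r n) * (2 * Re (Cconj (1 - RtoC (r n) * z) *
      (Cconj (f (RtoC (r n))) * z + RtoC (r n) * f z)))
  <= Cmod (1 - RtoC (r n) * z) ^ 2 * ((1 + r n) * (2 * Re (Cconj z * f z)) - x * (2 * (r n * Re (bt n))))).
{ intros n. pose proof (dyadic_pos n) as Ht. pose proof (dyadic_lt_1 n) as Ht1.
  assert (Er : Cmod (RtoC (r n)) = r n) by (rewrite Cmod_R Rabs_pos_eq; [reflexivity|unfold r; lra]).
  pose proof (generator_two_points f F HF Hf z (RtoC (r n)) Hz ltac:(rewrite Er; unfold r; lra)) as G.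
  replace (Cconj (RtoC (r n))) with (RtoC (r n)) in G by (apply injective_projections; simpl; ring).
  rewrite Er in G. fold x in G.
  (* Both sides vanish to first order as [w] tends to [1]: through [1 - r^2], and through
     [f r = - (1 - r) * bt]. Dividing by [1 - r] leaves the quotient that converges to [beta]. *)
  assert (E1 : (1 - r n ^ 2 = dyadic n * (1 + r n))%R) by (unfold r; ring).
  assert (E2 : f (RtoC (r n)) = RtoC (- dyadic n) * bt n).
  { unfold bt. fold (r n). replace (RtoC (r n) - 1) with (RtoC (- dyadic n)).
    - field. intros E. apply RtoC_inj in E. lra.
    - rewrite -RtoC_minus. f_equal. unfold r. ring. }
  assert (E3 : (Re (RtoC (r n) * f (RtoC (r n))) = - dyadic n * (r n * Re (bt n)))%R).
  { rewrite E2 !re_scal_l. ring. }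
  rewrite E1 E3 in G. apply (Rmult_le_reg_l (dyadic n)); [exact Ht|]. 
  set (X := Re (Cconj (1 - RtoC (r n) * z) * (Cconj (f (RtoC (r n))) * z + RtoC (r n) * f z))) in *.
  set (m := (Cmod (1 - RtoC (r n) * z) ^ 2)%R) in *.
  replace (dyadic n * (x * (1 + r n) * (2 * X)))%R with (x * (dyadic n * (1 + r n)) * (2 * X))%R by ring.
  apply: Rle_trans; [exact G|]. right. ring. }
assert (Hfin : x * (1 + 1) * (2 * Re (Cconj (1 - z) * f z))
  <= Cmod (1 - z) ^ 2 * ((1 + 1) * (2 * Re (Cconj z * f z)) - x * (2 * (1 * beta)))).
{ refine (is_lim_seq_le _ _ (Finite _) (Finite _) Hle _ _).
  - apply is_lim_seq_mult'; [apply is_lim_seq_mult'; [apply is_lim_seq_const|]|].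
    + apply is_lim_seq_plus'; [apply is_lim_seq_const|exact Lr].
    + apply is_lim_seq_mult'; [apply is_lim_seq_const|exact Le].
  - apply is_lim_seq_mult'; [exact Lm|].
    apply is_lim_seq_minus'; (apply is_lim_seq_mult'; [|]); try apply is_lim_seq_const.
    + apply is_lim_seq_plus'; [apply is_lim_seq_const|exact Lr].
    + apply is_lim_seq_mult'; [apply is_lim_seq_const|].
      apply is_lim_seq_mult'; [exact Lr|exact Lb]. }
lra.
Qed.

(** The function [q] of the overview. *)
Definition remainder (f : C -> C) (beta : R) (z : C) : C :=
  - f z / ((1 - z) * (1 - z)) - RtoC (beta / 2) * ((1 + z) / (1 - z)).

Lemma Re_div (z w : C) : w <> 0 -> Re (z / w) = (Re (z * Cconj w) / Cmod w ^ 2)%R.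
Proof.
intros Hw. unfold Rdiv. rewrite -re_scal_r. f_equal.
assert (H : 0 < Cmod w) by (apply Cmod_gt_0, Hw).
assert (H2 : (Cmod w ^ 2)%R <> 0%R) by (apply pow_nonzero; lra).
rewrite RtoC_inv; [|exact H2]. rewrite Cmod2_conj. field.
split; [|exact Hw]. intros E. apply (f_equal Cmod) in E. rewrite Cmod_conj Cmod_0 in E. lra.
Qed.

(** The boundary inequality already says this, since [(1 - |z|^2) conj (1 - z) - |1 - z|^2 conj z =
    conj (1 - z)^2] and [Re ((1 + z) conj (1 - z)) = 1 - |z|^2]. *)
Lemma remainder_nonneg (f : C -> C) (beta : R) (z : C) :
  generator_plus_one beta f -> Cmod z < 1 -> 0 <= Re (remainder f beta z).
Proof.
intros Hf Hz. pose proof (generator_boundary_inequality f beta z Hf Hz) as H.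
pose proof (one_minus_neq_0 z Hz) as N.
unfold remainder.
replace (- f z / ((1 - z) * (1 - z)) - RtoC (beta / 2) * ((1 + z) / (1 - z)))
  with ((- f z - RtoC (beta / 2) * ((1 + z) * (1 - z))) / ((1 - z) * (1 - z))) by (field; exact N).
rewrite Re_div; [|apply Cmult_neq_0; exact N].
apply Rdiv_le_0_compat.
2:{ apply pow_lt. apply Cmod_gt_0, Cmult_neq_0; exact N. }
rewrite !Cmod2_alt in H. destruct z as [a b]. destruct (f (a, b)) as [p q]. simpl in *. nra.
Qed.

Lemma remainder_holo (f : C -> C) (beta : R) :
  generator f -> holo_disc (remainder f beta).
Proof.
intros [F [HF Hf]] z Hz. pose proof (one_minus_neq_0 z Hz) as N.
assert (D : cdiff (fun w => 1 - w) z) by (apply cdiff_minus; [apply cdiff_const|apply cdiff_id]).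
apply cdiff_minus.
- apply cdiff_div; [apply Cmult_neq_0; exact N| |apply cdiff_mult; exact D].
  apply cdiff_opp. exact (generator_holo f F HF Hf z Hz).
- apply cdiff_mult; [apply cdiff_const|]. apply cdiff_div; [exact N| |exact D].
  apply cdiff_plus; [apply cdiff_const|apply cdiff_id].
Qed.

(** * Picard iteration *)

Definition curve_deriv (u : R -> C) (t : R) (l : C) : Prop :=
  is_derive (fun s => Re (u s)) t (Re l) /\ is_derive (fun s => Im (u s)) t (Im l).

Lemma curve_deriv_continuous (u : R -> C) (t : R) (l : C) :
  curve_deriv u t l -> continuous u t.
Proof.
intros [H1 H2].
apply (continuous_ext (fun s => (Re (u s), Im (u s)) : C)).
- intros s. destruct (u s); reflexivity.
- apply filterlim_pair_C.
  + apply (ex_derive_continuous (fun s => Re (u s))). eexists; exact H1.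
  + apply (ex_derive_continuous (fun s => Im (u s))). eexists; exact H2.
Qed.

Lemma curve_deriv_mult (u v : R -> C) (t : R) (l m : C) :
  curve_deriv u t l -> curve_deriv v t m ->
  curve_deriv (fun s => u s * v s) t (l * v t + u t * m).
Proof.
intros [H1 H2] [H3 H4]. split.
- apply (is_derive_ext (fun s => Re (u s) * Re (v s) - Im (u s) * Im (v s))%R).
  { intros s. symmetry. apply re_mult. }
  evar_last; [apply (is_derive_minus (fun s => Re (u s) * Re (v s))%R (fun s => Im (u s) * Im (v s))%R);
    apply Derive.is_derive_mult; eassumption|].
  destruct l, m, (u t), (v t); unfold minus, plus, opp; simpl; ring.
- apply (is_derive_ext (fun s => Re (u s) * Im (v s) + Im (u s) * Re (v s))%R).
  { intros s. symmetry. apply im_mult. }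
  evar_last; [apply (is_derive_plus (fun s => Re (u s) * Im (v s))%R (fun s => Im (u s) * Re (v s))%R);
    apply Derive.is_derive_mult; eassumption|].
  destruct l, m, (u t), (v t); unfold plus; simpl; ring.
Qed.

Lemma curve_deriv_minus (u v : R -> C) (t : R) (l m : C) :
  curve_deriv u t l -> curve_deriv v t m -> curve_deriv (fun s => u s - v s) t (l - m).
Proof.
intros [H1 H2] [H3 H4].
split; [exact (is_derive_minus _ _ _ _ _ H1 H3)|exact (is_derive_minus _ _ _ _ _ H2 H4)].
Qed.

Lemma curve_deriv_const (c : C) (t : R) : curve_deriv (fun _ => c) t 0.
Proof. split; [exact (is_derive_const (Re c) t)|exact (is_derive_const (Im c) t)]. Qed.

Lemma curve_deriv_Cexp (u : R -> C) (t : R) (l : C) :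
  curve_deriv u t l -> curve_deriv (fun s => Cexp (u s)) t (Cexp (u t) * l).
Proof.
intros [H1 H2].
assert (E : is_derive (fun s => exp (Re (u s))) t (Re l * exp (Re (u t)))%R).
{ apply (is_derive_comp exp (fun s => Re (u s))); [apply is_derive_exp|exact H1]. }
split.
- evar_last.
  + apply Derive.is_derive_mult; [exact E|].
    apply (is_derive_comp cos (fun s => Im (u s))); [apply is_derive_cos|exact H2].
  + destruct l. unfold scal, Cexp; simpl. unfold mult; simpl. ring.
- evar_last.
  + apply Derive.is_derive_mult; [exact E|].
    apply (is_derive_comp sin (fun s => Im (u s))); [apply is_derive_sin|exact H2].
  + destruct l. unfold scal, Cexp; simpl. unfold mult; simpl. ring.
Qed.

Lemma curve_deriv_zero (u : R -> C) (T : R) :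
  0 <= T -> (forall t, 0 <= t <= T -> curve_deriv u t 0) -> u T = u 0.
Proof.
intros [HT| <-] H; [|reflexivity]. symmetry. apply injective_projections.
- apply (eq_is_derive (fun s => Re (u s))); [|exact HT]. intros t Ht. apply (H t Ht).
- apply (eq_is_derive (fun s => Im (u s))); [|exact HT]. intros t Ht. apply (H t Ht).
Qed.

Lemma curve_deriv_CInt (k : R -> C) (t : R) :
  (forall s, continuous k s) -> curve_deriv (CInt k 0) t (k t).
Proof.
intros H. split.
- apply (is_derive_RInt (fun s => Re (k s)) _ 0).
  + apply filter_forall => x. apply (RInt_correct (fun s => Re (k s))).
    apply (ex_RInt_continuous (V := R_CompleteNormedModule)). intros s _. apply filterlim_Re, H.
  + apply filterlim_Re, H.
- apply (is_derive_RInt (fun s => Im (k s)) _ 0).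
  + apply filter_forall => x. apply (RInt_correct (fun s => Im (k s))).
    apply (ex_RInt_continuous (V := R_CompleteNormedModule)). intros s _. apply filterlim_Im, H.
  + apply filterlim_Im, H.
Qed.

Lemma curve_deriv_quotient (v : R -> C) (l : C) :
  curve_deriv v 0 l ->
  filterlim (fun t => (v t - v 0%R) / RtoC t) (at_right 0) (locally l).
Proof.
intros [H1 H2].
assert (Hr : forall (g : R -> R) d, is_derive g 0 d ->
  filterlim (fun t => (g t - g 0) / t)%R (at_right 0) (locally d)).
{ intros g d Hg. apply is_derive_Reals in Hg. intros P [e He].
  destruct (Hg e (cond_pos e)) as [dl Hdl]. exists dl. intros t Ht Ht0.
  apply He. change (Rabs ((g t - g 0) / t - d) < e).
  specialize (Hdl t ltac:(lra)). rewrite Rplus_0_l in Hdl. apply Hdl.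
  change (Rabs (t - 0) < dl) in Ht. rewrite Rminus_0_r in Ht. exact Ht. }
assert (H := filterlim_pair_C _ _ _ _ (Hr _ _ H1) (Hr _ _ H2)).
destruct l as [l1 l2]. simpl in H.
refine (filterlim_ext_loc _ _ _ H).
exists (mkposreal 1 Rlt_0_1). intros t _ Ht.
unfold Cdiv. rewrite -RtoC_inv; [|lra].
apply injective_projections; simpl; unfold Re, Im, Rdiv; ring.
Qed.

Section Picard.

Variables (K : C -> C) (B L : R).
Hypotheses (HL : 0 < L) (HB : 0 < B).
Hypothesis K_bound : forall w, Cmod (K w) <= B.
Hypothesis K_lip : forall w w', Cmod (K w - K w') <= L * Cmod (w - w').

Let K_cont (w : C) : continuous K w.
Proof.
apply filterlim_C. intros eps He. apply locally_Cmod.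
exists (eps / L)%R. split; [apply Rdiv_lt_0_compat; assumption|].
intros w' Hw'. apply: Rle_lt_trans; [apply K_lip|].
apply Rlt_div_r in Hw'; [|exact HL]. lra.
Qed.

Let comp_cont (u : R -> C) : (forall t, continuous u t) -> forall t, continuous (fun s => K (u s)) t.
Proof. intros H t. apply (continuous_comp u K); [apply H|apply K_cont]. Qed.

Fixpoint picard_iter (n : nat) : R -> C :=
  match n with
  | O => fun _ => 0
  | S m => CInt (fun s => K (picard_iter m s)) 0
  end.

Let picard_cont (n : nat) : forall t, continuous (picard_iter n) t.
Proof.
induction n as [|n IH]; intros t; simpl; [apply continuous_const|].
eapply curve_deriv_continuous. apply curve_deriv_CInt. apply comp_cont, IH.
Qed.

Let A := (B / (2 * L))%R.

Let A_pos : 0 < A.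
Proof. apply Rdiv_lt_0_compat; lra. Qed.

Let exp_RInt (M t : R) : is_RInt (fun s => M * exp (2 * L * s))%R 0 t (M / (2 * L) * (exp (2 * L * t) - 1))%R.
Proof.
replace (M / (2 * L) * (exp (2 * L * t) - 1))%R
  with (minus (M / (2 * L) * exp (2 * L * t)) (M / (2 * L) * exp (2 * L * 0)))%R
  by (rewrite Rmult_0_r exp_0; unfold minus, plus, opp; simpl; ring).
apply (is_RInt_derive (fun s => M / (2 * L) * exp (2 * L * s))%R (fun s => M * exp (2 * L * s))%R).
- intros x _. auto_derive; [exact I|field; lra].
- intros x _. apply (ex_derive_continuous (fun s => M * exp (2 * L * s))%R). auto_derive. exact I.
Qed.

(** In the weight [exp (2 L t)] one iteration contracts by [1/2], because integrating
    [L exp (2 L s)] gains the factor [1 / (2 L)]. Convergence thus holds for all times at once. The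
    first step is at most [B t = A * (2 L t)], whence [A]. *)
Let picard_step (n : nat) (t : R) : 0 <= t ->
  Cmod (picard_iter (S n) t - picard_iter n t) <= A / 2 ^ n * exp (2 * L * t).
Proof.
revert t. induction n as [|n IH]; intros t Ht.
- change (Cmod (CInt (fun _ => K 0) 0 t - 0) <= A / 1 * exp (2 * L * t)).
  replace (CInt (fun _ => K 0) 0 t - 0) with (CInt (fun _ => K 0) 0 t) by ring.
  rewrite CInt_const Cmod_mult Cmod_R Rabs_pos_eq; [|lra].
  pose proof (K_bound 0) as H0. pose proof (exp_ineq1_le (2 * L * t)) as H1.
  apply Rle_trans with (t * B)%R; [rewrite Rminus_0_r; apply Rmult_le_compat_l; assumption|].
  apply Rle_trans with (A * (2 * L * t))%R; [right; unfold A; field; lra|].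
  unfold Rdiv. rewrite Rinv_1 Rmult_1_r. apply Rmult_le_compat_l; lra.
- change (Cmod (CInt (fun s => K (picard_iter (S n) s)) 0 t - CInt (fun s => K (picard_iter n s)) 0 t)
    <= A / 2 ^ S n * exp (2 * L * t)).
  assert (C1 : forall m, cont_on (fun s => K (picard_iter m s)) 0 t).
  { intros m s _. apply comp_cont. intros s'. apply picard_cont. }
  rewrite -CInt_minus; [|exact Ht|apply (C1 (S n))|apply (C1 n)].
  pose proof (exp_RInt (L * (A / 2 ^ n)) t) as I1.
  apply: Rle_trans.
  + apply (Cmod_CInt_le_RInt _ (fun s => L * (A / 2 ^ n) * exp (2 * L * s))%R); [exact Ht| | |].
    * intros s Hs. apply filterlim_Cminus; [apply (C1 (S n)), Hs|apply (C1 n), Hs].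
    * eexists; exact I1.
    * intros s Hs. apply: Rle_trans; [apply K_lip|].
      rewrite Rmult_assoc. apply Rmult_le_compat_l; [lra|]. apply IH; lra.
  + rewrite (is_RInt_unique _ _ _ _ I1).
    assert (0 < 2 ^ n) by (apply pow_lt; lra).
    replace (L * (A / 2 ^ n) / (2 * L))%R with (A / 2 ^ S n)%R by (simpl; field; lra).
    apply Rmult_le_compat_l; [|lra].
    apply Rlt_le, Rdiv_lt_0_compat; [exact A_pos|apply pow_lt; lra].
Qed.

Let picard_dist (n k : nat) (t : R) : 0 <= t ->
  Cmod (picard_iter (n + k) t - picard_iter n t) <= 2 * A / 2 ^ n * exp (2 * L * t).
Proof.
intros Ht. pose proof (exp_pos (2 * L * t)) as He.
assert (H : Cmod (picard_iter (n + k) t - picard_iter n t)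
  <= (2 * A / 2 ^ n - 2 * A / 2 ^ (n + k)) * exp (2 * L * t)).
{ induction k as [|k IH].
  - rewrite Nat.add_0_r. replace (picard_iter n t - picard_iter n t) with (RtoC 0) by ring.
    rewrite Cmod_0. lra.
  - rewrite Nat.add_succ_r.
    replace (picard_iter (S (n + k)) t - picard_iter n t)
      with ((picard_iter (S (n + k)) t - picard_iter (n + k) t)
        + (picard_iter (n + k) t - picard_iter n t)) by ring.
    apply: Rle_trans; [apply Cmod_triangle|].
    pose proof (picard_step (n + k) t Ht) as S1.
    assert (0 < 2 ^ (n + k)) by (apply pow_lt; lra).
    replace (2 * A / 2 ^ n - 2 * A / 2 ^ S (n + k))%R
      with (A / 2 ^ (n + k) + (2 * A / 2 ^ n - 2 * A / 2 ^ (n + k)))%R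
      by (simpl; field; split; apply pow_nonzero; lra).
    lra. }
assert (0 < 2 * A / 2 ^ (n + k)) by (apply Rdiv_lt_0_compat; [lra|apply pow_lt; lra]).
nra.
Qed.

(** The curve is continued to negative times with the constant velocity [K 0], so that it has a
    two-sided derivative at [0]; the equation itself is claimed for [0 <= t]. *)
Lemma picard : exists U kappa : R -> C,
  (forall s, continuous kappa s) /\ U 0%R = 0 /\
  (forall t, curve_deriv U t (kappa t)) /\ (forall t, 0 <= t -> kappa t = K (U t)).
Proof.
assert (Hsmall : forall c eps, 0 < eps -> exists N, forall n, (N <= n)%nat -> Rabs (c / 2 ^ n) < eps).
{ intros c eps He. pose proof (is_lim_seq_div_pow2 c) as H. apply is_lim_seq_spec in H.
  destruct (H (mkposreal _ He)) as [N HN]. exists N. intros n Hn.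
  specialize (HN n Hn). simpl in HN. rewrite Rminus_0_r in HN. exact HN. }
set (x := fun n t => picard_iter n (Rmax 0 t)).
assert (Hx0 : forall t, 0 <= Rmax 0 t) by (intros; apply Rmax_l).
assert (Hex : forall t, exists l : C, filterlim (fun n => x n t) eventually (locally l)).
{ intros t. apply C_cauchy_limit. intros eps He.
  destruct (Hsmall (2 * (2 * A * exp (2 * L * Rmax 0 t)))%R eps He) as [N HN].
  exists N. intros n m Hn Hm.
  specialize (HN N (le_n _)).
  replace (x n t - x m t) with ((x n t - x N t) + - (x m t - x N t)) by ring.
  apply: Rle_lt_trans; [apply Cmod_triangle|]. rewrite Cmod_opp.
  assert (Hb : forall n, (N <= n)%nat -> Cmod (x n t - x N t) <= 2 * A / 2 ^ N * exp (2 * L * Rmax 0 t)).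
  { intros k Hk. unfold x. replace k with (N + (k - N))%nat by lia. apply picard_dist, Hx0. }
  pose proof (Hb n Hn). pose proof (Hb m Hm).
  apply: Rle_lt_trans; [|apply: Rle_lt_trans HN; apply Rle_abs].
  replace (2 * (2 * A * exp (2 * L * Rmax 0 t)) / 2 ^ N)%R
    with (2 * (2 * A / 2 ^ N * exp (2 * L * Rmax 0 t)))%R by (field; apply pow_nonzero; lra). lra. }
set (u := fun t => proj1_sig (constructive_indefinite_description _ (Hex t))).
assert (Hu : forall t, filterlim (fun n => x n t) eventually (locally (u t))).
{ intros t. exact (proj2_sig (constructive_indefinite_description _ (Hex t))). }
clearbody u.
assert (Hdist : forall n t, 0 <= t -> Cmod (u t - picard_iter n t) <= 2 * A / 2 ^ n * exp (2 * L * t)).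
{ intros n t Ht.
  refine (is_lim_seq_le (fun k => Cmod (x (n + k)%nat t - picard_iter n t)) (fun _ => _) (Finite _) (Finite _) _ _ (is_lim_seq_const _)).
  - intros k. unfold x. rewrite Rmax_right; [|exact Ht]. apply picard_dist, Ht.
  - apply (filterlim_Cmod (fun k => x (n + k)%nat t - picard_iter n t)).
    apply filterlim_Cminus; [|apply filterlim_const].
    apply (filterlim_comp _ _ _ (fun k => n + k)%nat (fun n => x n t) _ eventually); [|apply Hu].
    intros P [M HM]. exists M. intros k Hk. apply HM. lia. }
assert (Hlip : forall n t s, 0 <= s <= t -> Cmod (picard_iter n t - picard_iter n s) <= B * (t - s)).
{ intros [|n] t s Hs.
  - simpl. replace (0 - 0) with (RtoC 0) by ring. rewrite Cmod_0. nra.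
  - simpl. assert (C1 : cont_on (fun s => K (picard_iter n s)) 0 t).
    { intros y _. apply comp_cont. intros y'. apply picard_cont. }
    rewrite -(CInt_Chasles _ 0 s t); [|lra|lra|exact C1].
    match goal with |- Cmod (?a + ?b - ?c) <= _ => replace (a + b - c) with b by ring end.
    apply Cmod_CInt_le; [lra| |intros; apply K_bound].
    intros y Hy. apply C1. lra. }
assert (Ulip : forall t s, 0 <= s <= t -> Cmod (u t - u s) <= B * (t - s)).
{ intros t s Hs.
  refine (is_lim_seq_le (fun n => Cmod (x n t - x n s)) (fun _ => _) (Finite _) (Finite _) _ _ (is_lim_seq_const _)).
  - intros n. unfold x. rewrite !Rmax_right; [|lra|lra]. apply Hlip, Hs.
  - apply (filterlim_Cmod (fun n => x n t - x n s)). apply filterlim_Cminus; apply Hu. }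
set (u' := fun t => u (Rmax 0 t)).
assert (Cu : forall t, continuous u' t).
{ intros t. apply filterlim_C. intros eps He.
  assert (Hd : 0 < eps / B) by (apply Rdiv_lt_0_compat; assumption).
  exists (mkposreal _ Hd). intros s Hs. change (Rabs (s - t) < eps / B) in Hs.
  apply Rlt_div_r in Hs; [|exact HB]. unfold u'.
  assert (Hm : Rabs (Rmax 0 s - Rmax 0 t) <= Rabs (s - t)).
  { unfold Rmax. destruct (Rle_dec 0 s), (Rle_dec 0 t); unfold Rabs;
      repeat destruct Rcase_abs; lra. }
  pose proof (Hx0 s). pose proof (Hx0 t).
  destruct (Rle_lt_dec (Rmax 0 t) (Rmax 0 s)) as [Hc|Hc].
  - pose proof (Ulip (Rmax 0 s) (Rmax 0 t) ltac:(lra)). rewrite Rabs_pos_eq in Hm; [|lra]. nra.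
  - pose proof (Ulip (Rmax 0 t) (Rmax 0 s) ltac:(lra)).
    replace (u (Rmax 0 s) - u (Rmax 0 t)) with (- (u (Rmax 0 t) - u (Rmax 0 s))) by ring.
    rewrite Cmod_opp. rewrite Rabs_left in Hm; [|lra]. nra. }
assert (Ck := comp_cont u' Cu).
(* The integral equation survives the limit because [Hdist] is uniform on [[0, t]]: the two errors
   add up to [(E / 2 ^ N) * (1 + L t)]. *)
assert (Heq : forall t, 0 <= t -> u t = CInt (fun s => K (u' s)) 0 t).
{ intros t Ht. apply Ceq_eps. intros eps He.
  set (E := (2 * A * exp (2 * L * t))%R).
  assert (HE : 0 < E) by (unfold E; pose proof (exp_pos (2 * L * t)); nra).
  destruct (Hsmall (E * (1 + L * t))%R eps He) as [N HN]. specialize (HN N (le_n _)).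
  assert (P0 : 0 < 2 ^ N) by (apply pow_lt; lra).
  pose proof (Hdist (S N) t Ht) as D1.
  assert (D2 : Cmod (picard_iter (S N) t - CInt (fun s => K (u' s)) 0 t) <= (L * (E / 2 ^ N)) * (t - 0)).
  { simpl. assert (C1 : cont_on (fun s => K (picard_iter N s)) 0 t).
    { intros y _. apply comp_cont. intros y'. apply picard_cont. }
    rewrite -CInt_minus; [|exact Ht|exact C1|intros y _; apply Ck].
    apply Cmod_CInt_le; [exact Ht| |].
    - intros y Hy. apply filterlim_Cminus; [apply C1, Hy|apply Ck].
    - intros s Hs. apply: Rle_trans; [apply K_lip|]. apply Rmult_le_compat_l; [lra|].
      unfold u'. rewrite Rmax_right; [|lra].
      replace (picard_iter N s - u s) with (- (u s - picard_iter N s)) by ring. rewrite Cmod_opp.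
      apply: Rle_trans; [apply Hdist; lra|].
      assert (Hexp : exp (2 * L * s) <= exp (2 * L * t)).
      { destruct (proj2 Hs) as [Hlt| ->]; [|lra]. apply Rlt_le, exp_increasing. nra. }
      unfold E. replace (2 * A * exp (2 * L * t) / 2 ^ N)%R with (2 * A / 2 ^ N * exp (2 * L * t))%R by (field; lra).
      apply Rmult_le_compat_l; [|exact Hexp].
      apply Rlt_le, Rdiv_lt_0_compat; lra. }
  assert (D3 : 2 * A / 2 ^ S N * exp (2 * L * t) <= E / 2 ^ N).
  { replace (E / 2 ^ N)%R with (2 * (2 * A / 2 ^ S N * exp (2 * L * t)))%R
      by (unfold E; simpl; field; lra).
    assert (0 < 2 * A / 2 ^ S N * exp (2 * L * t)).
    { apply Rmult_lt_0_compat; [|apply exp_pos]. apply Rdiv_lt_0_compat; [lra|apply pow_lt; lra]. }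
    lra. }
  replace (u t - CInt (fun s => K (u' s)) 0 t)
    with ((u t - picard_iter (S N) t) + (picard_iter (S N) t - CInt (fun s => K (u' s)) 0 t)) by ring.
  apply: Rle_trans; [apply Cmod_triangle|].
  apply Rlt_le. apply: Rle_lt_trans; [|apply: Rle_lt_trans HN; apply Rle_abs].
  replace (E * (1 + L * t) / 2 ^ N)%R with (E / 2 ^ N + L * (E / 2 ^ N) * (t - 0))%R by (field; lra).
  lra. }
exists (CInt (fun s => K (u' s)) 0), (fun s => K (u' s)).
split; [exact Ck|split; [apply CInt_point|split]].
- intros t. apply curve_deriv_CInt, Ck.
- intros t Ht. rewrite -Heq; [|exact Ht]. unfold u'. rewrite Rmax_right; [reflexivity|exact Ht].
Qed.

End Picard.

(** * The flow of [v' = - v P v] *)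

Lemma exp_neg_lip (x y : R) : 0 <= x -> 0 <= y -> Rabs (exp (- x) - exp (- y)) <= Rabs (x - y).
Proof.
assert (H : forall x y, 0 <= x <= y -> 0 <= exp (- x) - exp (- y) <= y - x).
{ intros a b Hab.
  assert (E : exp (- b) = (exp (- a) * exp (- (b - a)))%R) by (rewrite -exp_plus; f_equal; ring).
  pose proof (exp_ineq1_le (- (b - a))) as H1.
  pose proof (exp_pos (- a)). 
  assert (exp (- a) <= 1) by (rewrite -exp_0; destruct (Req_dec a 0) as [->|];
    [rewrite Ropp_0; lra|apply Rlt_le, exp_increasing; lra]).
  assert (exp (- (b - a)) <= 1) by (rewrite -exp_0; destruct (Req_dec (b - a) 0) as [->|];
    [rewrite Ropp_0; lra|apply Rlt_le, exp_increasing; lra]).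
  rewrite E. nra. }
intros Hx Hy. destruct (Rle_dec x y) as [Hxy|Hxy].
- pose proof (H x y ltac:(lra)). rewrite Rabs_pos_eq; [|lra]. rewrite Rabs_left1; lra.
- pose proof (H y x ltac:(lra)). rewrite Rabs_left1; [|lra]. rewrite Rabs_pos_eq; lra.
Qed.

Lemma cos_lip (x y : R) : Rabs (cos x - cos y) <= Rabs (x - y).
Proof.
rewrite -(Rmult_1_l (Rabs (x - y))). apply (bounded_variation cos (fun t => - sin t)%R).
intros t _. split; [apply is_derive_cos|]. rewrite Rabs_Ropp.
apply Rabs_le. pose proof (SIN_bound t). lra.
Qed.

Lemma sin_lip (x y : R) : Rabs (sin x - sin y) <= Rabs (x - y).
Proof.
rewrite -(Rmult_1_l (Rabs (x - y))). apply (bounded_variation sin cos).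
intros t _. split; [apply is_derive_sin|].
apply Rabs_le. pose proof (COS_bound t). lra.
Qed.

Lemma Cexp_opp_lip (z w : C) : 0 <= Re z -> 0 <= Re w ->
  Cmod (Cexp (- z) - Cexp (- w)) <= 4 * Cmod (z - w).
Proof.
intros Hz Hw.
pose proof (re_le_Cmod (z - w)) as H1. pose proof (im_le_Cmod (z - w)) as H2.
apply: Rle_trans; [apply Cmod_le_Rabs|].
destruct z as [a b], w as [c d]. unfold Cexp. simpl in *.
set (m := Cmod ((a, b) - (c, d))) in *.
change (Rabs (a - c) <= m) in H1. change (Rabs (b - d) <= m) in H2.
pose proof (exp_neg_lip a c Hz Hw) as E1.
assert (C1 : Rabs (cos (- b) - cos (- d)) <= m).
{ apply: Rle_trans; [apply cos_lip|]. replace (- b - - d)%R with (- (b - d))%R by ring.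
  rewrite Rabs_Ropp. exact H2. }
assert (S1 : Rabs (sin (- b) - sin (- d)) <= m).
{ apply: Rle_trans; [apply sin_lip|]. replace (- b - - d)%R with (- (b - d))%R by ring.
  rewrite Rabs_Ropp. exact H2. }
assert (E2 : 0 < exp (- c) <= 1).
{ split; [apply exp_pos|]. rewrite -exp_0. destruct Hw as [Hw| <-]; [|rewrite Ropp_0; lra].
  apply Rlt_le, exp_increasing. lra. }
assert (Hm : 0 <= m) by apply Cmod_ge_0.
assert (X : forall e e' p p', Rabs (e - e') <= m -> 0 < e' <= 1 -> Rabs p <= 1 -> Rabs (p - p') <= m ->
  Rabs (e * p + - (e' * p')) <= 2 * m).
{ intros e e' p p' He He' Hp Hpp. replace (e * p + - (e' * p'))%R with ((e - e') * p + e' * (p - p'))%R by ring.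
  apply: Rle_trans; [apply Rabs_triang|]. rewrite !Rabs_mult (Rabs_pos_eq e'); [|lra].
  pose proof (Rabs_pos (e - e')). pose proof (Rabs_pos p). pose proof (Rabs_pos (p - p')). nra. }
assert (X1 : Rabs (cos (- b)) <= 1) by (apply Rabs_le; pose proof (COS_bound (- b)); lra).
assert (X2 : Rabs (sin (- b)) <= 1) by (apply Rabs_le; pose proof (SIN_bound (- b)); lra).
pose proof (X (exp (- a)) (exp (- c)) _ _ ltac:(lra) E2 X1 C1).
pose proof (X (exp (- a)) (exp (- c)) _ _ ltac:(lra) E2 X2 S1).
lra.
Qed.

Lemma continuous_Rmax_0 (t : R) : continuous (Rmax 0) t.
Proof.
intros P [e He]. exists e. intros s Hs. apply He.
apply: Rle_lt_trans Hs. unfold Rmax.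
destruct (Rle_dec 0 s), (Rle_dec 0 t); unfold abs, minus, plus, opp; simpl; unfold Rabs;
  repeat destruct Rcase_abs; lra.
Qed.

Section Flow.

Variables (P : C -> C) (delta : R).
Hypotheses (HP : holo_disc P) (Hdelta : 0 < delta).
Hypothesis HRe : forall z, Cmod z < 1 -> delta <= Re (P z).

(** The decay clause reflects [delta <= Re P]. It confines the curve to [|v| <= |z|], a compact disc
    on which one divided difference of the field is available for all times, and it forces
    convergence to [0]. *)
Definition flow_line (v : R -> C) (z : C) : Prop :=
  v 0%R = z /\
  (forall t, 0 <= t -> curve_deriv v t (- (v t * P (v t)))) /\
  (forall s t, 0 <= s <= t -> Cmod (v t) <= Cmod (v s) * exp (- (delta * (t - s)))).

Lemma flow_line_decreasing (v : R -> C) (z : C) (s t : R) :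
  flow_line v z -> 0 <= s <= t -> Cmod (v t) <= Cmod (v s).
Proof.
intros [_ [_ H]] Hst. apply: Rle_trans; [apply (H s t Hst)|].
rewrite -{2}(Rmult_1_r (Cmod (v s))). apply Rmult_le_compat_l; [apply Cmod_ge_0|].
rewrite -exp_0. destruct (Req_dec (delta * (t - s)) 0) as [->|N]; [rewrite Ropp_0; lra|].
apply Rlt_le, exp_increasing. assert (0 <= delta * (t - s)) by nra. lra.
Qed.

Lemma flow_line_le (v : R -> C) (z : C) (t : R) :
  flow_line v z -> 0 <= t -> Cmod (v t) <= Cmod z.
Proof.
intros H Ht. pose proof (flow_line_decreasing v z 0 t H ltac:(lra)) as D.
destruct H as [H0 _]. rewrite H0 in D. exact D.
Qed.

(* In the logarithmic variable [v = z * exp (- w)] the equation becomes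
   [w' = P v], whose right-hand side has positive real part, so the
   half-plane [0 <= Re w] is invariant; the field is extended to the whole
   plane by clipping [Re w] at [0]. *)
Lemma flow_line_exists (z : C) : Cmod z < 1 -> exists v, flow_line v z.
Proof.
intros Hz. pose proof (Cmod_ge_0 z) as Hz0.
destruct (holomorphic_divided_difference P 1 (Cmod z) HP ltac:(lra)) as [L [G [HL [G1 [G2 _]]]]].
set (clip := fun w : C => (Rmax 0 (Re w), Im w) : C).
set (V := fun w => z * Cexp (- clip w)).
assert (Hclip : forall w, 0 <= Re (clip w)) by (intros w; apply Rmax_l).
assert (HV : forall w, Cmod (V w) <= Cmod z).
{ intros w. unfold V. rewrite Cmod_mult Cmod_Cexp re_opp. pose proof (Hclip w) as H.
  assert (exp (- Re (clip w)) <= 1).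
  { rewrite -exp_0. destruct H as [H| <-]; [|rewrite Ropp_0; lra].
    apply Rlt_le, exp_increasing. lra. }
  pose proof (exp_pos (- Re (clip w))). nra. }
assert (Hclip_lip : forall w w', Cmod (clip w - clip w') <= 2 * Cmod (w - w')).
{ intros w w'. apply: Rle_trans; [apply Cmod_le_Rabs|].
  pose proof (re_le_Cmod (w - w')) as R1. pose proof (im_le_Cmod (w - w')) as R2.
  assert (Rabs (Re (clip w - clip w')) <= Rabs (Re (w - w'))).
  { destruct w as [a b], w' as [c d]. simpl. unfold Rmax.
    destruct (Rle_dec 0 a), (Rle_dec 0 c); unfold Rabs; repeat destruct Rcase_abs; lra. }
  assert (Im (clip w - clip w') = Im (w - w')) as -> by reflexivity. lra. }
(* The factor [8] is [4] from [Cexp_opp_lip] times [2] from the clipping; each [1] is there for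
   positivity. *)
destruct (picard (fun w => P (V w)) (Cmod (P 0) + L + 1) (8 * L + 1)) as [U [kappa [Ck [U0 [HU Hk]]]]].
- lra.
- pose proof (Cmod_ge_0 (P 0)). lra.
- intros w. replace (P (V w)) with ((P (V w) - P 0) + P 0) by ring.
  apply: Rle_trans; [apply Cmod_triangle|].
  assert (Z0 : Cmod 0 <= Cmod z) by (rewrite Cmod_0; exact Hz0).
  rewrite G1; [|apply HV|exact Z0]. rewrite Cmod_mult.
  replace (V w - 0) with (V w) by ring.
  pose proof (G2 (V w) 0 (HV w) Z0). pose proof (HV w). pose proof (Cmod_ge_0 (V w)).
  pose proof (Cmod_ge_0 (G (V w) 0)). nra.
- intros w w'. rewrite G1; [|apply HV|apply HV]. rewrite Cmod_mult.
  pose proof (G2 (V w) (V w') (HV w) (HV w')) as B1. pose proof (Cmod_ge_0 (G (V w) (V w'))).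
  assert (B2 : Cmod (V w - V w') <= 8 * Cmod (w - w')).
  { unfold V. replace (z * Cexp (- clip w) - z * Cexp (- clip w'))
      with (z * (Cexp (- clip w) - Cexp (- clip w'))) by ring.
    rewrite Cmod_mult. pose proof (Cexp_opp_lip (clip w) (clip w') (Hclip w) (Hclip w')).
    pose proof (Hclip_lip w w'). pose proof (Cmod_ge_0 (Cexp (- clip w) - Cexp (- clip w'))).
    nra. }
  pose proof (Cmod_ge_0 (V w - V w')). pose proof (Cmod_ge_0 (w - w')). nra.
- assert (HUre : forall s t, 0 <= s <= t -> delta * (t - s) <= Re (U t) - Re (U s)).
  { intros s t Hst. destruct (MVT_gen (fun t => Re (U t)) s t (fun t => Re (kappa t))) as [c [Hc Ec]].
    - intros x _. apply (HU x).
    - intros x _. apply continuity_pt_filterlim. 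
      apply (ex_derive_continuous (fun s => Re (U s))). eexists; apply (HU x).
    - rewrite Ec. rewrite Rmin_left in Hc; [|lra]. rewrite Rmax_right in Hc; [|lra].
      rewrite Hk; [|lra]. pose proof (HRe (V (U c)) (Rle_lt_trans _ _ _ (HV _) Hz)).
      apply Rmult_le_compat_r; lra. }
  assert (HU0 : forall t, 0 <= t -> 0 <= Re (U t)).
  { intros t Ht. pose proof (HUre 0%R t ltac:(lra)) as H. rewrite U0 in H. simpl in H.
    assert (0 <= delta * (t - 0)) by nra. lra. }
  exists (fun t => z * Cexp (- U t)). split; [|split].
  + rewrite U0. replace (- 0) with (RtoC 0) by ring. rewrite Cexp_0. ring.
  + intros t Ht.
    assert (D1 : curve_deriv (fun s => 0 - U s) t (0 - kappa t)).
    { apply curve_deriv_minus; [apply curve_deriv_const|apply HU]. }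
    apply curve_deriv_Cexp in D1.
    pose proof (curve_deriv_mult _ _ _ _ _ (curve_deriv_const z t) D1) as D2.
    (* Along the solution the clipping is inactive, because [Re (U t)] starts at [0] and
       increases. *)
    assert (EV : V (U t) = z * Cexp (- U t)).
    { unfold V, clip. rewrite Rmax_right; [|apply HU0, Ht]. destruct (U t); reflexivity. }
    rewrite -EV -Hk; [|exact Ht]. rewrite EV.
    replace (- (z * Cexp (- U t) * kappa t))
      with (0 * Cexp (0 - U t) + z * (Cexp (0 - U t) * (0 - kappa t)))
      by (replace (0 - U t) with (- U t) by ring; ring).
    destruct D2 as [D3 D4].
    assert (Ee : forall s, z * Cexp (0 - U s) = z * Cexp (- U s)).
    { intros s. do 2 f_equal. ring. }
    split.
    * apply (is_derive_ext _ _ _ _ (fun s => f_equal Re (Ee s)) D3).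
    * apply (is_derive_ext _ _ _ _ (fun s => f_equal Im (Ee s)) D4).
  + intros s t Hst. rewrite !Cmod_mult !Cmod_Cexp !re_opp Rmult_assoc.
    apply Rmult_le_compat_l; [exact Hz0|]. rewrite -exp_plus.
    pose proof (HUre s t Hst) as H.
    destruct (Req_dec (- Re (U t)) (- Re (U s) + - (delta * (t - s)))) as [->|N]; [lra|].
    apply Rlt_le, exp_increasing. lra.
Qed.

Lemma flow_line_continuous (v : R -> C) (z : C) (t : R) :
  flow_line v z -> continuous (fun s => v (Rmax 0 s)) t.
Proof.
intros [_ [H _]]. apply (continuous_comp (Rmax 0) v); [apply continuous_Rmax_0|].
eapply curve_deriv_continuous. apply H, Rmax_l.
Qed.

(** Two solutions satisfy the linear equation [(v1 - v2)' = - G v1 v2 * (v1 - v2)]; this is its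
    integrated coefficient, with the integrand extended continuously to negative times. *)
Definition flow_slope (G : C -> C -> C) (v1 v2 : R -> C) : R -> C :=
  CInt (fun s => G (v1 (Rmax 0 s)) (v2 (Rmax 0 s))) 0.

Section TwoFlowLines.

Variables (rho L : R) (G : C -> C -> C).
Hypotheses (Hrho : rho < 1) (HG : divided_difference (fun v => v * P v) rho L G).

Lemma flow_slope_continuous (v1 v2 : R -> C) (z1 z2 : C) (t : R) :
  flow_line v1 z1 -> flow_line v2 z2 -> Cmod z1 <= rho -> Cmod z2 <= rho ->
  continuous (fun s => G (v1 (Rmax 0 s)) (v2 (Rmax 0 s))) t.
Proof.
intros H1 H2 Hz1 Hz2. destruct HG as [_ [B1 B2]].
assert (HL : 0 <= L) by (apply: Rle_trans; [|apply (B1 z1 z1 Hz1 Hz1)]; apply Cmod_ge_0).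
apply filterlim_C. intros eps He.
assert (He' : 0 < eps / (2 * L + 1)) by (apply Rdiv_lt_0_compat; lra).
pose proof (proj1 (filterlim_C _ _) (flow_line_continuous v1 z1 t H1) _ He') as C1.
pose proof (proj1 (filterlim_C _ _) (flow_line_continuous v2 z2 t H2) _ He') as C2.
apply: filter_imp (filter_and _ _ C1 C2) => s [D1 D2].
assert (Hv : forall s, Cmod (v1 (Rmax 0 s)) <= rho /\ Cmod (v2 (Rmax 0 s)) <= rho).
{ intros y. pose proof (flow_line_le v1 z1 (Rmax 0 y) H1 (Rmax_l _ _)).
  pose proof (flow_line_le v2 z2 (Rmax 0 y) H2 (Rmax_l _ _)). lra. }
apply: Rle_lt_trans; [apply B2; apply Hv|].
apply Rlt_div_r in D1; [|lra]. apply Rlt_div_r in D2; [|lra].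
pose proof (Cmod_ge_0 (v1 (Rmax 0 s) - v1 (Rmax 0 t))).
pose proof (Cmod_ge_0 (v2 (Rmax 0 s) - v2 (Rmax 0 t))).
nra.
Qed.

(** The derivative of [(v1 - v2) * Cexp E] vanishes. This exact form of Gronwall's inequality yields
    uniqueness, Lipschitz dependence on the initial value and the complex derivative of the flow. *)
Lemma flow_line_difference (v1 v2 : R -> C) (z1 z2 : C) (t : R) :
  flow_line v1 z1 -> flow_line v2 z2 -> Cmod z1 <= rho -> Cmod z2 <= rho -> 0 <= t ->
  v1 t - v2 t = (z1 - z2) * Cexp (- flow_slope G v1 v2 t).
Proof.
intros H1 H2 Hz1 Hz2 Ht.
pose proof (fun s => flow_slope_continuous v1 v2 z1 z2 s H1 H2 Hz1 Hz2) as CG.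
set (E := flow_slope G v1 v2).
assert (DE : forall s, 0 <= s -> curve_deriv E s (G (v1 s) (v2 s))).
{ intros s Hs. pose proof (curve_deriv_CInt _ s CG) as D. simpl in D.
  rewrite Rmax_right in D; [|exact Hs]. exact D. }
assert (Z : (v1 t - v2 t) * Cexp (E t) = (v1 0%R - v2 0%R) * Cexp (E 0%R)).
{ apply (curve_deriv_zero (fun s => (v1 s - v2 s) * Cexp (E s)) t Ht).
  intros s Hs.
  pose proof (flow_line_le v1 z1 s H1 ltac:(lra)). pose proof (flow_line_le v2 z2 s H2 ltac:(lra)).
  destruct HG as [G1 _]. specialize (G1 (v1 s) (v2 s) ltac:(lra) ltac:(lra)). simpl in G1.
  pose proof (curve_deriv_mult _ _ _ _ _
    (curve_deriv_minus _ _ _ _ _ (proj1 (proj2 H1) s ltac:(lra)) (proj1 (proj2 H2) s ltac:(lra)))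
    (curve_deriv_Cexp _ _ _ (DE s ltac:(lra)))) as D.
  replace (RtoC 0) with ((- (v1 s * P (v1 s)) - - (v2 s * P (v2 s))) * Cexp (E s)
    + (v1 s - v2 s) * (Cexp (E s) * G (v1 s) (v2 s))); [exact D|].
  replace (- (v1 s * P (v1 s)) - - (v2 s * P (v2 s)))
    with (- (v1 s * P (v1 s) - v2 s * P (v2 s))) by ring.
  rewrite G1. ring. }
assert (E0 : E 0%R = 0) by apply CInt_point.
rewrite E0 Cexp_0 (proj1 H1) (proj1 H2) in Z.
assert (EE : Cexp (E t) * Cexp (- E t) = 1).
{ rewrite -Cexp_plus. replace (E t + - E t) with (RtoC 0) by ring. apply Cexp_0. }
replace (v1 t - v2 t) with ((v1 t - v2 t) * Cexp (E t) * Cexp (- E t))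
  by (rewrite -Cmult_assoc EE; ring).
rewrite Z. ring.
Qed.

Lemma flow_line_lipschitz (v1 v2 : R -> C) (z1 z2 : C) (t : R) :
  flow_line v1 z1 -> flow_line v2 z2 -> Cmod z1 <= rho -> Cmod z2 <= rho -> 0 <= t ->
  Cmod (v1 t - v2 t) <= Cmod (z1 - z2) * exp (L * t).
Proof.
intros H1 H2 Hz1 Hz2 Ht.
rewrite (flow_line_difference v1 v2 z1 z2 t H1 H2 Hz1 Hz2 Ht) Cmod_mult Cmod_Cexp re_opp.
apply Rmult_le_compat_l; [apply Cmod_ge_0|].
assert (B : Cmod (flow_slope G v1 v2 t) <= L * (t - 0)).
{ apply Cmod_CInt_le; [exact Ht| |].
  - intros s _. apply (flow_slope_continuous v1 v2 z1 z2); assumption.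
  - intros s Hs. rewrite Rmax_right; [|lra].
    pose proof (flow_line_le v1 z1 s H1 ltac:(lra)). pose proof (flow_line_le v2 z2 s H2 ltac:(lra)).
    apply HG; lra. }
pose proof (re_le_Cmod (flow_slope G v1 v2 t)) as R1. apply Rabs_le_between in R1.
destruct (Req_dec (- Re (flow_slope G v1 v2 t)) (L * t)) as [->|N]; [lra|].
apply Rlt_le, exp_increasing. lra.
Qed.

End TwoFlowLines.

Lemma field_divided_difference (rho : R) : 0 <= rho < 1 ->
  exists L G, 0 <= L /\ divided_difference (fun v => v * P v) rho L G.
Proof.
intros H. apply (holomorphic_divided_difference _ 1); [|exact H].
intros z Hz. apply cdiff_mult; [apply cdiff_id|apply HP, Hz].
Qed.

Lemma flow_line_unique (v1 v2 : R -> C) (z : C) (t : R) :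
  flow_line v1 z -> flow_line v2 z -> Cmod z < 1 -> 0 <= t -> v1 t = v2 t.
Proof.
intros H1 H2 Hz Ht. pose proof (Cmod_ge_0 z).
destruct (field_divided_difference (Cmod z) ltac:(lra)) as [L [G [_ HG]]].
apply Ceq_minus.
rewrite (flow_line_difference (Cmod z) L G HG v1 v2 z z t); try assumption; try lra.
ring.
Qed.

Lemma flow_line_shift (v : R -> C) (z : C) (s : R) :
  flow_line v z -> 0 <= s -> flow_line (fun t => v (t + s)%R) (v s).
Proof.
intros [H0 [H1 H2]] Hs. split; [rewrite Rplus_0_l; reflexivity|split].
- intros t Ht. destruct (H1 (t + s)%R ltac:(lra)) as [D1 D2].
  assert (Dt : is_derive (fun t => t + s)%R t 1%R) by (auto_derive; [exact I|ring]).
  split.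
  + pose proof (is_derive_comp (fun x => Re (v x)) (fun t => t + s)%R t _ _ D1 Dt) as D.
    unfold scal in D; simpl in D; unfold mult in D; simpl in D. rewrite Rmult_1_l in D. exact D.
  + pose proof (is_derive_comp (fun x => Im (v x)) (fun t => t + s)%R t _ _ D2 Dt) as D.
    unfold scal in D; simpl in D; unfold mult in D; simpl in D. rewrite Rmult_1_l in D. exact D.
- intros a b Hab. pose proof (H2 (a + s)%R (b + s)%R ltac:(lra)) as D.
  replace (b + s - (a + s))%R with (b - a)%R in D by ring. exact D.
Qed.

Lemma flow_exists : exists Phi : R -> C -> C,
  forall z, Cmod z < 1 -> flow_line (fun t => Phi t z) z.
Proof.
assert (H : forall z, exists v, Cmod z < 1 -> flow_line v z).
{ intros z. destruct (Rlt_dec (Cmod z) 1) as [Hz|Hz].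
  - destruct (flow_line_exists z Hz) as [v Hv]. exists v. auto.
  - exists (fun _ => z). contradiction. }
exists (fun t z => proj1_sig (constructive_indefinite_description _ (H z)) t).
intros z Hz. exact (proj2_sig (constructive_indefinite_description _ (H z)) Hz).
Qed.

Section Semigroup.

Variable Phi : R -> C -> C.
Hypothesis HPhi : forall z, Cmod z < 1 -> flow_line (fun t => Phi t z) z.

Lemma flow_self_map (t : R) (z : C) : 0 <= t -> Cmod z < 1 -> Cmod (Phi t z) < 1.
Proof.
intros Ht Hz. pose proof (flow_line_le _ _ t (HPhi z Hz) Ht) as H. simpl in H. lra.
Qed.

(** By [flow_line_difference] the slope of [Phi t] between [z] and [w] is [Cexp (- E z)]. Since [E]
    is Lipschitz at [w], this slope has the limit [Cexp (- E w)], the derivative. *)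
Lemma flow_holo (t : R) : 0 <= t -> holo_disc (Phi t).
Proof.
intros Ht w Hw. pose proof (Cmod_ge_0 w) as Hw0.
set (rho := ((Cmod w + 1) / 2)%R).
assert (Hrho : Cmod w < rho < 1) by (unfold rho; lra).
destruct (field_divided_difference rho ltac:(lra)) as [L [G [HL HG]]].
set (E := fun z => flow_slope G (fun t => Phi t z) (fun t => Phi t w) t).
set (Z := (t * (L * exp (L * t)))%R).
assert (HZ : 0 <= Z).
{ unfold Z. pose proof (exp_pos (L * t)). apply Rmult_le_pos; [exact Ht|]. nra. }
assert (HE : forall z, Cmod z <= rho -> Cmod (E z - E w) <= Z * Cmod (z - w)).
{ intros z Hz. unfold E, flow_slope.
  assert (Lz := HPhi z ltac:(lra)). assert (Lw := HPhi w Hw).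
  assert (Cz := fun s => flow_slope_continuous rho L G HG _ _ z w s Lz Lw Hz ltac:(lra)).
  assert (Cw := fun s => flow_slope_continuous rho L G HG _ _ w w s Lw Lw ltac:(lra) ltac:(lra)).
  rewrite -CInt_minus; [|exact Ht|intros s _; apply Cz|intros s _; apply Cw].
  apply Rle_trans with ((L * (Cmod (z - w) * exp (L * t))) * (t - 0))%R; [|unfold Z; right; ring].
  apply Cmod_CInt_le; [exact Ht|intros s _; apply filterlim_Cminus; [apply Cz|apply Cw]|].
  intros s Hs. rewrite Rmax_right; [|lra].
  pose proof (flow_line_le _ _ s Lz ltac:(lra)) as B1. pose proof (flow_line_le _ _ s Lw ltac:(lra)) as B2.
  simpl in B1, B2.
  apply: Rle_trans; [apply HG; lra|].
  replace (Phi s w - Phi s w) with (RtoC 0) by ring. rewrite Cmod_0 Rplus_0_r.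
  apply Rmult_le_compat_l; [exact HL|].
  apply: Rle_trans; [apply (flow_line_lipschitz rho L G HG _ _ z w s Lz Lw Hz); lra|].
  apply Rmult_le_compat_l; [apply Cmod_ge_0|].
  destruct (Req_dec (L * s) (L * t)) as [->|N]; [lra|].
  apply Rlt_le, exp_increasing. assert (L * s <= L * t) by (apply Rmult_le_compat_l; lra). lra. }
exists (Cexp (- E w)). apply cderiv_eps. intros eps He.
pose proof (cderiv_continuous _ _ _ (cderiv_Cexp (- E w))) as CE.
apply filterlim_C with (eps := eps) in CE; [|exact He].
apply locally_Cmod in CE. destruct CE as [d [Hd HCE]].
exists (Rmin (rho - Cmod w) (d / (Z + 1))). split.
{ apply Rmin_pos; [lra|]. apply Rdiv_lt_0_compat; lra. }
intros z Hz.
assert (W1 : Cmod (z - w) < rho - Cmod w) by (apply: Rlt_le_trans Hz _; apply Rmin_l).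
assert (W2 : Cmod (z - w) < d / (Z + 1)) by (apply: Rlt_le_trans Hz _; apply Rmin_r).
assert (W3 : Cmod z <= rho) by (pose proof (Cmod_sub_ge z w); lra).
apply Rlt_div_r in W2; [|lra].
rewrite (flow_line_difference rho L G HG _ _ z w t (HPhi z ltac:(lra)) (HPhi w Hw) W3 ltac:(lra) Ht).
fold (E z).
replace ((z - w) * Cexp (- E z) - Cexp (- E w) * (z - w))
  with ((Cexp (- E z) - Cexp (- E w)) * (z - w)) by ring.
rewrite Cmod_mult. apply Rmult_le_compat_r; [apply Cmod_ge_0|].
apply Rlt_le, HCE.
replace (- E z - - E w) with (- (E z - E w)) by ring. rewrite Cmod_opp.
apply: Rle_lt_trans; [apply HE, W3|]. pose proof (Cmod_ge_0 (z - w)). nra.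
Qed.

Lemma flow_add (t s : R) (z : C) : 0 <= t -> 0 <= s -> Cmod z < 1 ->
  Phi (t + s)%R z = Phi t (Phi s z).
Proof.
intros Ht Hs Hz.
pose proof (flow_self_map s z Hs Hz) as Hsz.
exact (flow_line_unique _ _ (Phi s z) t (flow_line_shift _ z s (HPhi z Hz) Hs) (HPhi _ Hsz) Hsz Ht).
Qed.

Lemma flow_tends_to_0 (z : C) : Cmod z < 1 ->
  filterlim (fun t => Phi t z) (Rbar_locally p_infty) (locally (RtoC 0)).
Proof.
intros Hz. apply filterlim_C. intros eps He.
exists (Rmax 0 (- ln eps / delta)). intros t Ht.
assert (T0 : 0 < t) by (apply: Rle_lt_trans Ht; apply Rmax_l).
assert (T1 : - ln eps / delta < t) by (apply: Rle_lt_trans Ht; apply Rmax_r).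
apply Rlt_div_l in T1; [|exact Hdelta].
destruct (HPhi z Hz) as [E0 [_ HD]]. specialize (HD 0%R t ltac:(lra)). simpl in HD, E0. rewrite E0 in HD.
replace (Phi t z - 0) with (Phi t z) by ring.
apply: Rle_lt_trans; [exact HD|].
apply Rle_lt_trans with (1 * exp (- (delta * (t - 0))))%R.
- apply Rmult_le_compat_r; [apply Rlt_le, exp_pos|lra].
- rewrite Rmult_1_l -(exp_ln eps He). apply exp_increasing. lra.
Qed.

End Semigroup.

End Flow.

(** * Generators of Berkson-Porta form *)

Lemma moebius_inv_opp (b z : C) : Cmod b < 1 -> Cmod z < 1 -> moebius b (moebius (- b) z) = z.
Proof.
intros Hb Hz. rewrite -(Cmod_opp b) in Hb. pose proof (moebius_inv (- b) z Hb Hz) as H.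
replace (- - b) with b in H by ring. exact H.
Qed.

Lemma at_right_locally : filter_le (at_right 0) (locally (0 : R)).
Proof. intros P. unfold at_right, within. apply filter_imp. auto. Qed.

(** The automorphism [M] takes [tau] to [0] and turns the field into [v * P v] with
    [P v = s * p (N v)], whose factor [P] has real part at least [s * eta]. The semigroup is the
    flow of this field, transported back by [N]. *)
Lemma berkson_porta_generator (tau : C) (p : C -> C) (eta : R) :
  Cmod tau < 1 -> holo_disc p -> 0 < eta -> (forall z, Cmod z < 1 -> eta <= Re (p z)) ->
  generator_DW tau (fun z => (z - tau) * ((1 - Cconj tau * z) * p z)).
Proof.
intros Htau Hp Heta HRe.
set (s := (1 - Cmod tau ^ 2)%R).
assert (Hs : 0 < s) by (unfold s; pose proof (Cmod_ge_0 tau); nra).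
assert (Es : RtoC s = 1 - Cconj tau * tau).
{ unfold s. rewrite RtoC_minus Cmod2_conj. ring. }
assert (Hmt : Cmod (- tau) < 1) by (rewrite Cmod_opp; exact Htau).
set (M := moebius tau). set (N := moebius (- tau)).
assert (NM : forall z, Cmod z < 1 -> N (M z) = z) by (intros z Hz; apply moebius_inv; assumption).
assert (MN : forall z, Cmod z < 1 -> M (N z) = z) by (intros z Hz; apply moebius_inv_opp; assumption).
assert (HM : forall z, Cmod z < 1 -> Cmod (M z) < 1) by (intros z Hz; apply moebius_self_map; assumption).
assert (HN : forall z, Cmod z < 1 -> Cmod (N z) < 1) by (intros z Hz; apply moebius_self_map; assumption).
set (P := fun v => RtoC s * p (N v)).
assert (HP : holo_disc P).
{ intros v Hv. apply cdiff_mult; [apply cdiff_const|].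
  apply (cdiff_comp N p); [apply moebius_cdiff; lra|apply Hp, HN, Hv]. }
assert (HPre : forall v, Cmod v < 1 -> s * eta <= Re (P v)).
{ intros v Hv. unfold P. rewrite re_scal_l. apply Rmult_le_compat_l; [lra|apply HRe, HN, Hv]. }
assert (Hse : 0 < s * eta) by nra.
destruct (flow_exists P _ HP Hse HPre) as [Phi HPhi].
assert (Pself := flow_self_map P _ Hse Phi HPhi).
exists (fun t z => N (Phi t (M z))). split; [split|split].
- intros t Ht z Hz. apply HM in Hz as Hz'.
  destruct (cdiff_comp (fun z => Phi t (M z)) N z) as [l Hl].
  + apply (cdiff_comp M (Phi t)); [apply moebius_cdiff; [lra|exact Hz]|].
    apply (flow_holo P _ HP Hse Phi HPhi t Ht), Hz'.
  + apply moebius_cdiff; [lra|]. apply Pself; assumption.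
  + exists l. apply cderiv_is_derive, Hl.
- intros t z Ht Hz. apply HN, Pself; [exact Ht|apply HM, Hz].
- intros t r z Ht Hr Hz. rewrite (flow_add P _ HP Hse Phi HPhi t r (M z) Ht Hr (HM z Hz)).
  rewrite MN; [reflexivity|]. apply Pself; [exact Hr|apply HM, Hz].
- intros z Hz. destruct (HPhi (M z) (HM z Hz)) as [-> _]. apply NM, Hz.
- intros r z Hr Hz. destruct (HPhi (M z) (HM z Hz)) as [_ [D _]].
  pose proof (curve_deriv_continuous _ _ _ (D r Hr)) as Cr. simpl in Cr.
  assert (Hle : filter_le (within (fun t => 0 <= t) (locally r)) (locally r)).
  { intros Q. unfold within. apply filter_imp. auto. }
  refine (filterlim_filter_le_1 _ Hle _).
  apply (filterlim_comp _ _ _ (fun t => Phi t (M z)) N _ (locally (Phi r (M z)))); [exact Cr|].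
  apply cdiff_continuous, moebius_cdiff; [lra|]. apply Pself; [exact Hr|apply HM, Hz].
- intros z Hz. set (v0 := M z). assert (Hv0 : Cmod v0 < 1) by apply HM, Hz.
  destruct (HPhi v0 Hv0) as [E0 [D _]]. simpl in E0.
  assert (D0 := D 0%R (Rle_refl 0)). simpl in D0. rewrite E0 in D0.
  pose proof (curve_deriv_quotient _ _ D0) as Q. simpl in Q. rewrite E0 in Q.
  assert (Cv : filterlim (fun t => Phi t v0) (at_right 0) (locally v0)).
  { refine (filterlim_filter_le_1 _ at_right_locally _).
    rewrite -{2}E0. exact (curve_deriv_continuous _ _ _ D0). }
  assert (Nd : forall v, Cmod v < 1 -> 1 + Cconj tau * v <> 0).
  { intros v Hv E. apply (moebius_den (- tau) v); [lra|exact Hv|].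
    rewrite -E Copp_conj. ring. }
  (* The difference quotient of [N] is explicit: [N v - N v0] is [v - v0] times
     [s / ((1 + conj tau v) (1 + conj tau v0))]. *)
  assert (HL : filterlim (fun t => - ((Phi t v0 - v0) / RtoC t) * (RtoC s / ((1 + Cconj tau * Phi t v0) * (1 + Cconj tau * v0))))
    (at_right 0) (locally (- - (v0 * P v0) * (RtoC s / ((1 + Cconj tau * v0) * (1 + Cconj tau * v0)))))).
  { apply filterlim_Cmult; [apply filterlim_Copp; exact Q|].
    apply filterlim_Cdiv; [apply Cmult_neq_0; apply Nd, Hv0|apply filterlim_const|].
    apply filterlim_Cmult; [|apply filterlim_const].
    apply filterlim_Cplus; [apply filterlim_const|].
    apply filterlim_Cmult; [apply filterlim_const|exact Cv]. }
  replace ((z - tau) * ((1 - Cconj tau * z) * p z))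
    with (- - (v0 * P v0) * (RtoC s / ((1 + Cconj tau * v0) * (1 + Cconj tau * v0)))).
  + refine (filterlim_ext_loc _ _ _ HL).
    exists (mkposreal 1 Rlt_0_1). intros t _ Ht.
    assert (Nt : RtoC t <> 0) by (intros E; apply RtoC_inj in E; lra).
    assert (N1 := Nd _ (Pself t v0 (Rlt_le _ _ Ht) Hv0)). assert (N2 := Nd _ Hv0).
    fold v0. rewrite -{1}(NM z Hz). fold v0. unfold N, moebius. rewrite Es Copp_conj.
    field. repeat split; try assumption.
    * intros E. apply N1. rewrite -E. ring.
    * intros E. apply N2. rewrite -E. ring.
  + unfold P, v0. rewrite NM; [|exact Hz]. unfold M, moebius. rewrite Es.
    assert (N1 := moebius_den tau z ltac:(lra) Hz).
    assert (N2 := moebius_den tau tau ltac:(lra) Htau).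
    field. split; [exact N1|].
    intros E. apply N2. rewrite -E. ring.
- intros z Hz. pose proof (flow_tends_to_0 P _ Hse Phi HPhi (M z) (HM z Hz)) as L.
  apply (filterlim_comp _ _ _ (fun t => Phi t (M z)) N _ (locally (RtoC 0))); [exact L|].
  assert (E : N 0 = tau).
  { unfold N, moebius. rewrite Copp_conj. field. }
  rewrite -E. apply cdiff_continuous, moebius_cdiff; [lra|rewrite Cmod_0; lra].
Qed.

Lemma berkson_porta_derive (tau : C) (p : C -> C) :
  Cmod tau < 1 -> holo_disc p ->
  @is_derive C_AbsRing C_NormedModule (fun z => (z - tau) * ((1 - Cconj tau * z) * p z)) tau
    (RtoC (1 - Cmod tau ^ 2) * p tau).
Proof.
intros Htau Hp. apply cderiv_is_derive.
exists (fun w => (1 - Cconj tau * w) * p w). split; [|split].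
- intros w. ring.
- rewrite RtoC_minus Cmod2_conj. ring.
- apply cdiff_continuous, cdiff_mult; [|apply Hp, Htau].
  apply cdiff_minus; [apply cdiff_const|apply cdiff_mult; [apply cdiff_const|apply cdiff_id]].
Qed.

Definition DW_with_derivative (mu tau : C) (g : C -> C) : Prop :=
  generator_DW tau g /\ @is_derive C_AbsRing C_NormedModule g tau mu.

Lemma berkson_porta_realizes (mu tau : C) (p : C -> C) (eta : R) :
  Cmod tau < 1 -> holo_disc p -> 0 < eta -> (forall z, Cmod z < 1 -> eta <= Re (p z)) ->
  RtoC (1 - Cmod tau ^ 2) * p tau = mu ->
  DW_with_derivative mu tau (fun z => (z - tau) * ((1 - Cconj tau * z) * p z)).
Proof.
intros H1 H2 H3 H4 H5. split; [apply (berkson_porta_generator tau p eta); assumption|].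
rewrite -H5. apply berkson_porta_derive; assumption.
Qed.

(** A constant [p] does it. This supplies the members of the family at points [tau] where no
    approximation of [f] is available. *)
Lemma realizing_generator_exists (mu tau : C) : 0 < Re mu -> Cmod tau < 1 -> exists g, DW_with_derivative mu tau g.
Proof.
intros Hmu Htau.
assert (Hs : 0 < 1 - Cmod tau ^ 2) by (pose proof (Cmod_ge_0 tau); nra).
exists (fun z => (z - tau) * ((1 - Cconj tau * z) * (RtoC (/ (1 - Cmod tau ^ 2)) * mu))).
apply (berkson_porta_realizes mu tau (fun _ => RtoC (/ (1 - Cmod tau ^ 2)) * mu)
  (/ (1 - Cmod tau ^ 2) * Re mu)%R Htau).
- intros z _. apply cdiff_const.
- apply Rmult_lt_0_compat; [apply Rinv_0_lt_compat, Hs|exact Hmu].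
- intros z _. rewrite re_scal_l. lra.
- rewrite Cmult_assoc -RtoC_mult Rinv_r; [ring|lra].
Qed.

(** * Half-plane kernels and the equation for their parameter *)

Definition cayley (a z : C) : C := (1 + a * z) / (1 - a * z).

Lemma cayley_den (a z : C) : Cmod a <= 1 -> Cmod z < 1 -> 1 - Cmod z <= Cmod (1 - a * z).
Proof.
intros Ha Hz. pose proof (Cmod_sub_ge 1 (a * z)) as T. rewrite Cmod_1 Cmod_mult in T.
pose proof (Cmod_ge_0 z). pose proof (Cmod_ge_0 a). nra.
Qed.

Lemma cayley_den_neq_0 (a z : C) : Cmod a <= 1 -> Cmod z < 1 -> 1 - a * z <> 0.
Proof. intros Ha Hz. apply Cmod_gt_0. pose proof (cayley_den a z Ha Hz). lra. Qed.

Lemma cayley_Re (a z : C) : Cmod a <= 1 -> Cmod z < 1 -> 0 <= Re (cayley a z).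
Proof.
intros Ha Hz. pose proof (cayley_den_neq_0 a z Ha Hz) as N.
unfold cayley. rewrite Re_div; [|exact N].
apply Rdiv_le_0_compat; [|apply pow_lt, Cmod_gt_0, N].
assert (H : Cmod (a * z) ^ 2 <= 1).
{ rewrite Cmod_mult. pose proof (Cmod_ge_0 z). pose proof (Cmod_ge_0 a).
  assert (Cmod a * Cmod z <= 1) by nra. assert (0 <= Cmod a * Cmod z) by nra. nra. }
rewrite Cmod2_alt in H. destruct (a * z) as [x y]. simpl in *. nra.
Qed.

Lemma cayley_holo (a : C) : Cmod a <= 1 -> holo_disc (cayley a).
Proof.
intros Ha z Hz.
assert (D : cdiff (fun w => a * w) z) by (apply cdiff_mult; [apply cdiff_const|apply cdiff_id]).
apply cdiff_div; [apply cayley_den_neq_0; assumption| |].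
- apply cdiff_plus; [apply cdiff_const|exact D].
- apply cdiff_minus; [apply cdiff_const|exact D].
Qed.

Lemma cayley_bound (a z : C) (e : R) : Cmod a <= 1 -> Cmod z <= 1 - e -> 0 < e ->
  Cmod (cayley a z) <= 2 / e.
Proof.
intros Ha Hz He. pose proof (Cmod_ge_0 z).
assert (Hz1 : Cmod z < 1) by lra.
pose proof (cayley_den a z Ha Hz1). unfold cayley, Cdiv. rewrite Cmod_mult.
apply Rmult_le_compat; [apply Cmod_ge_0|apply Cmod_ge_0| |apply Cmod_inv_le; lra].
apply: Rle_trans; [apply Cmod_triangle|]. rewrite Cmod_1 Cmod_mult.
pose proof (Cmod_ge_0 a). nra.
Qed.

Lemma cayley_lip (a z : C) (e : R) : Cmod a <= 1 -> Cmod z <= 1 - e -> 0 < e ->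
  Cmod (cayley a z - cayley 1 z) <= 2 / e ^ 2 * Cmod (a - 1).
Proof.
intros Ha Hz He. pose proof (Cmod_ge_0 z).
assert (Hz1 : Cmod z < 1) by lra.
assert (H1 : Cmod 1 <= 1) by (rewrite Cmod_1; lra).
pose proof (cayley_den a z Ha Hz1). pose proof (cayley_den 1 z H1 Hz1).
assert (N1 := cayley_den_neq_0 a z Ha Hz1). assert (N2 := cayley_den_neq_0 1 z H1 Hz1).
replace (cayley a z - cayley 1 z) with (2 * z * (a - 1) * (/ (1 - a * z) * / (1 - 1 * z))).
2:{ unfold cayley. field. split; [|exact N1]. intros E. apply N2. rewrite -E. ring. }
rewrite !Cmod_mult. replace (Cmod 2) with 2%R by (rewrite Cmod_R Rabs_pos_eq; lra).
assert (I1 : Cmod (/ (1 - a * z)) <= / e) by (apply Cmod_inv_le; lra).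
assert (I2 : Cmod (/ (1 - 1 * z)) <= / e) by (apply Cmod_inv_le; lra).
pose proof (Cmod_ge_0 (/ (1 - a * z))). pose proof (Cmod_ge_0 (/ (1 - 1 * z))).
pose proof (Cmod_ge_0 (a - 1)).
replace (2 / e ^ 2 * Cmod (a - 1))%R with (2 * Cmod (a - 1) * (/ e * / e))%R by (field; lra).
apply Rmult_le_compat; [nra|nra|nra|]. apply Rmult_le_compat; assumption.
Qed.

Lemma holo_bound (q : C -> C) (rho : R) : holo_disc q -> 0 <= rho < 1 ->
  exists L, 0 <= L /\ (forall z, Cmod z <= rho -> Cmod (q z) <= L) /\
    (forall z w, Cmod z <= rho -> Cmod w <= rho -> Cmod (q z - q w) <= L * Cmod (z - w)).
Proof.
intros Hq Hr. destruct (holomorphic_divided_difference q 1 rho Hq Hr) as [L [G [HL [G1 [G2 _]]]]].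
assert (H0 : Cmod 0 <= rho) by (rewrite Cmod_0; lra).
assert (Hlip : forall z w, Cmod z <= rho -> Cmod w <= rho -> Cmod (q z - q w) <= L * Cmod (z - w)).
{ intros z w Hz Hw. rewrite G1; try assumption. rewrite Cmod_mult Rmult_comm.
  apply Rmult_le_compat_r; [apply Cmod_ge_0|apply G2; assumption]. }
pose proof (Cmod_ge_0 (q 0)).
exists (L + Cmod (q 0))%R. split; [lra|split].
- intros z Hz. replace (q z) with ((q z - q 0) + q 0) by ring.
  apply: Rle_trans; [apply Cmod_triangle|]. pose proof (Hlip z 0 Hz H0) as B.
  replace (z - 0) with z in B by ring. pose proof (Cmod_ge_0 z). nra.
- intros z w Hz Hw. apply: Rle_trans; [apply Hlip; assumption|].
  pose proof (Cmod_ge_0 (z - w)). nra.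
Qed.

Lemma small_factor (X Y : R) : 0 <= X -> 0 < Y -> exists d, 0 < d /\ forall t, 0 <= t <= d -> t * X <= Y.
Proof.
intros HX HY. exists (Y / (X + 1))%R. split; [apply Rdiv_lt_0_compat; lra|].
intros t Ht. apply Rle_trans with (Y / (X + 1) * (X + 1))%R; [|right; field; lra].
assert (0 < Y / (X + 1)) by (apply Rdiv_lt_0_compat; lra). nra.
Qed.

(* With [s = 1 - |tau|^2], the parameter [a = (1 - s / w) / tau] solves
   [s / (1 - a * tau) = w]; it lies in the closed disc as soon as [w] lies in
   the disc [|w - 1|^2 <= 1 - s]. *)
Lemma solve_parameter (tau w : C) :
  let s := (1 - Cmod tau ^ 2)%R in
  Cmod tau < 1 -> tau <> 0 -> w <> 0 -> Cmod w ^ 2 + s <= 2 * Re w ->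
  Cmod ((1 - RtoC s / w) / tau) <= 1.
Proof.
intros s Htau Ht Hw H. pose proof (Cmod_ge_0 tau) as Ht0.
assert (Hs : 0 < s) by (unfold s; nra).
assert (P1 : 0 < Cmod tau) by (apply Cmod_gt_0, Ht). assert (P2 : 0 < Cmod w) by (apply Cmod_gt_0, Hw).
rewrite Cmod_div; [|exact Ht]. apply Rle_div_l; [exact P1|]. rewrite Rmult_1_l.
replace (1 - RtoC s / w) with ((w - RtoC s) / w) by (field; exact Hw).
rewrite Cmod_div; [|exact Hw]. apply Rle_div_l; [exact P2|].
(* Squared, the claim is [|w - s|^2 <= (1 - s) |w|^2], which is the hypothesis on [w] multiplied by
   [s]. *)
apply Rsqr_incr_0_var; [|nra]. unfold Rsqr.
assert (E : (Cmod (w - RtoC s) ^ 2 = Cmod w ^ 2 - 2 * s * Re w + s ^ 2)%R).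
{ rewrite !Cmod2_alt. destruct w; simpl; ring. }
assert (E2 : (Cmod tau ^ 2 = 1 - s)%R) by (unfold s; ring).
replace (Cmod tau * Cmod w * (Cmod tau * Cmod w))%R with (Cmod tau ^ 2 * Cmod w ^ 2)%R by ring.
replace (Cmod (w - RtoC s) * Cmod (w - RtoC s))%R with (Cmod (w - RtoC s) ^ 2)%R by ring.
rewrite E E2. nra.
Qed.

(** * Approximation *)

Lemma remainder_decomposition (f : C -> C) (beta : R) (z : C) : Cmod z < 1 ->
  f z = - ((1 - z) * (1 - z)) * (RtoC (beta / 2) * cayley 1 z + remainder f beta z).
Proof.
intros Hz. pose proof (one_minus_neq_0 z Hz) as N.
unfold cayley, remainder. field. exact N.
Qed.

Lemma disc_Re_bound (mu : C) (beta : R) : 0 < beta -> Cmod (mu - RtoC beta) <= beta ->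
  Cmod mu ^ 2 <= 2 * beta * Re mu.
Proof.
intros Hb H. pose proof (Cmod_ge_0 (mu - RtoC beta)).
assert (H2 : Cmod (mu - RtoC beta) ^ 2 <= beta ^ 2) by (apply pow_incr; lra).
rewrite !Cmod2_alt in H2 |- *. destruct mu as [x y]. simpl in *. nra.
Qed.

Lemma Cmod_one_minus (tau : C) : 1 - Cmod tau <= Cmod (tau - 1).
Proof.
pose proof (Cmod_sub_ge 1 tau) as H. rewrite Cmod_1 in H.
replace (1 - tau) with (- (tau - 1)) in H by ring. rewrite Cmod_opp in H. exact H.
Qed.

(* Near [1] the value [w], a perturbation of [mu / (c * beta)] with [c > 1], stays
   inside the disc required by [solve_parameter]. *)
Lemma perturbed_parameter (w0 : C) (D alpha : R) :
  0 <= D -> 0 < alpha -> Cmod w0 ^ 2 < 2 * Re w0 ->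
  exists delta, 0 < delta /\ forall tau w : C,
    Cmod tau < 1 -> Cmod (tau - 1) < delta -> Cmod (w - w0) <= (1 - Cmod tau ^ 2) * D ->
    tau <> 0 /\ w <> 0 /\
    Cmod ((1 - RtoC (1 - Cmod tau ^ 2) / w) / tau) <= 1 /\
    Cmod ((1 - RtoC (1 - Cmod tau ^ 2) / w) / tau - 1) <= alpha.
Proof.
intros HD Ha Hw0.
set (r0 := Cmod w0) in *.
assert (Hr0 : 0 < r0).
{ apply Cmod_gt_0. intros E. unfold r0 in Hw0. rewrite E in Hw0. rewrite Cmod_0 in Hw0. simpl in Hw0. lra. }
(* [d1] preserves the disc condition [|w|^2 + s <= 2 Re w], [d2] keeps [|w| >= r0 / 2], and [d3]
   gives [|a - 1| <= alpha]. The first two constrain [s], which is at most [2 |tau - 1|]; hence the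
   halves in [delta]. *)
destruct (small_factor (1 + 2 * D + 2 * D * r0 + D ^ 2) (2 * Re w0 - r0 ^ 2)) as [d1 [P1 Q1]]; [nra|lra|].
destruct (small_factor D (r0 / 2)) as [d2 [P2 Q2]]; [lra|lra|].
assert (I0 : 0 < / r0) by (apply Rinv_0_lt_compat, Hr0).
destruct (small_factor (2 + 8 * / r0) alpha) as [d3 [P3 Q3]]; [lra|lra|].
set (delta := Rmin (/ 2) (Rmin (d1 / 2) (Rmin (d2 / 2) d3))).
assert (B0 : delta <= / 2) by apply Rmin_l.
assert (B0' : delta <= Rmin (d1 / 2) (Rmin (d2 / 2) d3)) by apply Rmin_r.
assert (B1 : delta <= d1 / 2) by (apply: (Rle_trans _ _ _ B0'); apply Rmin_l).
assert (B1' : delta <= Rmin (d2 / 2) d3) by (apply: (Rle_trans _ _ _ B0'); apply Rmin_r).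
assert (B2 : delta <= d2 / 2) by (apply: (Rle_trans _ _ _ B1'); apply Rmin_l).
assert (B3 : delta <= d3) by (apply: (Rle_trans _ _ _ B1'); apply Rmin_r).
exists delta. split; [repeat apply Rmin_pos; lra|].
intros tau w Htau Ht Hw.
pose proof (Cmod_one_minus tau) as T1. pose proof (Cmod_ge_0 tau) as T2.
set (t := Cmod (tau - 1)) in *. set (s := (1 - Cmod tau ^ 2)%R) in *.
assert (S0 : 0 < s) by (unfold s; nra).
assert (S1 : s <= 2 * t) by (unfold s; nra).
assert (S2 : s <= 1) by (unfold s; nra).
assert (Q1s := Q1 s ltac:(lra)). assert (Q2s := Q2 s ltac:(lra)). assert (Q3t := Q3 t ltac:(lra)).
assert (W1 : r0 / 2 <= Cmod w).
{ pose proof (Cmod_sub_ge w0 w) as T. replace (w0 - w) with (- (w - w0)) in T by ring.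
  rewrite Cmod_opp in T. fold r0 in T. lra. }
assert (W2 : Cmod w <= r0 + s * D).
{ pose proof (Cmod_sub_ge w w0) as T. fold r0 in T. lra. }
assert (W3 : Re w0 - s * D <= Re w).
{ pose proof (re_le_Cmod (w - w0)) as T. apply Rabs_le_between in T.
  replace (Re (w - w0)) with (Re w - Re w0)%R in T by (destruct w, w0; reflexivity). lra. }
assert (Nt : tau <> 0) by (apply Cmod_gt_0; lra).
assert (Nw : w <> 0) by (apply Cmod_gt_0; lra).
split; [exact Nt|split; [exact Nw|split]].
- apply solve_parameter; try assumption. fold s.
  assert (W4 : Cmod w ^ 2 <= (r0 + s * D) ^ 2) by (apply pow_incr; split; [apply Cmod_ge_0|exact W2]).
  assert (W5 : (s * D) ^ 2 <= s * D ^ 2).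
  { replace ((s * D) ^ 2)%R with (s * (s * D ^ 2))%R by ring.
    assert (0 <= D ^ 2) by apply pow2_ge_0.
    assert (0 <= s * D ^ 2) by (apply Rmult_le_pos; lra). nra. }
  nra.
- replace ((1 - RtoC s / w) / tau - 1) with ((- (tau - 1) + - (RtoC s / w)) / tau) by (field; split; assumption).
  rewrite Cmod_div; [|exact Nt]. apply Rle_div_l; [lra|].
  apply: Rle_trans; [apply Cmod_triangle|]. rewrite !Cmod_opp. fold t.
  unfold Cdiv. rewrite Cmod_mult Cmod_R Rabs_pos_eq; [|lra].
  pose proof (Cmod_inv_le w (r0 / 2) ltac:(lra) W1) as I1.
  replace (/ (r0 / 2))%R with (2 * / r0)%R in I1 by (field; lra).
  pose proof (Cmod_ge_0 (/ w)).
  assert (s * Cmod (/ w) <= 2 * t * (2 * / r0)) by (apply Rmult_le_compat; lra).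
  assert (/ 2 <= Cmod tau) by lra.
  assert (0 <= t) by apply Cmod_ge_0.
  apply Rle_trans with (alpha * / 2)%R; [nra|]. apply Rmult_le_compat_l; lra.
Qed.

Lemma approximating_generator (f : C -> C) (beta : R) (mu : C) (eps : R) :
  generator_plus_one beta f -> Cmod (mu - RtoC beta) <= beta -> mu <> RtoC 0 -> 0 < eps < 1 ->
  exists delta, 0 < delta /\ forall tau, Cmod tau < 1 -> Cmod (tau - 1) < delta ->
    exists g, DW_with_derivative mu tau g /\ forall z, Cmod z <= 1 - eps -> Cmod (g z - f z) < eps.
Proof.
intros Hf Hmu Hmu0 He.
assert (Hbeta : 0 < beta) by apply Hf.
set (q := remainder f beta).
assert (Hq : holo_disc q) by (apply remainder_holo, Hf).
assert (HqRe : forall z, Cmod z < 1 -> 0 <= Re (q z)) by (intros z Hz; apply remainder_nonneg; assumption).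
destruct (holo_bound q (1 - eps) Hq ltac:(lra)) as [Lq [HLq [Bq Lipq]]].
(* The final error is at most [16 e] from the perturbation of [p] and [4 e] from that of the
   quadratic factor, in all [eps / 2]. *)
set (e := (eps / 40)%R). assert (He0 : 0 < e) by (unfold e; lra).
(* Chosen so that [kappa * (beta / 2) * (2 / eps) = e], where [2 / eps] bounds the kernel on
   [|z| <= 1 - eps]. *)
set (kappa := (e * eps / beta)%R).
assert (Hkappa : 0 < kappa) by (unfold kappa; apply Rdiv_lt_0_compat; nra).
set (c := (1 + kappa)%R).
assert (Hc : 1 < c) by (unfold c; lra).
(* The order of choices matters: [rho] is fixed by the Lipschitz constant of [q] on the target disc,
   then [Lr] bounds [q (rho z)] on the whole unit disc, and only then is [tau] restricted. *)
destruct (small_factor Lq e HLq He0) as [d [Hd Hd2]].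
set (rho := (1 - Rmin d (/ 2))%R).
assert (Hm1 : Rmin d (/ 2) <= / 2) by apply Rmin_r.
assert (Hm0 : 0 < Rmin d (/ 2)) by (apply Rmin_pos; lra).
assert (Hm2 : Rmin d (/ 2) * Lq <= e) by (apply Hd2; split; [lra|apply Rmin_l]).
assert (Hrho : 0 <= rho < 1) by (unfold rho; lra).
destruct (holo_bound q rho Hq Hrho) as [Lr [HLr [Br _]]].
assert (Hcb : 0 < c * beta) by (unfold c; nra).
assert (Ncb : RtoC (c * beta) <> 0) by (intros E; apply RtoC_inj in E; lra).
set (w0 := mu / RtoC (c * beta)).
(* Bounds [(w - w0) / s] for the [w] defined below: the first term comes from [Q / (c * beta)], the
   second from the summand [s / 2]. *)
set (D := ((Lr + e) / (c * beta) + / 2)%R).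
assert (HD : 0 <= D).
{ unfold D. assert (0 < (Lr + e) / (c * beta)) by (apply Rdiv_lt_0_compat; lra). lra. }
assert (Hw0 : Cmod w0 ^ 2 < 2 * Re w0).
{ pose proof (disc_Re_bound mu beta Hbeta Hmu) as H1.
  assert (H2 : 0 < Cmod mu) by (apply Cmod_gt_0, Hmu0).
  unfold w0. rewrite Cmod_div; [|exact Ncb]. rewrite Cmod_R Rabs_pos_eq; [|lra].
  unfold Cdiv. rewrite -RtoC_inv; [|lra]. rewrite re_scal_r.
  unfold Rdiv. rewrite Rpow_mult_distr pow_inv.
  apply (Rmult_lt_reg_r ((c * beta) ^ 2)); [apply pow_lt, Hcb|].
  rewrite Rmult_assoc Rinv_l; [|apply pow_nonzero; lra].
  replace (2 * (Re mu * / (c * beta)) * (c * beta) ^ 2)%R with (c * (2 * beta * Re mu))%R by (field; lra).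
  rewrite Rmult_1_r. unfold c. assert (0 < Cmod mu ^ 2) by (apply pow_lt, H2).
  assert (0 < kappa * Cmod mu ^ 2) by (apply Rmult_lt_0_compat; assumption). nra. }
(* Chosen so that [(beta / 2) * (2 / eps^2) * alpha = e], with [2 / eps^2] from [cayley_lip]. *)
set (alpha := (e * eps ^ 2 / beta)%R).
assert (Halpha : 0 < alpha).
{ unfold alpha. apply Rdiv_lt_0_compat; [|exact Hbeta]. apply Rmult_lt_0_compat; [exact He0|apply pow_lt; lra]. }
destruct (perturbed_parameter w0 D alpha HD Halpha Hw0) as [d1 [Hd1 Hpar]].
set (S0 := (beta / eps + Lq)%R).
assert (HS0 : 0 <= S0).
{ unfold S0. assert (0 < beta / eps) by (apply Rdiv_lt_0_compat; lra). lra. }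
destruct (small_factor S0 e HS0 He0) as [d2 [Hd2' HdS]].
exists (Rmin d1 d2). split; [apply Rmin_pos; assumption|].
intros tau Htau Ht.
assert (Ht1 : Cmod (tau - 1) < d1) by (apply: Rlt_le_trans Ht _; apply Rmin_l).
assert (Ht2 : Cmod (tau - 1) < d2) by (apply: Rlt_le_trans Ht _; apply Rmin_r).
assert (Hs : 0 < 1 - Cmod tau ^ 2) by (pose proof (Cmod_ge_0 tau); nra).
assert (Hrz : forall z, Cmod (RtoC rho * z) = (rho * Cmod z)%R).
{ intros z. rewrite Cmod_mult Cmod_R Rabs_pos_eq; [reflexivity|lra]. }
set (Q := q (RtoC rho * tau) + RtoC e).
assert (HQ : Cmod Q <= Lr + e).
{ apply: Rle_trans; [apply Cmod_triangle|]. rewrite Cmod_R Rabs_pos_eq; [|lra].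
  assert (Cmod (q (RtoC rho * tau)) <= Lr); [|lra]. apply Br. rewrite Hrz. nra. }
set (s := (1 - Cmod tau ^ 2)%R) in *.
(* With [w = s / (1 - a * tau)] the kernel at [tau] equals [(2 w - s) / s], and [s * p tau = mu]
   becomes [c beta w - c beta s / 2 + s Q = mu]. *)
set (w := (mu - RtoC s * Q) / RtoC (c * beta) + RtoC (s / 2)).
assert (Hw : Cmod (w - w0) <= s * D).
{ unfold w, w0. replace ((mu - RtoC s * Q) / RtoC (c * beta) + RtoC (s / 2) - mu / RtoC (c * beta))
    with (- (RtoC s * (Q / RtoC (c * beta))) + RtoC (s / 2)) by (field; exact Ncb).
  apply: Rle_trans; [apply Cmod_triangle|].
  rewrite Cmod_opp Cmod_mult Cmod_div; [|exact Ncb]. rewrite !Cmod_R !Rabs_pos_eq; try lra.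
  assert (Cmod Q / (c * beta) <= (Lr + e) / (c * beta)).
  { apply Rmult_le_compat_r; [apply Rlt_le, Rinv_0_lt_compat, Hcb|exact HQ]. }
  unfold D. nra. }
destruct (Hpar tau w Htau Ht1 Hw) as [Nt [Nw [Ha1 Ha2]]]. fold s in Ha1, Ha2.
set (a := (1 - RtoC s / w) / tau) in *.
set (p := fun z => RtoC (c * beta / 2) * cayley a z + (q (RtoC rho * z) + RtoC e)).
exists (fun z => (z - tau) * ((1 - Cconj tau * z) * p z)). split.
- assert (Hrd : forall z, Cmod z < 1 -> Cmod (RtoC rho * z) < 1).
  { intros z Hz. rewrite Hrz. pose proof (Cmod_ge_0 z). nra. }
  apply (berkson_porta_realizes mu tau p e Htau).
  + intros z Hz. apply cdiff_plus.
    * apply cdiff_mult; [apply cdiff_const|apply cayley_holo; assumption].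
    * apply cdiff_plus; [|apply cdiff_const].
      apply (cdiff_comp (fun z => RtoC rho * z) q); [|apply Hq, Hrd, Hz].
      apply cdiff_mult; [apply cdiff_const|apply cdiff_id].
  + exact He0.
  + intros z Hz. unfold p. rewrite re_plus re_scal_l (re_plus (q (RtoC rho * z))) re_RtoC.
    pose proof (cayley_Re a z Ha1 Hz). pose proof (HqRe _ (Hrd z Hz)).
    assert (0 <= c * beta / 2 * Re (cayley a z)) by (apply Rmult_le_pos; lra). lra.
  + fold s. unfold p. fold Q.
    assert (Ea : a * tau = 1 - RtoC s / w) by (unfold a; field; split; assumption).
    assert (Ns : RtoC s <> 0) by (intros E; apply RtoC_inj in E; lra).
    unfold cayley. rewrite Ea.
    assert (Ec : (1 + (1 - RtoC s / w)) / (1 - (1 - RtoC s / w)) = (2 * w - RtoC s) / RtoC s).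
    { replace (1 - (1 - RtoC s / w)) with (RtoC s / w) by ring. field. split; assumption. }
    rewrite Ec. unfold w.
    replace (RtoC (c * beta / 2)) with (RtoC (c * beta) / 2) by (rewrite RtoC_div; [reflexivity|lra]).
    replace (RtoC (s / 2)) with (RtoC s / 2) by (rewrite RtoC_div; [reflexivity|lra]).
    field. split; assumption.
- intros z Hz. assert (Hz1 : Cmod z < 1) by lra. pose proof (Cmod_ge_0 z) as Hz0.
  rewrite {1}(remainder_decomposition f beta z Hz1). fold q.
  set (S := RtoC (beta / 2) * cayley 1 z + q z).
  assert (HS : Cmod S <= S0).
  { apply: Rle_trans; [apply Cmod_triangle|]. rewrite Cmod_mult Cmod_R Rabs_pos_eq; [|lra].
    pose proof (cayley_bound 1 z eps ltac:(rewrite Cmod_1; lra) Hz ltac:(lra)) as K1.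
    pose proof (Bq z Hz). unfold S0.
    replace (beta / eps)%R with (beta / 2 * (2 / eps))%R by (field; lra).
    apply Rplus_le_compat; [apply Rmult_le_compat_l; lra|assumption]. }
  set (E := RtoC (kappa * (beta / 2)) * cayley a z
    + (RtoC (beta / 2) * (cayley a z - cayley 1 z) + ((q (RtoC rho * z) - q z) + RtoC e))).
  assert (Ep : p z = S + E).
  { unfold p, S, E, c. replace ((1 + kappa) * beta / 2)%R with (beta / 2 + kappa * (beta / 2))%R by field.
    rewrite RtoC_plus. ring. }
  assert (HE : Cmod E <= 4 * e).
  { unfold E.
    assert (E1 : Cmod (RtoC (kappa * (beta / 2)) * cayley a z) <= e).
    { rewrite Cmod_mult Cmod_R Rabs_pos_eq; [|nra].
      pose proof (cayley_bound a z eps Ha1 Hz ltac:(lra)) as K1.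
      apply Rle_trans with (kappa * (beta / 2) * (2 / eps))%R; [apply Rmult_le_compat_l; [nra|exact K1]|].
      unfold kappa. right. field. lra. }
    assert (E2 : Cmod (RtoC (beta / 2) * (cayley a z - cayley 1 z)) <= e).
    { rewrite Cmod_mult Cmod_R Rabs_pos_eq; [|lra].
      pose proof (cayley_lip a z eps Ha1 Hz ltac:(lra)) as K1.
      apply Rle_trans with (beta / 2 * (2 / eps ^ 2 * alpha))%R.
      - apply Rmult_le_compat_l; [lra|]. apply: Rle_trans; [exact K1|].
        apply Rmult_le_compat_l; [|exact Ha2].
        apply Rlt_le, Rdiv_lt_0_compat; [lra|apply pow_lt; lra].
      - unfold alpha. right. field. lra. }
    assert (E3 : Cmod (q (RtoC rho * z) - q z) <= e).
    { apply: Rle_trans; [apply Lipq; [rewrite Hrz; nra|exact Hz]|].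
      replace (RtoC rho * z - z) with (RtoC (- Rmin d (/ 2)) * z).
      - rewrite Cmod_mult Cmod_R Rabs_Ropp Rabs_pos_eq; [|lra].
        assert (Rmin d (/ 2) * Cmod z <= Rmin d (/ 2)) by nra. nra.
      - unfold rho. rewrite RtoC_minus RtoC_opp. ring. }
    apply: Rle_trans; [apply Cmod_triangle|].
    apply: Rle_trans; [apply Rplus_le_compat_l, Cmod_triangle|].
    apply: Rle_trans; [apply Rplus_le_compat_l, Rplus_le_compat_l, Cmod_triangle|].
    rewrite (Cmod_R e) Rabs_pos_eq; lra. }
  rewrite Ep.
  (* The error splits into that of [p], which is [E], and that of the quadratic factor, which is at
     most [4 |tau - 1|] because each of its two terms contains [1 - tau] or its conjugate. *)
  replace ((z - tau) * ((1 - Cconj tau * z) * (S + E)) - - ((1 - z) * (1 - z)) * S)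
    with ((z - tau) * (1 - Cconj tau * z) * E
      + ((1 - tau) * (1 - Cconj tau * z) + (z - 1) * ((1 - Cconj tau) * z)) * S) by ring.
  assert (X1 : Cmod (1 - Cconj tau * z) <= 2).
  { apply: Rle_trans; [apply Cmod_triangle|]. rewrite Cmod_opp Cmod_mult Cmod_conj Cmod_1.
    pose proof (Cmod_ge_0 tau). nra. }
  assert (X2 : Cmod (z - tau) <= 2).
  { apply: Rle_trans; [apply Cmod_triangle|]. rewrite Cmod_opp. lra. }
  assert (X3 : Cmod (z - 1) <= 2).
  { apply: Rle_trans; [apply Cmod_triangle|]. rewrite Cmod_opp Cmod_1. lra. }
  assert (X4 : Cmod (1 - tau) = Cmod (tau - 1)).
  { replace (1 - tau) with (- (tau - 1)) by ring. apply Cmod_opp. }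
  assert (X5 : Cmod (1 - Cconj tau) = Cmod (tau - 1)).
  { rewrite -X4 -(Cmod_conj (1 - tau)) Cminus_conj. do 2 f_equal. apply injective_projections; simpl; ring. }
  pose proof (HdS (Cmod (tau - 1)) ltac:(split; [apply Cmod_ge_0|lra])) as X6.
  apply: Rle_lt_trans; [apply Cmod_triangle|]. rewrite !Cmod_mult.
  pose proof (Cmod_triangle ((1 - tau) * (1 - Cconj tau * z)) ((z - 1) * ((1 - Cconj tau) * z))) as X7.
  rewrite !Cmod_mult X4 X5 in X7.
  set (t := Cmod (tau - 1)) in *. assert (T0 : 0 <= t) by apply Cmod_ge_0.
  set (A1 := Cmod (1 - Cconj tau * z)) in *. assert (A1p : 0 <= A1) by apply Cmod_ge_0.
  set (A2 := Cmod (z - tau)) in *. assert (A2p : 0 <= A2) by apply Cmod_ge_0.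
  set (A3 := Cmod (z - 1)) in *. assert (A3p : 0 <= A3) by apply Cmod_ge_0.
  assert (Y1 : A2 * A1 * Cmod E <= (2 * 2) * (4 * e)).
  { apply Rmult_le_compat; [nra|apply Cmod_ge_0|nra|exact HE]. }
  assert (Y2 : t * A1 + A3 * (t * Cmod z) <= 4 * t).
  { assert (t * Cmod z <= t * 1) by (apply Rmult_le_compat_l; lra).
    assert (0 <= t * Cmod z) by (apply Rmult_le_pos; lra). nra. }
  assert (Y3 : Cmod ((1 - tau) * (1 - Cconj tau * z) + (z - 1) * ((1 - Cconj tau) * z)) * Cmod S <= 4 * t * S0).
  { apply Rmult_le_compat; [apply Cmod_ge_0|apply Cmod_ge_0|lra|exact HS]. }
  unfold e in *. lra.
Qed.

(** * From fixed accuracy to a single family *)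

Lemma dyadic_decreasing (n m : nat) : (n <= m)%nat -> dyadic m <= dyadic n.
Proof.
intros H. unfold dyadic. replace (S m) with (S n + (m - n))%nat by lia. rewrite pow_add.
assert (0 < (/ 2) ^ S n) by (apply pow_lt; lra).
assert ((/ 2) ^ (m - n) <= 1) by (rewrite -(pow1 (m - n)); apply pow_incr; lra). nra.
Qed.

Lemma dyadic_eventually (eps : R) : 0 < eps -> exists N, forall n, (N <= n)%nat -> dyadic n < eps.
Proof.
intros He. pose proof dyadic_lim as H. apply is_lim_seq_spec in H.
destruct (H (mkposreal _ He)) as [N HN]. exists N. intros n Hn. specialize (HN n Hn).
simpl in HN. rewrite Rminus_0_r Rabs_pos_eq in HN; [exact HN|apply Rlt_le, dyadic_pos].
Qed.

(** The open discs of radius [1 - dyadic n] increase and exhaust the unit disc, so the largest index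
    of a finite subcover serves for all of [K]. *)
Lemma compact_in_disc (K : C -> Prop) : compact_set K -> (forall z, K z -> unit_disc z) ->
  exists N, forall z, K z -> Cmod z <= 1 - dyadic N.
Proof.
intros HK Hd.
destruct (HK nat (fun n z => Cmod z < 1 - dyadic n)) as [l Hl].
- intros n z Hz. apply locally_Cmod. exists (1 - dyadic n - Cmod z)%R. split; [lra|].
  intros w Hw. pose proof (Cmod_sub_ge w z). lra.
- intros z Hz. specialize (Hd z Hz). unfold unit_disc in Hd.
  destruct (dyadic_eventually (1 - Cmod z) ltac:(lra)) as [N HN]. exists N. specialize (HN N (le_n _)). lra.
- exists (list_max l). intros z Hz. destruct (Hl z Hz) as [n [Hn Hzn]].
  assert (Hle : (n <= list_max l)%nat).
  { pose proof (proj1 (list_max_le l (list_max l)) (le_n _)) as F. rewrite Forall_forall in F. auto. }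
  pose proof (dyadic_decreasing n _ Hle). lra.
Qed.

(* For each [tau] one generator is chosen that realises the best of the
   finitely many approximation levels compatible with [|tau - 1|]. *)
Lemma generator_family (f : C -> C) (beta : R) (mu : C) :
  generator_plus_one beta f -> Cmod (mu - RtoC beta) <= beta -> mu <> RtoC 0 ->
  exists f_ : C -> C -> C,
    (forall tau, unit_disc tau ->
       generator_DW tau (f_ tau) /\ @is_derive C_AbsRing C_NormedModule (f_ tau) tau mu) /\
    locally_uniform_lim f_ f (RtoC 1).
Proof.
intros Hf Hmu Hmu0.
assert (Hbeta : 0 < beta) by apply Hf.
assert (HRe : 0 < Re mu).
{ pose proof (disc_Re_bound mu beta Hbeta Hmu). assert (0 < Cmod mu) by (apply Cmod_gt_0, Hmu0). nra. }
(* One index governs both the subdisc and the accuracy, so [close] is monotone in [n] and a single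
   level answers to any [K] and [eps]. *)
set (close := fun (n : nat) (g : C -> C) => forall z, Cmod z <= 1 - dyadic n -> Cmod (g z - f z) < dyadic n).
assert (Hmono : forall n m g, (n <= m)%nat -> close m g -> close n g).
{ intros n m g Hnm Hg z Hz. pose proof (dyadic_decreasing n m Hnm).
  apply Rlt_le_trans with (dyadic m); [apply Hg; lra|lra]. }
assert (Hlevel : forall tau, Cmod tau < 1 -> forall N, exists g, DW_with_derivative mu tau g /\
  forall n, (n <= N)%nat -> (exists g', DW_with_derivative mu tau g' /\ close n g') -> close n g).
{ intros tau Htau N. induction N as [|N [g [Hg IH]]].
  - destruct (classic (exists g', DW_with_derivative mu tau g' /\ close O g')) as [[g [Hg Hc]]|Hno].
    + exists g. split; [exact Hg|]. intros n Hn _. replace n with O by lia. exact Hc.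
    + destruct (realizing_generator_exists mu tau HRe Htau) as [g Hg]. exists g. split; [exact Hg|].
      intros n Hn Hex. replace n with O in * by lia. contradiction.
  - destruct (classic (exists g', DW_with_derivative mu tau g' /\ close (S N) g')) as [[g' [Hg' Hc]]|Hno].
    + exists g'. split; [exact Hg'|]. intros n Hn _. exact (Hmono n (S N) g' Hn Hc).
    + exists g. split; [exact Hg|]. intros n Hn Hex.
      destruct (Nat.eq_dec n (S N)) as [->|Hne]; [contradiction|]. apply IH; [lia|exact Hex]. }
assert (Hchoice : forall tau, exists g, Cmod tau < 1 -> DW_with_derivative mu tau g /\
  forall n, Cmod (tau - 1) < dyadic n -> (exists g', DW_with_derivative mu tau g' /\ close n g') -> close n g).
{ intros tau. destruct (Rlt_dec (Cmod tau) 1) as [Htau|Hno]; [|exists f; contradiction].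
  (* Since [tau] is not [1], only finitely many [n] satisfy [|tau - 1| < dyadic n]. This is what
     makes a best level exist. *)
  assert (Hpos : 0 < Cmod (tau - 1)) by (pose proof (Cmod_one_minus tau); lra).
  destruct (dyadic_eventually _ Hpos) as [N HN].
  destruct (Hlevel tau Htau N) as [g [Hg H]]. exists g. intros _. split; [exact Hg|].
  intros n Hn. apply H. destruct (Nat.le_gt_cases n N) as [Hle|Hlt]; [exact Hle|].
  pose proof (HN n ltac:(lia)). lra. }
set (f_ := fun tau => proj1_sig (constructive_indefinite_description _ (Hchoice tau))).
assert (Hf_ : forall tau, Cmod tau < 1 -> DW_with_derivative mu tau (f_ tau) /\
  forall n, Cmod (tau - 1) < dyadic n -> (exists g', DW_with_derivative mu tau g' /\ close n g') -> close n (f_ tau)).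
{ intros tau. exact (proj2_sig (constructive_indefinite_description _ (Hchoice tau))). }
clearbody f_.
exists f_. split; [intros tau Htau; apply (Hf_ tau Htau)|].
intros K HK HKd eps Heps.
destruct (compact_in_disc K HK HKd) as [N1 HN1].
destruct (dyadic_eventually eps Heps) as [N2 HN2].
set (n := Nat.max N1 N2).
destruct (approximating_generator f beta mu (dyadic n) Hf Hmu Hmu0) as [d [Hd Happ]].
{ split; [apply dyadic_pos|apply dyadic_lt_1]. }
apply locally_Cmod. exists (Rmin d (dyadic n)). split; [apply Rmin_pos; [exact Hd|apply dyadic_pos]|].
intros tau Ht Htau z Hz.
assert (Ht1 : Cmod (tau - 1) < d) by (apply: Rlt_le_trans Ht _; apply Rmin_l).
assert (Ht2 : Cmod (tau - 1) < dyadic n) by (apply: Rlt_le_trans Ht _; apply Rmin_r).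
destruct (Hf_ tau Htau) as [_ H].
apply Rlt_trans with (dyadic n).
(* [Happ] shows that level [n] is attainable at this [tau], so the chosen generator attains it as
   well. *)
- apply (H n Ht2 (Happ tau Htau Ht1)).
  pose proof (HN1 z Hz). pose proof (dyadic_decreasing N1 n ltac:(lia)). lra.
- apply HN2. lia.
Qed.

Theorem theorem3p2 (f : C -> C) (beta : R) (hf : generator_plus_one beta f) :
  (forall mu : C, (Cmod (mu - RtoC beta) <= beta)%R -> mu <> RtoC 0 ->
     exists f_ : C -> C -> C,
       (forall tau : C, unit_disc tau ->
          generator_DW tau (f_ tau) /\
          @is_derive C_AbsRing C_NormedModule (f_ tau) tau mu) /\
       locally_uniform_lim f_ f (RtoC 1)) /\
  (exists f_ : C -> C -> C,
     (forall tau : C, unit_disc tau ->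
        generator_DW tau (f_ tau) /\
        @is_derive C_AbsRing C_NormedModule (f_ tau) tau (RtoC beta)) /\
     locally_uniform_lim f_ f (RtoC 1)).
Proof.
split.
- intros mu Hmu Hmu0. exact (generator_family f beta mu hf Hmu Hmu0).
- assert (Hbeta : 0 < beta) by apply hf.
  apply (generator_family f beta (RtoC beta) hf).
  + replace (RtoC beta - RtoC beta) with (RtoC 0) by ring. rewrite Cmod_0. lra.
  + intros E. apply RtoC_inj in E. lra.
Qed.
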